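(* Let $\mathcal C_\bullet$ be an $S_\bullet$-category. There is a universal determinant functor $\det\colon\mathcal C_\bullet\to\Gamma\mathcal D_*(\mathcal C_\bullet)$ defined by $\det(X)=[X]$ for any object of $\mathcal C_1$; $\det(X\xrightarrow{\sim}X')=([X'],[X\xrightarrow{\sim}X'])$ for any weak equivalence in $\mathcal C_1$; $\det(\Delta)=([d_1\Delta],[\Delta])$ for any object $\Delta$ of $\mathcal C_2$. This determinant functor is strict. Moreover, for any stable quadratic module $C_*$, the functor $$\mathrm{Hom}(\mathcal D_*(\mathcal C_\bullet),C_* )\longrightarrow\mathrm{Det}_s(\mathcal C_\bullet,\Gamma C_* ),\qquad\varphi\mapsto(\Gamma\varphi)\circ\det,$$ is an isomorphism of groupoids, where the source is the morphism groupoid in the $2$-category of stable quadratic modules.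
   Context: An $S_\bullet$-category $\mathcal C_\bullet$ is a simplicial category with $\mathcal C_0=*$ terminal, each $\mathcal C_n$ having finite coproducts preserved by faces $d_i$ and degeneracies $s_i$ (so $s_0^n( * )$ is initial in $\mathcal C_n$), with a simplicial subcategory $\mathrm{we}\,\mathcal C_\bullet$ of weak equivalences, containing all isomorphisms and closed under finite coproducts. A Picard groupoid is a symmetric monoidal groupoid in which tensoring with any object is an equivalence (constraints ass, comm; unit $I$). A determinant functor $\det\colon\mathcal C_\bullet\to\mathcal P$ to a Picard groupoid is a functor $\det\colon\mathrm{we}\,\mathcal C_1\to\mathcal P$ with morphisms $\det(\Delta)\colon\det(d_0\Delta)\otimes\det(d_2\Delta)\to\det(d_1\Delta)$ for every object $\Delta$ of $\mathcal C_2$, natural in $\mathrm{we}\,\mathcal C_2$, such that: (1) for every object $\Theta$ of $\mathcal C_3$, $\det(d_1\Theta)\circ(1\otimes\det(d_3\Theta))=\det(d_2\Theta)\circ(\det(d_0\Theta)\otimes1)\circ\mathrm{ass}$ on $\det(d_0d_1\Theta)\otimes(\det(d_0d_3\Theta)\otimes\det(d_2d_3\Theta))$; (2) for objects $X,Y$ of $\mathcal C_1$ with coproduct $X\sqcup Y$, $\det(s_1X\sqcup s_0Y)=\det(s_0X\sqcup s_1Y)\circ\mathrm{comm}\colon\det(Y)\otimes\det(X)\to\det(X\sqcup Y)$. Morphisms of determinant functors are natural transformations compatible with the $\det(\Delta)$; they form a groupoid $\mathrm{Det}(\mathcal C_\bullet,\mathcal P)$. If $\mathcal P$ is strict (associativity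 and unit isomorphisms are identities, and every object has a strict inverse), $\det$ is strict if $\det(s_0( * ))=I$ and $\det(s_0^2( * ))=1_I$; $\mathrm{Det}_s$ denotes the full subgroupoid of strict ones. Composition with symmetric tensor functors $f$ (using $f(\det\Delta)\circ\mathrm{mult}$ as additivity data) and with tensor natural transformations makes $\mathrm{Det}(\mathcal C_\bullet,-)$ $2$-functorial. $\det\colon\mathcal C_\bullet\to V$ is universal if $-\circ\det\colon\mathrm{Hom}^\otimes_c(V,\mathcal P)\to\mathrm{Det}(\mathcal C_\bullet,\mathcal P)$ is an equivalence for every Picard groupoid $\mathcal P$, where $\mathrm{Hom}^\otimes_c$ is the groupoid of symmetric tensor functors and tensor natural transformations. Stable quadratic modules. Groups are additive, $[x,y]=-x-y+x+y$. A stable quadratic module $C_*$ consists of homomorphisms $C_0^{ab}\otimes C_0^{ab}\xrightarrow{\langle\cdot,\cdot\rangle}C_1\xrightarrow{\partial}C_0$ with $\langle c_0,c_0'\rangle+\langle c_0',c_0\rangle=0$, $\partial\langle c_0,c_0'\rangle=[c_0',c_0]$, $\langle\partial c_1,\partial c_1'\rangle=[c_1',c_1]$; $C_0$ acts on $C_1$ by $c_1^{c_0}=c_1+\langle c_0,\partial c_1\rangle$. Morphisms are pairs of homomorphisms compatible with $\partial$ and bracket; a homotopy $\alpha\colon f\Rightarrow g$ is a function $\alpha\colon C_0\to D_1$ with $\alpha(c_0+c_0')=\alpha(c_0)^{g_0(c_0')}+\alpha(c_0')$, $\partial\alpha(c_0)=-g_0(c_0)+f_0(c_0)$, $\alpha\partial(c_1)=-g_1(c_1)+f_1(c_1)$.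 They form a $2$-category. $\Gamma C_*$ is the strict Picard groupoid with object set $C_0$, morphisms $(c_0,c_1)\colon c_0+\partial c_1\to c_0$, composition $(c_0,c_1)\circ(c_0+\partial c_1,c_1')=(c_0,c_1+c_1')$, tensor product $+$ on objects and $(c_0,c_1)+(c_0',c_1')=(c_0+c_0',c_1^{c_0'}+c_1')$ on morphisms, unit $0$, symmetry $(c_0'+c_0,\langle c_0',c_0\rangle)$; $\Gamma f$ is given by $f_0,f_1$, and $(\Gamma\alpha)(c_0)=(g_0(c_0),\alpha(c_0))$. $\mathcal D_*(\mathcal C_\bullet)$ is the stable quadratic module presented by generators $[X]$ (degree $0$) for objects of $\mathcal C_1$, $[X\xrightarrow{\sim}X']$ (degree $1$) for weak equivalences in $\mathcal C_1$, $[\Delta]$ (degree $1$) for objects of $\mathcal C_2$, and relations: $\partial[X\xrightarrow\sim X']=-[X']+[X]$; $\partial[\Delta]=-[d_1\Delta]+[d_0\Delta]+[d_2\Delta]$; $[s_0( * )]=0$; $[1_X]=0$; $[s_0X]=0=[s_1X]$; $[X\xrightarrow\sim Z]=[Y\xrightarrow\sim Z]+[X\xrightarrow\sim Y]$ for composable weak equivalences; $[d_2\Phi]+[d_0\Phi]^{[d_2\Delta]}=-[\Delta']+[d_1\Phi]+[\Delta]$ for weak equivalences $\Phi\colon\Delta\to\Delta'$ in $\mathcal C_2$; $[d_1\Theta]+[d_3\Theta]=[d_2\Theta]+[d_0\Theta]^{[d_2d_3\Theta]}$ for objects $\Theta$ of $\mathcal C_3$; $\langle[X],[Y]\rangle=-[s_0X\sqcup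 s_1Y]+[s_1X\sqcup s_0Y]$ for objects $X,Y$ of $\mathcal C_1$. *)

(* Defs.v *)
From HB Require Import structures.
From mathcomp Require Import all_boot.
From mathcomp Require Import boolp.

Set Implicit Arguments.
Unset Strict Implicit.
Unset Printing Implicit Defensive.

Declare Scope cat_scope.
Delimit Scope cat_scope with cat.
Local Open Scope cat_scope.

Local Obligation Tactic := idtac.

(** * Categories *)

Record category := Category {
  ob :> Type;
  hom : ob -> ob -> Type;
  idm : forall x, hom x x;
  cmp : forall x y z, hom y z -> hom x y -> hom x z;
  cmp1m : forall x y (f : hom x y), cmp (idm y) f = f;
  cmpm1 : forall x y (f : hom x y), cmp f (idm x) = f;
  cmpA : forall x y z t (h : hom z t) (g : hom y z) (f : hom x y),
    cmp h (cmp g f) = cmp (cmp h g) f }.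

Arguments hom {c} x y.
Arguments idm {c} x.
Arguments cmp {c x y z} g f.

Notation "g ∘ f" := (cmp g f) (at level 40, left associativity) : cat_scope.

(* The identity morphism, seen between two objects that are equal but not
   syntactically so. *)
Definition eqm (C : category) (x y : C) (e : x = y) : hom x y :=
  match e in _ = z return hom x z with erefl => idm x end.

Definition is_identity (C : category) (x y : C) (f : hom x y) : Prop :=
  exists e : x = y, f = eqm e.

Definition is_iso (C : category) (x y : C) (f : hom x y) : Prop :=
  exists g : hom y x, g ∘ f = idm x /\ f ∘ g = idm y.

Definition is_groupoid (C : category) : Prop :=
  forall (x y : C) (f : hom x y), is_iso f.

Record functor (C D : category) := Functor {
  fob :> C -> D;
  fmap : forall x y, hom x y -> hom (fob x) (fob y);
  fmap1 : forall x, fmap (idm x) = idm (fob x);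
  fmapM : forall x y z (g : hom y z) (f : hom x y),
    fmap (g ∘ f) = fmap g ∘ fmap f }.

Arguments fmap {C D} _ {x y} _.

Definition idF (C : category) : functor C C :=
  {| fob := fun x => x; fmap := fun _ _ f => f;
     fmap1 := fun _ => erefl; fmapM := fun _ _ _ _ _ => erefl |}.

Program Definition compF (C D E : category) (G : functor D E) (F : functor C D)
  : functor C E :=
  {| fob := fun x => G (F x); fmap := fun _ _ f => fmap G (fmap F f) |}.
Next Obligation. by move=> C D E G F x /=; rewrite !fmap1. Qed.
Next Obligation. by move=> C D E G F x y z g f /=; rewrite !fmapM. Qed.

Definition nat_iso (C D : category) (F G : functor C D) : Prop :=
  exists t : forall x, hom (F x) (G x),
    (forall x y (f : hom x y), t y ∘ fmap F f = fmap G f ∘ t x) /\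
    (forall x, is_iso (t x)).

Definition is_equivalence (C D : category) (F : functor C D) : Prop :=
  exists G : functor D C,
    nat_iso (compF G F) (idF C) /\ nat_iso (compF F G) (idF D).

Definition is_isomorphism (C D : category) (F : functor C D) : Prop :=
  exists G : functor D C, compF G F = idF C /\ compF F G = idF D.

Program Definition full_sub (C : category) (P : C -> Prop) : category :=
  {| ob := {x : C | P x};
     hom := fun x y => hom (sval x) (sval y);
     idm := fun x => idm (sval x);
     cmp := fun _ _ _ g f => g ∘ f |}.
Next Obligation. by move=> * /=; rewrite cmp1m. Qed.
Next Obligation. by move=> * /=; rewrite cmpm1. Qed.
Next Obligation. by move=> * /=; rewrite cmpA. Qed.

Definition lift_full (C D : category) (P : D -> Prop) (F : functor C D)
  (FP : forall x, P (F x)) : functor C (full_sub P) :=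
  {| fob := fun x => exist _ (F x) (FP x) : full_sub P;
     fmap := fun _ _ f => fmap F f;
     fmap1 := fmap1 F;
     fmapM := fun x y z g f => fmapM F g f |}.

Section CategoryTheory.
Variable C : category.

Lemma eqm_irr (x y : C) (e e' : x = y) : eqm e = eqm e'.
Proof. by rewrite (Prop_irrelevance e e'). Qed.

Lemma eqm1 (x : C) (e : x = x) : eqm e = idm x.
Proof. by rewrite (Prop_irrelevance e erefl). Qed.

Lemma eqm_trans (x y z : C) (e : x = y) (e' : y = z) :
  eqm e' ∘ eqm e = eqm (etrans e e').
Proof. by case: z / e'; rewrite cmp1m. Qed.

Lemma is_identity_cmp (x y z : C) (g : hom y z) (f : hom x y) :
  is_identity g -> is_identity f -> is_identity (g ∘ f).
Proof. by case=> e -> [e' ->]; rewrite eqm_trans; exists (etrans e' e). Qed.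

Lemma eqm_iso (x y : C) (e : x = y) : is_iso (eqm e).
Proof. by exists (eqm (esym e)); case: y / e; rewrite /= cmp1m. Qed.

Lemma is_iso_cmp (x y z : C) (g : hom y z) (f : hom x y) :
  is_iso g -> is_iso f -> is_iso (g ∘ f).
Proof.
move=> [g' [g'g gg']] [f' [f'f ff']]; exists (f' ∘ g'); split.
  by rewrite cmpA -(cmpA f') g'g cmpm1.
by rewrite cmpA -(cmpA g) ff' cmpm1.
Qed.

End CategoryTheory.

Lemma fmap_eqm (C D : category) (F : functor C D) (x y : C) (e : x = y) :
  fmap F (eqm e) = eqm (congr1 F e).
Proof. by case: y / e; rewrite /= fmap1. Qed.

Lemma fmap_iso (C D : category) (F : functor C D) (x y : C) (f : hom x y) :
  is_iso f -> is_iso (fmap F f).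
Proof. by move=> [g [gf fg]]; exists (fmap F g); rewrite -!fmapM gf fg !fmap1. Qed.

(** ** Finite coproducts *)

Definition is_initial (C : category) (x : C) : Prop :=
  forall y : C, exists f : hom x y, forall g : hom x y, g = f.

Definition is_coproduct (C : category) (X Y Z : C) (i : hom X Z) (j : hom Y Z)
  : Prop :=
  forall (T : C) (f : hom X T) (g : hom Y T),
    exists! h : hom Z T, h ∘ i = f /\ h ∘ j = g.

Definition has_finite_coproducts (C : category) : Prop :=
  (exists x : C, is_initial x) /\
  (forall X Y : C, exists (Z : C) (i : hom X Z) (j : hom Y Z),
     is_coproduct i j).

Definition preserves_finite_coproducts (C D : category) (F : functor C D)
  : Prop :=
  (forall x : C, is_initial x -> is_initial (F x)) /\
  (forall (X Y Z : C) (i : hom X Z) (j : hom Y Z),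
     is_coproduct i j -> is_coproduct (fmap F i) (fmap F j)).

Record coproduct (C : category) (X Y : C) := Coproduct {
  cpo :> C;
  cpl : hom X cpo;
  cpr : hom Y cpo;
  cpP : is_coproduct cpl cpr }.

Lemma is_coproduct_sym (C : category) (X Y Z : C) (i : hom X Z) (j : hom Y Z) :
  is_coproduct i j -> is_coproduct j i.
Proof.
move=> ijP T f g; have [h [[hi hj] hU]] := ijP T g f.
by exists h; split=> // h' [h'j h'i]; apply: hU.
Qed.

Definition cp_swap (C : category) (X Y : C) (Z : coproduct X Y) : coproduct Y X :=
  Coproduct (is_coproduct_sym (cpP Z)).

Section CoproductTheory.
Variable C : category.

Lemma coproduct_iso (X Y Z Z' : C) (i : hom X Z) (j : hom Y Z)
    (i' : hom X Z') (j' : hom Y Z') (w : hom Z Z') :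
  is_coproduct i j -> is_coproduct i' j' ->
  w ∘ i = i' -> w ∘ j = j' -> is_iso w.
Proof.
move=> ijP ijP' wi wj; have [v [[vi vj] _]] := ijP' _ i j.
exists v; split.
  have [u [_ uU]] := ijP _ i j.
  rewrite -(uU (v ∘ w)) ?(uU (idm Z)) //; first by rewrite !cmp1m.
  by rewrite -!cmpA wi wj.
have [u [_ uU]] := ijP' _ i' j'.
rewrite -(uU (w ∘ v)) ?(uU (idm Z')) //; first by rewrite !cmp1m.
by rewrite -!cmpA vi vj.
Qed.

Lemma coproduct_eqm (X Y X' Y' Z : C) (i : hom X Z) (j : hom Y Z)
    (e : X' = X) (e' : Y' = Y) :
  is_coproduct i j -> is_coproduct (i ∘ eqm e) (j ∘ eqm e').
Proof. by case: X / e i; case: Y / e' j => i j; rewrite /= !cmpm1. Qed.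

Lemma coproduct_initial_l (X Y Z : C) (i : hom X Z) (j : hom Y Z) :
  is_initial X -> is_coproduct i j -> is_iso j.
Proof.
move=> X0 ijP; have [f _] := X0 Y.
have [h [[hi hj] _]] := ijP _ f (idm Y).
exists h; split=> //.
have [u [_ uU]] := ijP _ i j; have [k kU] := X0 Z.
rewrite -(uU (j ∘ h)) ?(uU (idm Z)) //; first by rewrite !cmp1m.
split; first by rewrite (kU (_ ∘ i)) (kU i).
by rewrite -cmpA hj cmpm1.
Qed.

End CoproductTheory.

(** * Simplicial categories and S•-categories *)

(* The indices of faces and degeneracies are ordinals: [lift ord0 j] has value [j + 1] and
   [widen_ord (leqnSn _) i] has value [i]. *)
Record simplicial_category := SimplicialCategory {
  scat :> nat -> category;
  face : forall n, 'I_n.+2 -> functor (scat n.+1) (scat n);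
  degen : forall n, 'I_n.+1 -> functor (scat n) (scat n.+1);
  face_face : forall n (i j : 'I_n.+2), i <= j ->
    compF (face i) (face (lift ord0 j)) =
    compF (face j) (face (widen_ord (leqnSn _) i));
  degen_degen : forall n (i j : 'I_n.+1), i <= j ->
    compF (degen (widen_ord (leqnSn _) i)) (degen j) =
    compF (degen (lift ord0 j)) (degen i);
  face_degen_lt : forall n (i : 'I_n.+2) (j : 'I_n.+1), i <= j ->
    compF (face (widen_ord (leqnSn _) i)) (degen (lift ord0 j)) =
    compF (degen j) (face i);
  face_degen_gt : forall n (i : 'I_n.+2) (j : 'I_n.+1), j < i ->
    compF (face (lift ord0 i)) (degen (widen_ord (leqnSn _) j)) =
    compF (degen j) (face i);
  face_degen_l : forall n (i : 'I_n.+1),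
    compF (face (widen_ord (leqnSn _) i)) (degen i) = idF (scat n);
  face_degen_r : forall n (i : 'I_n.+1),
    compF (face (lift ord0 i)) (degen i) = idF (scat n) }.

Arguments face {s n} _.
Arguments degen {s n} _.

Record S_category := SCategory {
  ssc :> simplicial_category;
  pt : ssc 0;
  ptP : forall x : ssc 0, x = pt;
  pt_hom : forall (x y : ssc 0) (f g : hom x y), f = g;
  coprodP : forall n, has_finite_coproducts (ssc n);
  face_coprod : forall n (i : 'I_n.+2),
    preserves_finite_coproducts (@face ssc n i);
  degen_coprod : forall n (i : 'I_n.+1),
    preserves_finite_coproducts (@degen ssc n i);
  weq : forall n (x y : ssc n), hom x y -> Prop;
  weq_iso : forall n (x y : ssc n) (f : hom x y), is_iso f -> weq f;
  weq_cmp : forall n (x y z : ssc n) (g : hom y z) (f : hom x y),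
    weq g -> weq f -> weq (g ∘ f);
  weq_face : forall n (i : 'I_n.+2) (x y : ssc n.+1) (f : hom x y),
    weq f -> weq (fmap (face i) f);
  weq_degen : forall n (i : 'I_n.+1) (x y : ssc n) (f : hom x y),
    weq f -> weq (fmap (degen i) f);
  weq_coprod : forall n (X Y Z X' Y' Z' : ssc n)
    (i : hom X Z) (j : hom Y Z) (i' : hom X' Z') (j' : hom Y' Z')
    (f : hom X X') (g : hom Y Y') (h : hom Z Z'),
    is_coproduct i j -> is_coproduct i' j' ->
    h ∘ i = i' ∘ f -> h ∘ j = j' ∘ g ->
    weq f -> weq g -> weq h }.

Definition ord1 n : 'I_n.+2 := lift ord0 ord0.
Definition ord2 n : 'I_n.+3 := lift ord0 (ord1 n).
Definition ord3 n : 'I_n.+4 := lift ord0 (ord2 n).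

Notation d0 := (face ord0).
Notation d1 := (face (ord1 _)).
Notation d2 := (face (ord2 _)).
Notation d3 := (face (ord3 _)).
Notation s0 := (degen ord0).
Notation s1 := (degen (ord1 _)).

Section SCategoryTheory.
Variable C : S_category.

Lemma d0d1 n (T : C n.+2) : d0 (d1 T) = d0 (d0 T).
Proof.
have := congr1 (fun F : functor _ _ => F T) (face_face C (leqnn (@ord0 n.+1))).
by rewrite /= (_ : widen_ord _ _ = ord0) //; apply: val_inj.
Qed.

Lemma d0d2 n (T : C n.+2) : d0 (d2 T) = d1 (d0 T).
Proof.
have H : @ord0 n.+1 <= ord1 n by [].
have := congr1 (fun F : functor _ _ => F T) (face_face C H).
by rewrite /= (_ : widen_ord _ _ = ord0) //; apply: val_inj.
Qed.

Lemma d0d3 n (T : C n.+3) : d0 (d3 T) = d2 (d0 T).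
Proof.
have H : @ord0 n.+2 <= ord2 n by [].
have := congr1 (fun F : functor _ _ => F T) (face_face C H).
by rewrite /= (_ : widen_ord _ _ = ord0) //; apply: val_inj.
Qed.

Lemma d1d2 n (T : C n.+2) : d1 (d2 T) = d1 (d1 T).
Proof.
have := congr1 (fun F : functor _ _ => F T) (face_face C (leqnn (ord1 n))).
by rewrite /= (_ : widen_ord _ _ = ord1 _) //; apply: val_inj.
Qed.

Lemma d1d3 n (T : C n.+3) : d1 (d3 T) = d2 (d1 T).
Proof.
have H : ord1 n.+1 <= ord2 n by [].
have := congr1 (fun F : functor _ _ => F T) (face_face C H).
by rewrite /= (_ : widen_ord _ _ = ord1 _) //; apply: val_inj.
Qed.

Lemma d2d3 n (T : C n.+3) : d2 (d3 T) = d2 (d2 T).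
Proof.
have := congr1 (fun F : functor _ _ => F T) (face_face C (leqnn (ord2 n))).
by rewrite /= (_ : widen_ord _ _ = ord2 _) //; apply: val_inj.
Qed.

Lemma d0s0 n (X : C n) : d0 (s0 X) = X.
Proof.
have := congr1 (fun F : functor _ _ => F X) (face_degen_l C (@ord0 n)).
by rewrite /= (_ : widen_ord _ _ = ord0) //; apply: val_inj.
Qed.

Lemma d1s0 n (X : C n) : d1 (s0 X) = X.
Proof. exact: (congr1 (fun F : functor _ _ => F X) (face_degen_r C (@ord0 n))). Qed.

Lemma d1s1 n (X : C n.+1) : d1 (s1 X) = X.
Proof.
have := congr1 (fun F : functor _ _ => F X) (face_degen_l C (ord1 n)).
by rewrite /= (_ : widen_ord _ _ = ord1 _) //; apply: val_inj.
Qed.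

Lemma d2s1 n (X : C n.+1) : d2 (s1 X) = X.
Proof. exact: (congr1 (fun F : functor _ _ => F X) (face_degen_r C (ord1 n))). Qed.

Lemma d0s1 n (X : C n.+1) : d0 (s1 X) = s0 (d0 X).
Proof.
have H : @ord0 n.+1 <= @ord0 n by [].
have := congr1 (fun F : functor _ _ => F X) (face_degen_lt C H).
by rewrite /= (_ : widen_ord _ _ = ord0) //; apply: val_inj.
Qed.

Lemma d2s0 n (X : C n.+1) : d2 (s0 X) = s0 (d1 X).
Proof.
have H : @ord0 n < ord1 n by [].
have := congr1 (fun F : functor _ _ => F X) (face_degen_gt C H).
by rewrite /= (_ : widen_ord _ _ = ord0) //; apply: val_inj.
Qed.

Lemma s0_pt_initial : is_initial (s0 (pt C) : C 1).
Proof.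
apply: (proj1 (@degen_coprod C 0 ord0)) => y; rewrite (ptP y).
by exists (idm _) => g; apply: pt_hom.
Qed.

Definition whom n (x y : C n) : Type := {f : hom x y | weq f}.

Lemma whom_eq n (x y : C n) (f g : whom x y) : sval f = sval g -> f = g.
Proof.
case: f g => [f fW] [g gW] /= E; case: g / E gW => gW.
by rewrite (Prop_irrelevance fW gW).
Qed.

Lemma weq_id n (x : C n) : weq (idm x).
Proof. by apply: weq_iso; exists (idm x); rewrite cmp1m. Qed.

(* The category of weak equivalences in degree [n]; its objects are those of
   [C n]. *)
Program Definition wcat (n : nat) : category :=
  {| ob := C n;
     hom := @whom n;
     idm := fun x => exist _ (idm x) (weq_id x);
     cmp := fun _ _ _ g f => exist _ (sval g ∘ sval f)
                               (weq_cmp (proj2_sig g) (proj2_sig f)) |}.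
Next Obligation. by move=> *; apply: whom_eq; rewrite /= cmp1m. Qed.
Next Obligation. by move=> *; apply: whom_eq; rewrite /= cmpm1. Qed.
Next Obligation. by move=> *; apply: whom_eq; rewrite /= cmpA. Qed.

Definition wface n (i : 'I_n.+2) (x y : wcat n.+1) (f : hom x y) :
  @hom (wcat n) (face i x) (face i y) :=
  exist _ (fmap (face i) (sval f)) (weq_face i (proj2_sig f)).

End SCategoryTheory.

Arguments wface {C n} i {x y} f.

(** ** The coproducts [s1 X ⊔ s0 Y] *)

(* Coproducts are defined, and preserved by the faces, only up to canonical
   isomorphism.  For a coproduct [Z = X ⊔ Y], a [sum_simplex Z] is any coproduct
   [S = s1 X ⊔ s0 Y]; it comes with canonical isomorphisms
     [ss_d0 : Y -> d0 S],   [ss_d2 : X -> d2 S],   [ss_d1 : d1 S -> Z]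
   given by [d0 s0 = id], [d2 s1 = id], [d1 s1 = id = d1 s0], since
   [d0 s1 X = s0 d0 X = s0 *] and [d2 s0 Y = s0 d1 Y = s0 *] are initial.  If
   coproducts are chosen so that [d0 S = Y], [d2 S = X] and [d1 S = Z] compatibly
   with the injections, these isomorphisms are identities.  The coproducts
   [s0 X ⊔ s1 Y] are given by [sum_simplex (cp_swap Z)], with [cp_swap Z] the
   coproduct [Y ⊔ X] on the same object as [Z]. *)
Record sum_simplex (C : S_category) (X Y : C 1) (Z : coproduct X Y) := SumSimplex {
  ss_cp :> coproduct (s1 X : C 2) (s0 Y : C 2);
  ss_d1m : hom (d1 (ss_cp : C 2)) Z;
  ss_d1l : ss_d1m ∘ (fmap d1 (cpl ss_cp) ∘ eqm (esym (d1s1 X))) = cpl Z;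
  ss_d1r : ss_d1m ∘ (fmap d1 (cpr ss_cp) ∘ eqm (esym (d1s0 Y))) = cpr Z }.

Section SumSimplex.
Variables (C : S_category) (X Y : C 1) (Z : coproduct X Y) (S : sum_simplex Z).

Definition ss_d0m : hom Y (d0 (S : C 2)) :=
  fmap d0 (cpr S) ∘ eqm (esym (d0s0 Y)).

Definition ss_d2m : hom X (d2 (S : C 2)) :=
  fmap d2 (cpl S) ∘ eqm (esym (d2s1 X)).

Lemma ss_d0m_iso : is_iso ss_d0m.
Proof.
apply: is_iso_cmp (eqm_iso _).
apply: (coproduct_initial_l _ (proj2 (@face_coprod C 1 ord0) _ _ _ _ _ (cpP S))).
by rewrite d0s1 (ptP (d0 X)); apply: s0_pt_initial.
Qed.

Lemma ss_d2m_iso : is_iso ss_d2m.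
Proof.
apply: is_iso_cmp (eqm_iso _).
apply: (coproduct_initial_l _
  (is_coproduct_sym (proj2 (@face_coprod C 1 (ord2 0)) _ _ _ _ _ (cpP S)))).
by rewrite d2s0 (ptP (d1 Y)); apply: s0_pt_initial.
Qed.

Lemma ss_d1m_iso : is_iso (ss_d1m S).
Proof.
apply: coproduct_iso (ss_d1l S) (ss_d1r S) => //; last exact: cpP.
by apply: coproduct_eqm; apply: (proj2 (@face_coprod C 1 (ord1 1)) _ _ _ _ _ (cpP S)).
Qed.

Definition ss_d0 : @hom (wcat C 1) Y (d0 (S : C 2)) :=
  exist _ ss_d0m (weq_iso ss_d0m_iso).
Definition ss_d1 : @hom (wcat C 1) (d1 (S : C 2)) Z :=
  exist _ (ss_d1m S) (weq_iso ss_d1m_iso).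
Definition ss_d2 : @hom (wcat C 1) X (d2 (S : C 2)) :=
  exist _ ss_d2m (weq_iso ss_d2m_iso).

End SumSimplex.

(** * Picard groupoids *)

Record sym_monoidal := SymMonoidal {
  smc :> category;
  tns : smc -> smc -> smc;
  tnsm : forall x x' y y' : smc,
    hom x x' -> hom y y' -> hom (tns x y) (tns x' y');
  tnsm1 : forall x y, tnsm (idm x) (idm y) = idm (tns x y);
  tnsmM : forall (x x' x'' y y' y'' : smc)
    (g : hom x' x'') (f : hom x x') (k : hom y' y'') (h : hom y y'),
    tnsm (g ∘ f) (k ∘ h) = tnsm g k ∘ tnsm f h;
  unt : smc;
  ass : forall x y z, hom (tns x (tns y z)) (tns (tns x y) z);
  lun : forall x, hom (tns unt x) x;
  run : forall x, hom (tns x unt) x;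
  com : forall x y, hom (tns x y) (tns y x);
  ass_iso : forall x y z, is_iso (ass x y z);
  lun_iso : forall x, is_iso (lun x);
  run_iso : forall x, is_iso (run x);
  ass_nat : forall (x x' y y' z z' : smc)
    (f : hom x x') (g : hom y y') (h : hom z z'),
    ass x' y' z' ∘ tnsm f (tnsm g h) = tnsm (tnsm f g) h ∘ ass x y z;
  lun_nat : forall (x x' : smc) (f : hom x x'),
    lun x' ∘ tnsm (idm unt) f = f ∘ lun x;
  run_nat : forall (x x' : smc) (f : hom x x'),
    run x' ∘ tnsm f (idm unt) = f ∘ run x;
  com_nat : forall (x x' y y' : smc) (f : hom x x') (g : hom y y'),
    com x' y' ∘ tnsm f g = tnsm g f ∘ com x y;
  pentagon : forall w x y z,
    ass (tns w x) y z ∘ ass w x (tns y z) =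
    tnsm (ass w x y) (idm z) ∘ ass w (tns x y) z ∘ tnsm (idm w) (ass x y z);
  triangle : forall x y,
    tnsm (run x) (idm y) ∘ ass x unt y = tnsm (idm x) (lun y);
  hexagon : forall x y z,
    ass z x y ∘ com (tns x y) z ∘ ass x y z =
    tnsm (com x z) (idm y) ∘ ass x z y ∘ tnsm (idm x) (com y z);
  com_sym : forall x y, com y x ∘ com x y = idm (tns x y) }.

Arguments tnsm {s x x' y y'} f g.
Arguments unt {s}.
Arguments ass {s} x y z.
Arguments lun {s} x.
Arguments run {s} x.
Arguments com {s} x y.

Notation "x ⊗ y" := (tns x y) (at level 40, left associativity) : cat_scope.
Notation "f ⊠ g" := (tnsm f g) (at level 40, left associativity) : cat_scope.

Program Definition tensor_left (P : sym_monoidal) (x : P) : functor P P :=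
  {| fob := fun y => x ⊗ y; fmap := fun _ _ f => idm x ⊠ f |}.
Next Obligation. by move=> P x y /=; rewrite tnsm1. Qed.
Next Obligation. by move=> P x y z t g f /=; rewrite -tnsmM cmp1m. Qed.

(* By symmetry, tensoring with [x] on the right is then an equivalence too. *)
Record picard := Picard {
  psm :> sym_monoidal;
  picard_groupoid : is_groupoid psm;
  picard_tensor : forall x : psm, is_equivalence (tensor_left x) }.

Definition is_strict_picard (P : picard) : Prop :=
  [/\ forall x y z : P, is_identity (ass x y z),
      forall x : P, is_identity (lun x),
      forall x : P, is_identity (run x) &
      forall x : P, exists y : P, x ⊗ y = unt /\ y ⊗ x = unt].

Lemma tnsm_eqm (P : sym_monoidal) (x x' y y' : P) (e : x = x') (e' : y = y') :
  eqm e ⊠ eqm e' = eqm (congr2 (@tns P) e e').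
Proof. by case: x' / e; case: y' / e'; rewrite !eqm1 tnsm1. Qed.

(** ** Symmetric tensor functors and tensor natural transformations *)

(* The constraints [tmult] and [tunit] are automatically invertible. *)
Record tensor_functor (P Q : picard) := TensorFunctor {
  tff :> functor P Q;
  tmult : forall x y : P, hom (tff x ⊗ tff y) (tff (x ⊗ y));
  tunit : hom unt (tff unt);
  tmult_nat : forall (x x' y y' : P) (f : hom x x') (g : hom y y'),
    tmult x' y' ∘ (fmap tff f ⊠ fmap tff g) = fmap tff (f ⊠ g) ∘ tmult x y;
  tmult_ass : forall x y z : P,
    fmap tff (ass x y z) ∘ tmult x (y ⊗ z) ∘ (idm (tff x) ⊠ tmult y z) =
    tmult (x ⊗ y) z ∘ (tmult x y ⊠ idm (tff z)) ∘ ass (tff x) (tff y) (tff z);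
  tmult_lun : forall x : P,
    fmap tff (lun x) ∘ tmult unt x ∘ (tunit ⊠ idm (tff x)) = lun (tff x);
  tmult_run : forall x : P,
    fmap tff (run x) ∘ tmult x unt ∘ (idm (tff x) ⊠ tunit) = run (tff x);
  tmult_com : forall x y : P,
    fmap tff (com x y) ∘ tmult x y = tmult y x ∘ com (tff x) (tff y) }.

Arguments tmult {P Q} _ x y.
Arguments tunit {P Q} _.

Record tensor_nat (P Q : picard) (f g : tensor_functor P Q) := TensorNat {
  tnt :> forall x : P, hom (f x) (g x);
  tnt_nat : forall (x y : P) (h : hom x y),
    tnt y ∘ fmap f h = fmap g h ∘ tnt x;
  tnt_mult : forall x y : P,
    tnt (x ⊗ y) ∘ tmult f x y = tmult g x y ∘ (tnt x ⊠ tnt y);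
  tnt_unit : tnt unt ∘ tunit f = tunit g }.

Lemma tensor_nat_eq (P Q : picard) (f g : tensor_functor P Q)
  (a b : tensor_nat f g) : (forall x, a x = b x) -> a = b.
Proof.
case: a b => [a a1 a2 a3] [b b1 b2 b3] /= ab.
have {}ab : a = b by apply: functional_extensionality_dep.
case: b / ab b1 b2 b3 => b1 b2 b3.
by rewrite (Prop_irrelevance a1 b1) (Prop_irrelevance a2 b2)
  (Prop_irrelevance a3 b3).
Qed.

Program Definition tensor_nat_id (P Q : picard) (f : tensor_functor P Q) :
  tensor_nat f f := {| tnt := fun x => idm (f x) |}.
Next Obligation. by move=> P Q f x y h; rewrite cmp1m cmpm1. Qed.
Next Obligation. by move=> P Q f x y; rewrite tnsm1 cmp1m cmpm1. Qed.
Next Obligation. by move=> P Q f; rewrite cmp1m. Qed.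

Program Definition tensor_nat_cmp (P Q : picard) (f g h : tensor_functor P Q)
  (b : tensor_nat g h) (a : tensor_nat f g) : tensor_nat f h :=
  {| tnt := fun x => b x ∘ a x |}.
Next Obligation.
by move=> P Q f g h b a x y k /=; rewrite -cmpA tnt_nat cmpA tnt_nat cmpA.
Qed.
Next Obligation.
by move=> P Q f g h b a x y /=; rewrite -cmpA tnt_mult cmpA tnt_mult -cmpA -tnsmM.
Qed.
Next Obligation.
by move=> P Q f g h b a /=; rewrite -cmpA tnt_unit tnt_unit.
Qed.

Program Definition HomT (P Q : picard) : category :=
  {| ob := tensor_functor P Q;
     hom := @tensor_nat P Q;
     idm := @tensor_nat_id P Q;
     cmp := @tensor_nat_cmp P Q |}.
Next Obligation. by move=> *; apply: tensor_nat_eq => x /=; rewrite cmp1m. Qed.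
Next Obligation. by move=> *; apply: tensor_nat_eq => x /=; rewrite cmpm1. Qed.
Next Obligation. by move=> *; apply: tensor_nat_eq => x /=; rewrite cmpA. Qed.

Lemma HomT_groupoid (P Q : picard) : is_groupoid (HomT P Q).
Proof.
move=> f g a.
have [b bP] : exists b : forall x : P, hom (g x) (f x),
    forall x, b x ∘ a x = idm _ /\ a x ∘ b x = idm _.
  exists (fun x => sval (cid (picard_groupoid (a x)))) => x.
  exact: (proj2_sig (cid (picard_groupoid (a x)))).
have ba x : b x ∘ a x = idm _ by case: (bP x).
have ab x : a x ∘ b x = idm _ by case: (bP x).
have bN (x y : P) (h : hom x y) : b y ∘ fmap g h = fmap f h ∘ b x.
  by rewrite -[LHS]cmpm1 -(ab x) cmpA -(cmpA _ _ (a x)) -tnt_nat cmpA ba cmp1m.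
have bM (x y : P) : b (x ⊗ y) ∘ tmult g x y = tmult f x y ∘ (b x ⊠ b y).
  rewrite -[LHS]cmpm1 -tnsm1 -(ab x) -(ab y) tnsmM cmpA.
  by rewrite -(cmpA _ _ (a _ ⊠ a _)) -tnt_mult cmpA ba cmp1m.
have b1 : b unt ∘ tunit g = tunit f by rewrite -(tnt_unit a) cmpA ba cmp1m.
by exists (TensorNat bN bM b1); split; apply: tensor_nat_eq => x /=.
Qed.

(** * Determinant functors *)

(* [det(s1 X ⊔ s0 Y) : det Y ⊗ det X -> det (X ⊔ Y)] *)
Definition det_sum (C : S_category) (P : picard) (det : functor (wcat C 1) P)
    (det2 : forall D : C 2, hom (det (d0 D) ⊗ det (d2 D)) (det (d1 D)))
    (X Y : C 1) (Z : coproduct X Y) (S : sum_simplex Z) :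
  hom (det Y ⊗ det X) (det Z) :=
  fmap det (ss_d1 S) ∘ det2 S ∘ (fmap det (ss_d0 S) ⊠ fmap det (ss_d2 S)).

Record det_functor (C : S_category) (P : picard) := DetFunctor {
  det1 :> functor (wcat C 1) P;
  det2 : forall D : C 2, hom (det1 (d0 D) ⊗ det1 (d2 D)) (det1 (d1 D));
  det2_nat : forall (D D' : wcat C 2) (f : hom D D'),
    fmap det1 (wface (ord1 _) f) ∘ det2 D =
    det2 D' ∘ (fmap det1 (wface ord0 f) ⊠ fmap det1 (wface (ord2 _) f));
  det_ass : forall T : C 3,
    det2 (d1 T) ∘
      (idm (det1 (d0 (d1 T))) ⊠ (eqm (congr1 det1 (d1d3 T)) ∘ det2 (d3 T))) =
    eqm (congr1 det1 (d1d2 T)) ∘ det2 (d2 T) ∘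
      ((eqm (congr1 det1 (esym (d0d2 T))) ∘ det2 (d0 T) ∘
          (eqm (congr1 det1 (d0d1 T)) ⊠ eqm (congr1 det1 (d0d3 T))))
       ⊠ eqm (congr1 det1 (d2d3 T))) ∘
      ass (det1 (d0 (d1 T))) (det1 (d0 (d3 T))) (det1 (d2 (d3 T)));
  det_com : forall (X Y : C 1) (Z : coproduct X Y)
    (S : sum_simplex Z) (S' : sum_simplex (cp_swap Z)),
    det_sum det2 S = det_sum det2 S' ∘ com (det1 Y) (det1 X) }.

Arguments det2 {C P} _ D.

Record det_mor (C : S_category) (P : picard) (det det' : det_functor C P) :=
  DetMor {
  dmt :> forall X : C 1, hom (det X) (det' X);
  dmt_nat : forall (X Y : wcat C 1) (f : hom X Y),
    dmt Y ∘ fmap det f = fmap det' f ∘ dmt X;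
  dmt_add : forall D : C 2,
    dmt (d1 D) ∘ det2 det D = det2 det' D ∘ (dmt (d0 D) ⊠ dmt (d2 D)) }.

Lemma det_mor_eq (C : S_category) (P : picard) (det det' : det_functor C P)
  (a b : det_mor det det') : (forall X, a X = b X) -> a = b.
Proof.
case: a b => [a a1 a2] [b b1 b2] /= ab.
have {}ab : a = b by apply: functional_extensionality_dep.
case: b / ab b1 b2 => b1 b2.
by rewrite (Prop_irrelevance a1 b1) (Prop_irrelevance a2 b2).
Qed.

Program Definition det_mor_id (C : S_category) (P : picard)
  (det : det_functor C P) : det_mor det det := {| dmt := fun X => idm (det X) |}.
Next Obligation. by move=> C P det X Y f; rewrite cmp1m cmpm1. Qed.
Next Obligation. by move=> C P det D; rewrite tnsm1 cmp1m cmpm1. Qed.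

Program Definition det_mor_cmp (C : S_category) (P : picard)
  (det det' det'' : det_functor C P) (b : det_mor det' det'')
  (a : det_mor det det') : det_mor det det'' :=
  {| dmt := fun X => b X ∘ a X |}.
Next Obligation.
by move=> C P F G H b a X Y f /=; rewrite -cmpA dmt_nat cmpA dmt_nat cmpA.
Qed.
Next Obligation.
by move=> C P F G H b a D /=; rewrite -cmpA dmt_add cmpA dmt_add -cmpA -tnsmM.
Qed.

Program Definition Det (C : S_category) (P : picard) : category :=
  {| ob := det_functor C P;
     hom := @det_mor C P;
     idm := @det_mor_id C P;
     cmp := @det_mor_cmp C P |}.
Next Obligation. by move=> *; apply: det_mor_eq => x /=; rewrite cmp1m. Qed.
Next Obligation. by move=> *; apply: det_mor_eq => x /=; rewrite cmpm1. Qed.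
Next Obligation. by move=> *; apply: det_mor_eq => x /=; rewrite cmpA. Qed.

Lemma Det_groupoid (C : S_category) (P : picard) : is_groupoid (Det C P).
Proof.
move=> F G a.
have [b bP] : exists b : forall X : C 1, hom (G X) (F X),
    forall X, b X ∘ a X = idm _ /\ a X ∘ b X = idm _.
  exists (fun X => sval (cid (picard_groupoid (a X)))) => X.
  exact: (proj2_sig (cid (picard_groupoid (a X)))).
have ba X : b X ∘ a X = idm _ by case: (bP X).
have ab X : a X ∘ b X = idm _ by case: (bP X).
have bN (X Y : wcat C 1) (f : hom X Y) :
    b Y ∘ fmap G f = fmap F f ∘ b X.
  by rewrite -[LHS]cmpm1 -(ab X) cmpA -(cmpA _ _ (a X)) -dmt_nat cmpA ba cmp1m.
have bA (D : C 2) : b (d1 D) ∘ det2 G D =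
    det2 F D ∘ (b (d0 D) ⊠ b (d2 D)).
  rewrite -[LHS]cmpm1 -tnsm1 -(ab (d0 D)) -(ab (d2 D)) tnsmM cmpA.
  by rewrite -(cmpA _ _ (a _ ⊠ a _)) -dmt_add cmpA ba cmp1m.
by exists (DetMor bN bA); split; apply: det_mor_eq => X /=.
Qed.

(* Strictness is only considered when [P] is strict; then [unt ⊗ unt = unt], so
   that [det2 det (s0 (s0 (pt C)))] is an endomorphism of [unt] up to equality
   of objects. *)
Definition is_strict (C : S_category) (P : picard) (det : det_functor C P)
  : Prop :=
  det (s0 (pt C)) = unt /\ is_identity (det2 det (s0 (s0 (pt C)))).

Definition DetS (C : S_category) (P : picard) : category :=
  full_sub (fun det : Det C P => is_strict det).

Lemma DetS_groupoid (C : S_category) (P : picard) : is_groupoid (DetS C P).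
Proof. by move=> F G a; apply: Det_groupoid. Qed.

(** ** Composition with symmetric tensor functors *)

Lemma tensor_functor_ass (P Q : picard) (f : tensor_functor P Q)
    (x y z u v p q : P) (a : hom (x ⊗ u) v) (b : hom (y ⊗ z) u)
    (g : hom (p ⊗ q) v) (h : hom (x ⊗ y) p) (k : hom z q) :
  a ∘ (idm x ⊠ b) = g ∘ (h ⊠ k) ∘ ass x y z ->
  fmap f a ∘ tmult f x u ∘ (idm (f x) ⊠ (fmap f b ∘ tmult f y z)) =
  fmap f g ∘ tmult f p q ∘ ((fmap f h ∘ tmult f x y) ⊠ fmap f k) ∘
    ass (f x) (f y) (f z).
Proof.
move=> E; rewrite -{1}[idm (f x)]cmp1m tnsmM -{1}[idm (f x)]fmap1 cmpA.
rewrite -(cmpA _ (tmult f x u)) tmult_nat cmpA -fmapM E.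
rewrite -[fmap f k]cmpm1 tnsmM cmpA -(cmpA _ (tmult f p q)) tmult_nat.
rewrite cmpA -fmapM fmapM -!cmpA; congr (_ ∘ _); rewrite !cmpA.
exact: tmult_ass.
Qed.

Section CompDet.
Variables (C : S_category) (P Q : picard) (f : tensor_functor P Q)
  (det : det_functor C P).

Definition comp_det2 (D : C 2) :
  hom (f (det (d0 D)) ⊗ f (det (d2 D))) (f (det (d1 D))) :=
  fmap f (det2 det D) ∘ tmult f (det (d0 D)) (det (d2 D)).

Lemma comp_det2_nat (D D' : wcat C 2) (h : hom D D') :
  fmap (compF f det) (wface (ord1 _) h) ∘ comp_det2 D =
  comp_det2 D' ∘ (fmap (compF f det) (wface ord0 h)
                  ⊠ fmap (compF f det) (wface (ord2 _) h)).
Proof.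
rewrite /comp_det2 /= -[RHS]cmpA tmult_nat cmpA -fmapM det2_nat fmapM.
by rewrite cmpA.
Qed.

Lemma comp_eqm (X Y : C 1) (e : X = Y) :
  eqm (congr1 (compF f det) e) = fmap f (eqm (congr1 det e)).
Proof. by rewrite fmap_eqm; apply: eqm_irr. Qed.

Lemma comp_det_ass (T : C 3) :
  let F := compF f det in
  comp_det2 (d1 T) ∘
    (idm (F (d0 (d1 T))) ⊠ (eqm (congr1 F (d1d3 T)) ∘ comp_det2 (d3 T))) =
  eqm (congr1 F (d1d2 T)) ∘ comp_det2 (d2 T) ∘
    ((eqm (congr1 F (esym (d0d2 T))) ∘ comp_det2 (d0 T) ∘
        (eqm (congr1 F (d0d1 T)) ⊠ eqm (congr1 F (d0d3 T))))
     ⊠ eqm (congr1 F (d2d3 T))) ∘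
    ass (F (d0 (d1 T))) (F (d0 (d3 T))) (F (d2 (d3 T))).
Proof.
move=> F; have := tensor_functor_ass f (det_ass det T).
rewrite !comp_eqm {}/F /= /comp_det2 !fmapM !cmpA => ->.
by rewrite -(cmpA _ (tmult f (det (d0 (d0 T))) _)) tmult_nat !cmpA.
Qed.

Lemma comp_det_com (X Y : C 1) (Z : coproduct X Y)
    (S : sum_simplex Z) (S' : sum_simplex (cp_swap Z)) :
  det_sum (det := compF f det) comp_det2 S =
  det_sum (det := compF f det) comp_det2 S' ∘ com (f (det Y)) (f (det X)).
Proof.
have E (X0 Y0 : C 1) (Z0 : coproduct X0 Y0) (S0 : sum_simplex Z0) :
    det_sum (det := compF f det) comp_det2 S0 =
    fmap f (det_sum (det2 det) S0) ∘ tmult f (det Y0) (det X0).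
  by rewrite /det_sum /comp_det2 /= !fmapM -!cmpA tmult_nat.
by rewrite !E (det_com det S S') fmapM -!cmpA tmult_com.
Qed.

Definition comp_det : det_functor C Q :=
  {| det1 := compF f det;
     det2 := comp_det2;
     det2_nat := comp_det2_nat;
     det_ass := comp_det_ass;
     det_com := comp_det_com |}.

End CompDet.

Program Definition comp_det_mor (C : S_category) (P Q : picard)
  (det : det_functor C P) (f g : tensor_functor P Q) (a : tensor_nat f g) :
  det_mor (comp_det f det) (comp_det g det) := {| dmt := fun X => a (det X) |}.
Next Obligation. by move=> C P Q det f g a X Y h; apply: tnt_nat. Qed.
Next Obligation.
move=> C P Q det f g a D; rewrite /= /comp_det2 cmpA tnt_nat.
by rewrite -!cmpA tnt_mult.
Qed.

Program Definition precomp_det (C : S_category) (P : picard)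
  (det : det_functor C P) (Q : picard) : functor (HomT P Q) (Det C Q) :=
  {| fob := fun f => comp_det f det : Det C Q;
     fmap := fun _ _ a => comp_det_mor det a |}.
Next Obligation. by move=> *; apply: det_mor_eq. Qed.
Next Obligation. by move=> *; apply: det_mor_eq. Qed.

Definition is_universal (C : S_category) (V : picard) (det : det_functor C V)
  : Prop := forall P : picard, is_equivalence (precomp_det det P).

(** * Stable quadratic modules *)

Local Open Scope group_scope.

(* The groups, not commutative in general, are written multiplicatively:
   [x * y], [x^-1], [1] and [~ x, y] = x^-1 * y^-1 * x * y stand for
   x + y, -x, 0 and [x, y] = -x - y + x + y.
   A map [G x G -> H] that is multiplicative in each argument has pairwise
   commuting values (expand [sbr (x * y) (z * t)] in two ways), hence is the
   same thing as a homomorphism G^ab ⊗ G^ab -> H. *)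
Record sqm := Sqm {
  sq0 : groupType;
  sq1 : groupType;
  sbr : sq0 -> sq0 -> sq1;
  sbd : sq1 -> sq0;
  sbd_mul : forall a b, sbd (a * b) = sbd a * sbd b;
  sbr_mull : forall x y z, sbr (x * y) z = sbr x z * sbr y z;
  sbr_mulr : forall x y z, sbr x (y * z) = sbr x y * sbr x z;
  sbr_anti : forall x y, sbr x y * sbr y x = 1;
  sbd_br : forall x y, sbd (sbr x y) = [~ y, x];
  sbr_bd : forall a b, sbr (sbd a) (sbd b) = [~ b, a] }.

Arguments sbr {s} x y.
Arguments sbd {s} a.

(* The action of [sq0 C] on [sq1 C]. *)
Definition sact (C : sqm) (a : sq1 C) (x : sq0 C) : sq1 C := a * sbr x (sbd a).

Lemma commg_mulgC (G : groupType) (x y : G) : x * y = y * x * [~ x, y].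
Proof. by rewrite /commg /conjg !mulgA mulgK mulgV mul1g. Qed.

Section SqmTheory.
Variable C : sqm.
Implicit Types (x y z : sq0 C) (a b : sq1 C).

Lemma sbd1 : sbd (1 : sq1 C) = 1.
Proof. by apply: (mulgI (sbd (1 : sq1 C))); rewrite -sbd_mul !mulg1. Qed.

Lemma sbdV a : sbd a^-1 = (sbd a)^-1.
Proof. by apply: (mulgI (sbd a)); rewrite -sbd_mul !mulgV sbd1. Qed.

Lemma sbr1l y : sbr 1 y = 1 :> sq1 C.
Proof. by apply: (mulgI (sbr 1 y)); rewrite -sbr_mull !mulg1. Qed.

Lemma sbr1r x : sbr x 1 = 1 :> sq1 C.
Proof. by apply: (mulgI (sbr x 1)); rewrite -sbr_mulr !mulg1. Qed.

Lemma sbrVr x y : sbr x y^-1 = (sbr x y)^-1.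
Proof. by apply: (mulgI (sbr x y)); rewrite -sbr_mulr !mulgV sbr1r. Qed.

Lemma sbr_comm x y z t : sbr x t * sbr y z = sbr y z * sbr x t.
Proof.
have E : sbr x z * sbr x t * (sbr y z * sbr y t) =
         sbr x z * sbr y z * (sbr x t * sbr y t).
  by rewrite -!sbr_mulr -sbr_mull sbr_mulr !sbr_mull.
by move: E; rewrite -!mulgA => /mulgI; rewrite !mulgA => /mulIg.
Qed.

Lemma sbr_commgr x y z : sbr x [~ y, z] = 1.
Proof.
rewrite /commg /conjg !sbr_mulr !sbrVr !mulgA.
by rewrite -!mulgA (sbr_comm x x) mulKg mulVg.
Qed.

Lemma sbr_bd_br x y z : sbr z (sbd (sbr x y)) = 1.
Proof. by rewrite sbd_br sbr_commgr. Qed.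

Lemma sbr_central a x y : a * sbr x y = sbr x y * a.
Proof.
by rewrite [RHS]commg_mulgC -sbr_bd sbr_bd_br mulg1.
Qed.

Lemma sact1 x : sact 1 x = 1 :> sq1 C.
Proof. by rewrite /sact sbd1 sbr1r mulg1. Qed.

Lemma sact_one a : sact a 1 = a.
Proof. by rewrite /sact sbr1l mulg1. Qed.

Lemma sact_br x y z : sact (sbr x y) z = sbr x y.
Proof. by rewrite /sact sbr_bd_br mulg1. Qed.

Lemma sactM a b x : sact (a * b) x = sact a x * sact b x.
Proof.
by rewrite /sact sbd_mul sbr_mulr !mulgA -(mulgA a b) (sbr_central b) !mulgA.
Qed.

Lemma sact_mul a x y : sact a (x * y) = sact (sact a x) y.
Proof.
by rewrite /sact sbr_mull sbd_mul sbr_mulr sbr_bd_br mulg1 mulgA.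
Qed.

Lemma sact_bd a b : sact a (sbd b) = b^-1 * a * b.
Proof. by rewrite /sact sbr_bd /commg /conjg !mulgA mulgV mul1g. Qed.

Lemma sbd_act a x : sbd (sact a x) = x^-1 * sbd a * x.
Proof. by rewrite /sact sbd_mul sbd_br /commg /conjg !mulgA mulgV mul1g. Qed.

End SqmTheory.

(** ** The strict Picard groupoid of a stable quadratic module *)

(* The pair [(y, a)] of the usual description is a morphism with target [y]
   and source [y * sbd a]; with prescribed source and target only [a]
   remains. *)
Definition ghom (C : sqm) (x y : sq0 C) : Type := {a : sq1 C | y * sbd a = x}.

Definition gpair (C : sqm) (x y : sq0 C) (f : ghom x y) : sq0 C * sq1 C :=
  (y, sval f).

Lemma ghom_eq (C : sqm) (x y : sq0 C) (f g : ghom x y) :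
  sval f = sval g -> f = g.
Proof.
case: f g => [a aP] [b bP] /= E; case: b / E bP => bP.
by rewrite (Prop_irrelevance aP bP).
Qed.

Section Gamma.
Variable C : sqm.

Lemma gid_proof (x y : sq0 C) : x = y -> y * sbd (1 : sq1 C) = x.
Proof. by move=> ->; rewrite sbd1 mulg1. Qed.

Definition gid (x y : sq0 C) (e : x = y) : ghom x y := exist _ 1 (gid_proof e).

Lemma gcmp_proof (x y z : sq0 C) (g : ghom y z) (f : ghom x y) :
  z * sbd (sval g * sval f) = x.
Proof. by rewrite sbd_mul mulgA (proj2_sig g) (proj2_sig f). Qed.

Program Definition gcat : category :=
  {| ob := sq0 C;
     hom := @ghom C;
     idm := fun x => gid (erefl x);
     cmp := fun _ _ _ g f => exist _ (sval g * sval f) (gcmp_proof g f) |}.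
Next Obligation. by move=> *; apply: ghom_eq => /=; rewrite mul1g. Qed.
Next Obligation. by move=> *; apply: ghom_eq => /=; rewrite mulg1. Qed.
Next Obligation. by move=> *; apply: ghom_eq => /=; rewrite mulgA. Qed.

Lemma sval_eqm (x y : gcat) (e : x = y) : sval (eqm e : ghom x y) = 1.
Proof. by case: y / e. Qed.

Lemma gid_identity (x y : gcat) (e : x = y) : is_identity (gid e : hom x y).
Proof. by exists e; apply: ghom_eq; rewrite sval_eqm. Qed.

Lemma gcat_groupoid : is_groupoid gcat.
Proof.
move=> x y f; have fV : x * sbd (sval f)^-1 = y.
  by rewrite sbdV -{1}(proj2_sig f) mulgK.
by exists (exist _ _ fV : ghom y x); split; apply: ghom_eq; rewrite /= ?mulVg ?mulgV.
Qed.

Lemma gtns_proof (x x' y y' : sq0 C) (f : ghom x x') (g : ghom y y') :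
  x' * y' * sbd (sact (sval f) y' * sval g) = x * y.
Proof.
rewrite sbd_mul sbd_act !mulgA mulgK.
by rewrite (proj2_sig f) -(mulgA x) (proj2_sig g).
Qed.

Lemma gcom_proof (x y : sq0 C) : y * x * sbd (sbr y x) = x * y.
Proof. by rewrite sbd_br -commg_mulgC. Qed.

Program Definition gsm : sym_monoidal :=
  {| smc := gcat;
     tns := fun x y : sq0 C => x * y;
     tnsm := fun x x' y y' f g => exist _ (sact (sval f) y' * sval g) (gtns_proof f g);
     unt := (1 : sq0 C);
     ass := fun x y z => gid (mulgA x y z);
     lun := fun x => gid (mul1g x);
     run := fun x => gid (mulg1 x);
     com := fun x y => exist _ (sbr y x) (gcom_proof x y) |}.
Next Obligation. by move=> x y; apply: ghom_eq; rewrite /= sact1 mul1g. Qed.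
Next Obligation.
move=> x x' x'' y y' y'' g f k h; apply: ghom_eq; rewrite /= sactM.
have -> : sact (sval f) y' = (sval k)^-1 * sact (sval f) y'' * sval k.
  by rewrite -sact_bd -sact_mul (proj2_sig k).
by rewrite !mulgA mulgK.
Qed.
Next Obligation. by move=> x y z; apply: gcat_groupoid. Qed.
Next Obligation. by move=> x; apply: gcat_groupoid. Qed.
Next Obligation. by move=> x; apply: gcat_groupoid. Qed.
Next Obligation.
move=> x x' y y' z z' f g h; apply: ghom_eq => /=.
by rewrite mul1g mulg1 sactM sact_mul mulgA.
Qed.
Next Obligation.
by move=> x x' f; apply: ghom_eq; rewrite /= sact1 !mul1g mulg1.
Qed.
Next Obligation.
by move=> x x' f; apply: ghom_eq; rewrite /= sact_one !mul1g.
Qed.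
Next Obligation.
move=> x x' y y' [a ax] [b bY]; apply: ghom_eq => /=.
have ab : a * b = b * a * sbr (sbd b) (sbd a) by rewrite sbr_bd -commg_mulgC.
rewrite -ax -bY sbr_mull !sbr_mulr /sact.
rewrite -(mulgA a) -(sbr_central b) (mulgA a) ab (sbr_central b).
rewrite -[X in _ = _ * (_ * X)]sbr_central !mulgA [RHS]sbr_central !mulgA.
rewrite sbr_anti mul1g (sbr_central (b * a)) !mulgA.
by rewrite -[LHS]mulgA sbr_central !mulgA.
Qed.
Next Obligation.
by move=> w x y z; apply: ghom_eq; rewrite /= !sact1 !mulg1.
Qed.
Next Obligation. by move=> x y; apply: ghom_eq; rewrite /= !sact1 !mulg1. Qed.
Next Obligation.
move=> x y z; apply: ghom_eq.
by rewrite /= sact_br sact1 !mulg1 !mul1g sbr_mulr.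
Qed.
Next Obligation. by move=> x y; apply: ghom_eq; rewrite /= sbr_anti. Qed.

Lemma gamma_tensor (x : gsm) : is_equivalence (tensor_left x).
Proof.
exists (tensor_left (x^-1 : gsm)); split.
  exists (fun y => gid (mulKg x y)); split; last first.
    by move=> y; apply: gcat_groupoid.
  by move=> y z f; apply: ghom_eq; rewrite /= !sact1 !mul1g mulg1.
exists (fun y => gid (mulVKg x y)); split; last first.
  by move=> y; apply: gcat_groupoid.
by move=> y z f; apply: ghom_eq; rewrite /= !sact1 !mul1g mulg1.
Qed.

Definition gamma : picard :=
  {| psm := gsm;
     picard_groupoid := gcat_groupoid;
     picard_tensor := gamma_tensor |}.

Lemma gamma_strict : is_strict_picard gamma.
Proof.
split; try by move=> *; apply: gid_identity.
by move=> x; exists (x^-1 : sq0 C); split; [apply: mulgV | apply: mulVg].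
Qed.

End Gamma.

(** ** Morphisms and homotopies *)

Record sqm_hom (C D : sqm) := SqmHom {
  sf0 : sq0 C -> sq0 D;
  sf1 : sq1 C -> sq1 D;
  sf0_mul : forall x y, sf0 (x * y) = sf0 x * sf0 y;
  sf1_mul : forall a b, sf1 (a * b) = sf1 a * sf1 b;
  sf_bd : forall a, sbd (sf1 a) = sf0 (sbd a);
  sf_br : forall x y, sbr (sf0 x) (sf0 y) = sf1 (sbr x y) }.

Record homotopy (C D : sqm) (f g : sqm_hom C D) := Homotopy {
  hty :> sq0 C -> sq1 D;
  hty_mul : forall x y, hty (x * y) = sact (hty x) (sf0 g y) * hty y;
  hty_bd : forall x, sbd (hty x) = (sf0 g x)^-1 * sf0 f x;
  hty_sbd : forall a, hty (sbd a) = (sf1 g a)^-1 * sf1 f a }.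

Lemma homotopy_eq (C D : sqm) (f g : sqm_hom C D) (a b : homotopy f g) :
  (forall x, a x = b x) -> a = b.
Proof.
case: a b => [a a1 a2 a3] [b b1 b2 b3] /= ab.
have {}ab : a = b by apply: functional_extensionality_dep.
case: b / ab b1 b2 b3 => b1 b2 b3.
by rewrite (Prop_irrelevance a1 b1) (Prop_irrelevance a2 b2)
  (Prop_irrelevance a3 b3).
Qed.

Lemma sf0_1 (C D : sqm) (f : sqm_hom C D) : sf0 f 1 = 1.
Proof. by apply: (mulgI (sf0 f 1)); rewrite -sf0_mul !mulg1. Qed.

Lemma sf1_1 (C D : sqm) (f : sqm_hom C D) : sf1 f 1 = 1.
Proof. by apply: (mulgI (sf1 f 1)); rewrite -sf1_mul !mulg1. Qed.

Lemma sf_act (C D : sqm) (f : sqm_hom C D) (a : sq1 C) (x : sq0 C) :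
  sf1 f (sact a x) = sact (sf1 f a) (sf0 f x).
Proof. by rewrite /sact sf1_mul sf_bd sf_br. Qed.

Lemma hty1 (C D : sqm) (f g : sqm_hom C D) (a : homotopy f g) : a 1 = 1.
Proof.
apply: (mulIg (a 1)); rewrite mul1g -[RHS]sact_one.
by have := hty_mul a 1 1; rewrite mulg1 sf0_1 !sact_one => {1}<-.
Qed.

Program Definition homotopy_id (C D : sqm) (f : sqm_hom C D) : homotopy f f :=
  {| hty := fun _ => 1 |}.
Next Obligation. by move=> C D f x y; rewrite sact1 mulg1. Qed.
Next Obligation. by move=> C D f x; rewrite sbd1 mulVg. Qed.
Next Obligation. by move=> C D f a; rewrite mulVg. Qed.

Program Definition homotopy_cmp (C D : sqm) (f g h : sqm_hom C D)
  (b : homotopy g h) (a : homotopy f g) : homotopy f h :=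
  {| hty := fun x => b x * a x |}.
Next Obligation.
move=> C D f g h b a x y /=; rewrite !hty_mul sactM.
have -> : sact (a x) (sf0 g y) = (b y)^-1 * sact (a x) (sf0 h y) * b y.
  by rewrite -sact_bd -sact_mul hty_bd mulVKg.
by rewrite !mulgA mulgK.
Qed.
Next Obligation.
by move=> C D f g h b a x /=; rewrite sbd_mul !hty_bd mulgA mulgK.
Qed.
Next Obligation.
by move=> C D f g h b a x /=; rewrite !hty_sbd mulgA mulgK.
Qed.

Program Definition HomS (C D : sqm) : category :=
  {| ob := sqm_hom C D;
     hom := @homotopy C D;
     idm := @homotopy_id C D;
     cmp := @homotopy_cmp C D |}.
Next Obligation. by move=> *; apply: homotopy_eq => x /=; rewrite mul1g. Qed.
Next Obligation. by move=> *; apply: homotopy_eq => x /=; rewrite mulg1. Qed.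
Next Obligation. by move=> *; apply: homotopy_eq => x /=; rewrite mulgA. Qed.

Lemma sactV (C : sqm) (a : sq1 C) (x : sq0 C) : sact a^-1 x = (sact a x)^-1.
Proof. by apply: (mulgI (sact a x)); rewrite -sactM !mulgV sact1. Qed.

Program Definition homotopy_inv (C D : sqm) (f g : sqm_hom C D)
  (a : homotopy f g) : homotopy g f := {| hty := fun x => (a x)^-1 |}.
Next Obligation.
move=> C D f g a x y /=; rewrite hty_mul invgM.
have -> : sf0 f y = sf0 g y * sbd (a y) by rewrite hty_bd mulVKg.
by rewrite sact_mul sact_bd sactV mulgK.
Qed.
Next Obligation.
by move=> C D f g a x /=; rewrite sbdV hty_bd invgM invgK.
Qed.
Next Obligation.
by move=> C D f g a x /=; rewrite hty_sbd invgM invgK.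
Qed.

Lemma HomS_groupoid (C D : sqm) : is_groupoid (HomS C D).
Proof.
move=> f g a; exists (homotopy_inv a).
by split; apply: homotopy_eq => x /=; rewrite ?mulVg ?mulgV.
Qed.

(** ** Functoriality of [gamma] *)

Section GammaHom.
Variables (C D : sqm) (f : sqm_hom C D).

Lemma gmap_proof (x y : sq0 C) (a : ghom x y) :
  sf0 f y * sbd (sf1 f (sval a)) = sf0 f x.
Proof. by rewrite sf_bd -sf0_mul (proj2_sig a). Qed.

Program Definition gmap : functor (gamma C) (gamma D) :=
  {| fob := fun x : gamma C => sf0 f x : gamma D;
     fmap := fun _ _ a => exist _ (sf1 f (sval a)) (gmap_proof a) |}.
Next Obligation. by move=> x; apply: ghom_eq; rewrite /= sf1_1. Qed.
Next Obligation. by move=> x y z b a; apply: ghom_eq; rewrite /= sf1_mul. Qed.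

Program Definition gamma_hom : tensor_functor (gamma C) (gamma D) :=
  {| tff := gmap;
     tmult := fun x y => gid (esym (sf0_mul f x y));
     tunit := gid (esym (sf0_1 f)) |}.
Next Obligation.
move=> x x' y y' a b; apply: ghom_eq.
by rewrite /= mul1g mulg1 sf1_mul sf_act.
Qed.
Next Obligation.
by move=> x y z; apply: ghom_eq; rewrite /= !sact1 sf1_1 !mulg1.
Qed.
Next Obligation.
by move=> x; apply: ghom_eq; rewrite /= !sact1 sf1_1 !mulg1.
Qed.
Next Obligation.
by move=> x; apply: ghom_eq; rewrite /= !sact1 sf1_1 !mulg1.
Qed.
Next Obligation.
by move=> x y; apply: ghom_eq; rewrite /= sf_br mul1g mulg1.
Qed.

End GammaHom.

Lemma gamma_htp_proof (C D : sqm) (f g : sqm_hom C D) (a : homotopy f g)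
  (x : sq0 C) : sf0 g x * sbd (a x) = sf0 f x.
Proof. by rewrite hty_bd mulVKg. Qed.

Program Definition gamma_htp (C D : sqm) (f g : sqm_hom C D)
  (a : homotopy f g) : tensor_nat (gamma_hom f) (gamma_hom g) :=
  {| tnt := fun x => exist _ (a x) (gamma_htp_proof a x) |}.
Next Obligation.
move=> C D f g a x y [c cP]; apply: ghom_eq => /=.
by rewrite -cP hty_mul hty_sbd -sf_bd sact_bd !mulgA mulgV mul1g mulgK.
Qed.
Next Obligation.
by move=> C D f g a x y; apply: ghom_eq; rewrite /= mulg1 mul1g hty_mul.
Qed.
Next Obligation.
by move=> C D f g a; apply: ghom_eq; rewrite /= mulg1 hty1.
Qed.

Program Definition gamma_fun (C D : sqm) :
  functor (HomS C D) (HomT (gamma C) (gamma D)) :=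
  {| fob := fun f => gamma_hom f : HomT (gamma C) (gamma D);
     fmap := fun _ _ a => gamma_htp a |}.
Next Obligation. by move=> *; apply: tensor_nat_eq => x; apply: ghom_eq. Qed.
Next Obligation. by move=> *; apply: tensor_nat_eq => x; apply: ghom_eq. Qed.

(** * The stable quadratic module of an S•-category *)

Local Close Scope group_scope.

Section Presentation.
Variable C : S_category.

Inductive degree := Deg0 | Deg1.

Inductive dterm : degree -> Type :=
| tX : C 1 -> dterm Deg0
| tW : forall X X' : wcat C 1, hom X X' -> dterm Deg1
| tT : C 2 -> dterm Deg1
| tone : forall s, dterm s
| tmul : forall s, dterm s -> dterm s -> dterm s
| tinv : forall s, dterm s -> dterm s
| tbd : dterm Deg1 -> dterm Deg0
| tbr : dterm Deg0 -> dterm Deg0 -> dterm Deg1.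

Arguments tone {s}.

Declare Scope dterm_scope.
Local Open Scope dterm_scope.
Local Notation "x * y" := (tmul x y) : dterm_scope.
Local Notation "x ^-1" := (tinv x) : dterm_scope.

Definition tcomm s (x y : dterm s) : dterm s := x^-1 * (y^-1 * (x * y)).
Definition tact (a : dterm Deg1) (x : dterm Deg0) : dterm Deg1 :=
  a * tbr x (tbd a).

(* The class [s1 X ⊔ s0 Y], corrected by the canonical isomorphisms of
   [sum_simplex]: this is the degree 1 component of the morphism
   [ss_d1 ∘ S ∘ (ss_d0 ⊗ ss_d2)], cf. [det_sum]. It is [tT S] when the canonical
   isomorphisms are identities, see [dclass_sum]. *)
Definition tsum (X Y : C 1) (Z : coproduct X Y) (S : sum_simplex Z)
  : dterm Deg1 :=
  tW (ss_d1 S) * (tT S * (tact (tW (ss_d0 S)) (tX (d2 (S : C 2))) * tW (ss_d2 S))).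

Local Reserved Notation "x ≡ y" (at level 70, no associativity).

(* The congruence generated by the axioms of stable quadratic modules and by
   the defining relations. *)
Inductive deq : forall s, dterm s -> dterm s -> Prop :=
| deq_refl : forall s (x : dterm s), x ≡ x
| deq_sym : forall s (x y : dterm s), x ≡ y -> y ≡ x
| deq_trans : forall s (x y z : dterm s), x ≡ y -> y ≡ z -> x ≡ z
| deq_mul : forall s (x x' y y' : dterm s), x ≡ x' -> y ≡ y' -> x * y ≡ x' * y'
| deq_inv : forall s (x x' : dterm s), x ≡ x' -> x^-1 ≡ x'^-1
| deq_bd : forall a a', a ≡ a' -> tbd a ≡ tbd a'
| deq_br : forall x x' y y', x ≡ x' -> y ≡ y' -> tbr x y ≡ tbr x' y'

| deq_mulA : forall s (x y z : dterm s), x * (y * z) ≡ x * y * z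
| deq_mul1x : forall s (x : dterm s), tone * x ≡ x
| deq_mulx1 : forall s (x : dterm s), x * tone ≡ x
| deq_mulVx : forall s (x : dterm s), x^-1 * x ≡ tone
| deq_mulxV : forall s (x : dterm s), x * x^-1 ≡ tone

| deq_bd_mul : forall a b, tbd (a * b) ≡ tbd a * tbd b
| deq_br_mull : forall x y z, tbr (x * y) z ≡ tbr x z * tbr y z
| deq_br_mulr : forall x y z, tbr x (y * z) ≡ tbr x y * tbr x z
| deq_br_anti : forall x y, tbr x y * tbr y x ≡ tone
| deq_bd_br : forall x y, tbd (tbr x y) ≡ tcomm y x
| deq_br_bd : forall a b, tbr (tbd a) (tbd b) ≡ tcomm b a

| deq_bd_W : forall (X X' : wcat C 1) (f : hom X X'),
    tbd (tW f) ≡ (tX X')^-1 * tX X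
| deq_bd_T : forall D : C 2,
    tbd (tT D) ≡ (tX (d1 D))^-1 * (tX (d0 D) * tX (d2 D))
| deq_pt : tX (s0 (pt C)) ≡ tone
| deq_idm : forall X : wcat C 1, tW (idm X) ≡ tone
| deq_s0 : forall X : C 1, tT (s0 X) ≡ tone
| deq_s1 : forall X : C 1, tT (s1 X) ≡ tone
| deq_cmp : forall (X Y Z : wcat C 1) (g : hom Y Z) (f : hom X Y),
    tW (g ∘ f) ≡ tW g * tW f
| deq_nat : forall (D D' : wcat C 2) (f : hom D D'),
    tW (wface (ord2 _) f) * tact (tW (wface ord0 f)) (tX (d2 (D : C 2))) ≡
    (tT D')^-1 * (tW (wface (ord1 _) f) * tT D)
| deq_ass : forall T : C 3,
    tT (d1 T) * tT (d3 T) ≡ tT (d2 T) * tact (tT (d0 T)) (tX (d2 (d3 T)))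
| deq_com : forall (X Y : C 1) (Z : coproduct X Y)
    (S : sum_simplex Z) (S' : sum_simplex (cp_swap Z)),
    tbr (tX X) (tX Y) ≡ (tsum S')^-1 * tsum S

where "x ≡ y" := (deq x y) : dterm_scope.

Definition dterm_choice (s : degree) : choiceType := {classic dterm s}.

Definition deqb (s : degree) : rel (dterm_choice s) := fun x y => `[< deq x y >].

Lemma deqb_refl s : reflexive (@deqb s).
Proof. by move=> x; apply/asboolP; apply: deq_refl. Qed.

Lemma deqb_sym s : symmetric (@deqb s).
Proof.
by move=> x y; apply/asboolP/asboolP; apply: deq_sym.
Qed.

Lemma deqb_trans s : transitive (@deqb s).
Proof.
by move=> y x z /asboolP xy /asboolP yz; apply/asboolP; apply: deq_trans xy yz.
Qed.

Canonical deq_equiv (s : degree) :=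
  EquivRel (@deqb s) (@deqb_refl s) (@deqb_sym s) (@deqb_trans s).

Local Open Scope quotient_scope.

Definition dquot (s : degree) : Type := {eq_quot (deq_equiv s)}.
HB.instance Definition _ s := Choice.on (dquot s).
HB.instance Definition _ s := EqQuotient.on (dquot s).

Definition dclass (s : degree) (x : dterm s) : dquot s :=
  \pi_(dquot s) (x : dterm_choice s).
Definition drepr (s : degree) (u : dquot s) : dterm s := repr u.

Lemma dclassP s (x y : dterm s) : dclass x = dclass y <-> x ≡ y.
Proof. by split=> [/eqmodP/asboolP|xy]; last by apply/eqmodP/asboolP. Qed.

Lemma dreprK s (u : dquot s) : dclass (drepr u) = u.
Proof. exact: reprK. Qed.

Definition dmul s (u v : dquot s) : dquot s := dclass (drepr u * drepr v).
Definition dinv s (u : dquot s) : dquot s := dclass (drepr u)^-1.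
Definition dbd (u : dquot Deg1) : dquot Deg0 := dclass (tbd (drepr u)).
Definition dbr (u v : dquot Deg0) : dquot Deg1 := dclass (tbr (drepr u) (drepr v)).

Lemma drepr_class s (x : dterm s) : drepr (dclass x) ≡ x.
Proof. by apply/dclassP; rewrite dreprK. Qed.

Lemma dmulE s (x y : dterm s) : dmul (dclass x) (dclass y) = dclass (x * y).
Proof. by apply/dclassP/deq_mul; apply: drepr_class. Qed.

Lemma dinvE s (x : dterm s) : dinv (dclass x) = dclass x^-1.
Proof. by apply/dclassP/deq_inv; apply: drepr_class. Qed.

Lemma dbdE a : dbd (dclass a) = dclass (tbd a).
Proof. by apply/dclassP/deq_bd; apply: drepr_class. Qed.

Lemma dbrE x y : dbr (dclass x) (dclass y) = dclass (tbr x y).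
Proof. by apply/dclassP/deq_br; apply: drepr_class. Qed.

Lemma dquotW s (P : dquot s -> Prop) : (forall x, P (dclass x)) -> forall u, P u.
Proof. by move=> PP u; rewrite -(dreprK u). Qed.

Lemma dmulA s : associative (@dmul s).
Proof.
elim/dquotW=> x; elim/dquotW=> y; elim/dquotW=> z.
by rewrite !dmulE; apply/dclassP/deq_mulA.
Qed.

Lemma dmul1x s : left_id (dclass tone) (@dmul s).
Proof. by elim/dquotW=> x; rewrite dmulE; apply/dclassP/deq_mul1x. Qed.

Lemma dmulx1 s : right_id (dclass tone) (@dmul s).
Proof. by elim/dquotW=> x; rewrite dmulE; apply/dclassP/deq_mulx1. Qed.

Lemma dmulVx s : left_inverse (dclass tone) (@dinv s) (@dmul s).
Proof. by elim/dquotW=> x; rewrite dinvE dmulE; apply/dclassP/deq_mulVx. Qed.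

Lemma dmulxV s : right_inverse (dclass tone) (@dinv s) (@dmul s).
Proof. by elim/dquotW=> x; rewrite dinvE dmulE; apply/dclassP/deq_mulxV. Qed.

HB.instance Definition _ s := isGroup.Build (dquot s)
  (@dmulA s) (@dmul1x s) (@dmulx1 s) (@dmulVx s) (@dmulxV s).

Local Close Scope dterm_scope.
Local Open Scope group_scope.

Lemma dclass_mul s (x y : dterm s) : dclass (tmul x y) = dclass x * dclass y.
Proof. by rewrite -dmulE. Qed.

Lemma dclass_inv s (x : dterm s) : dclass (tinv x) = (dclass x)^-1.
Proof. by rewrite -dinvE. Qed.

Lemma dclass_one s : dclass (@tone s) = 1.
Proof. by []. Qed.

Lemma dclass_comm s (x y : dterm s) : dclass (tcomm x y) = [~ dclass x, dclass y].
Proof. by rewrite !(dclass_mul, dclass_inv). Qed.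

Lemma dbd_mul u v : dbd (u * v) = dbd u * dbd v.
Proof.
elim/dquotW: u => a; elim/dquotW: v => b.
by rewrite -dclass_mul !dbdE -dclass_mul; apply/dclassP/deq_bd_mul.
Qed.

Lemma dbr_mull u v w : dbr (u * v) w = dbr u w * dbr v w.
Proof.
elim/dquotW: u => x; elim/dquotW: v => y; elim/dquotW: w => z.
by rewrite -dclass_mul !dbrE -dclass_mul; apply/dclassP/deq_br_mull.
Qed.

Lemma dbr_mulr u v w : dbr u (v * w) = dbr u v * dbr u w.
Proof.
elim/dquotW: u => x; elim/dquotW: v => y; elim/dquotW: w => z.
by rewrite -dclass_mul !dbrE -dclass_mul; apply/dclassP/deq_br_mulr.
Qed.

Lemma dbr_anti u v : dbr u v * dbr v u = 1.
Proof.
elim/dquotW: u => x; elim/dquotW: v => y.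
by rewrite !dbrE -dclass_mul; apply/dclassP/deq_br_anti.
Qed.

Lemma dbd_br u v : dbd (dbr u v) = [~ v, u].
Proof.
elim/dquotW: u => x; elim/dquotW: v => y.
by rewrite dbrE dbdE -dclass_comm; apply/dclassP/deq_bd_br.
Qed.

Lemma dbr_bd u v : dbr (dbd u) (dbd v) = [~ v, u].
Proof.
elim/dquotW: u => a; elim/dquotW: v => b.
by rewrite !dbdE dbrE -dclass_comm; apply/dclassP/deq_br_bd.
Qed.

Definition Dsqm : sqm :=
  {| sq0 := dquot Deg0;
     sq1 := dquot Deg1;
     sbr := dbr;
     sbd := dbd;
     sbd_mul := dbd_mul;
     sbr_mull := dbr_mull;
     sbr_mulr := dbr_mulr;
     sbr_anti := dbr_anti;
     sbd_br := dbd_br;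
     sbr_bd := dbr_bd |}.

Definition dX (X : C 1%N) : sq0 Dsqm := dclass (tX X).
Definition dW (X X' : wcat C 1%N) (f : hom X X') : sq1 Dsqm := dclass (tW f).
Definition dT (D : C 2) : sq1 Dsqm := dclass (tT D).

Lemma dW_identity (X X' : wcat C 1%N) (f : hom X X') : is_identity f -> dW f = 1.
Proof. by case=> e ->; case: X' / e {f}; apply/dclassP/deq_idm. Qed.

Lemma dclass_sum (X Y : C 1%N) (Z : coproduct X Y) (S : sum_simplex Z) :
  is_identity (ss_d0 S) -> is_identity (ss_d1 S) -> is_identity (ss_d2 S) ->
  dclass (tsum S) = dT S.
Proof.
move=> I0 I1 I2; rewrite !(dclass_mul, =^~ dbrE, =^~ dbdE).
rewrite -/(dW (ss_d0 S)) -/(dW (ss_d1 S)) -/(dW (ss_d2 S)) -/(dT S).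
rewrite !dW_identity // (_ : dbd 1 = 1); last exact: (@sbd1 Dsqm).
by rewrite (_ : dbr _ 1 = 1) ?mulg1 ?mul1g //; apply: (@sbr1r Dsqm).
Qed.

End Presentation.

(** * Composition with a strict determinant functor *)

Section GammaDet.
Variables (C : S_category) (D E : sqm) (det : det_functor C (gamma D)).
Hypothesis detS : is_strict det.

Lemma comp_gamma_strict (f : sqm_hom D E) : is_strict (comp_det (gamma_hom f) det).
Proof.
split; first by rewrite /= detS.1 sf0_1.
have [_ [e eE]] := detS; rewrite /= /comp_det2.
apply: is_identity_cmp; last exact: gid_identity.
by rewrite eE fmap_eqm; exists (congr1 (gmap f) e).
Qed.

(* φ ↦ Γφ ∘ det *)
Definition gamma_det : functor (HomS D E) (DetS C (gamma E)) :=
  lift_full (F := compF (precomp_det det (gamma E)) (gamma_fun D E))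
    comp_gamma_strict.

End GammaDet.

(* Main.v *)
From HB Require Import structures.
From mathcomp Require Import all_boot all_algebra boolp classical_sets ring.
Require Import Defs.

(* The generating data of [Dsqm C] satisfy in any stable quadratic module [E] exactly the
   identities which the values of a strict determinant functor to [gamma E] satisfy, the
   relations on degenerate simplices being consequences of associativity. This gives the
   bijection on objects of the last assertion; morphisms follow from universality.

   For universality, fix a Picard groupoid [P] and measure its morphisms by elements of the
   automorphism group [A] of the unit, compatibly with composition. The associativity and
   the symmetry then become an abelian 3-cocycle on isomorphism classes.

   Fully faithful: given tensor functors [f], [g] from [gamma (Dsqm C)] to [P], the pairs of
   an object [x] and a morphism [f x -> g x] form the objects of a stable quadratic module
   with the same degree 1 group as [Dsqm C]. A morphism between the induced determinant
   functors defines a map from [Dsqm C] to it, i.e. a tensor natural transformation.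

   Essentially surjective: let [L] be the free abelian group on the objects of [C 1]. The
   3-cocycle, pulled back to [L], is a coboundary of some [U] (ignoring the symmetry). Hence
   [U] turns the obvious map [L -> P] into a tensor functor, which the symmetry of [P] and
   [U] promote to a fully faithful symmetric tensor functor [gamma E -> P], where [E] is a
   stable quadratic module with degree 0 group [L]. The given determinant functor lifts
   to [gamma E], where it is classified by a map [Dsqm C -> E]. *)

Set Implicit Arguments.
Unset Strict Implicit.
Unset Printing Implicit Defensive.

Import GRing.Theory.
Local Open Scope ring_scope.
Local Open Scope group_scope.
Local Open Scope cat_scope.

#[local] Obligation Tactic := idtac.

(** * Abelian groups and presented groups *)

(* The square-zero extension of the integers by [A]: embedding [A] in a commutative ring
   makes the tactic [ring] available for identities in [A]. *)
Definition sqz (A : zmodType) := (int * A)%type.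
HB.instance Definition _ (A : zmodType) := GRing.Zmodule.on (sqz A).

Section SquareZero.
Variable A : zmodType.

Definition sqz_mul (x y : sqz A) : sqz A :=
  ((x.1 * y.1)%R, y.2 *~ x.1 + x.2 *~ y.1).

Lemma sqz_mulA : associative sqz_mul.
Proof.
move=> [x a] [y b] [z c]; rewrite /sqz_mul /= mulrA !mulrzDl -!mulrzA addrA.
by congr (_, _ + _ + _); rewrite mulrC.
Qed.

Lemma sqz_mulC : commutative sqz_mul.
Proof. by move=> [x a] [y b]; rewrite /sqz_mul /= mulrC addrC. Qed.

Lemma sqz_mul1 : left_id ((1%R, 0) : sqz A) sqz_mul.
Proof. by move=> [x a]; rewrite /sqz_mul /= mul1r mul0rz addr0. Qed.

Lemma sqz_mulDl : left_distributive sqz_mul +%R.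
Proof.
move=> [x a] [y b] [z c]; rewrite /sqz_mul /= mulrDl mulrzDl mulrzDr.
by rewrite addrACA.
Qed.

Lemma sqz_1 : ((1%R, 0) : sqz A) != 0.
Proof. by []. Qed.

HB.instance Definition _ := GRing.Zmodule_isComNzRing.Build (sqz A)
  sqz_mulA sqz_mulC sqz_mul1 sqz_mulDl sqz_1.

Definition sqz_in (a : A) : sqz A := (0, a).

Lemma sqz_inD : {morph sqz_in : x y / x + y}.
Proof. by move=> x y; rewrite /sqz_in; congr (_, _). Qed.

HB.instance Definition _ :=
  GRing.isNmodMorphism.Build A (sqz A) sqz_in (conj (erefl _) sqz_inD).

Lemma sqz_inj (a b : A) : sqz_in a = sqz_in b -> a = b.
Proof. by case. Qed.

(** Used by [zlin]: a goal follows from [l = r] once the two differ by a formal identity of abelian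
    groups, which [ring] checks in [sqz A]. *)
Lemma lincomb (x y l r : A) : l = r -> x + r = y + l -> x = y.
Proof. by move=> -> /addIr. Qed.

End SquareZero.

Ltac zmod := apply: sqz_inj; ring.
Ltac zlin H := apply: (lincomb H); zmod.

(** * Groups as quotients by a congruence *)

Record group_pres := GroupPres {
  gp_car :> Type;
  gp_rel : gp_car -> gp_car -> Prop;
  gp_one : gp_car;
  gp_inv : gp_car -> gp_car;
  gp_mul : gp_car -> gp_car -> gp_car;
  gp_refl : forall x, gp_rel x x;
  gp_sym : forall x y, gp_rel x y -> gp_rel y x;
  gp_trans : forall x y z, gp_rel x y -> gp_rel y z -> gp_rel x z;
  gp_mulP : forall x x' y y',
    gp_rel x x' -> gp_rel y y' -> gp_rel (gp_mul x y) (gp_mul x' y');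
  gp_mulA : forall x y z, gp_rel (gp_mul x (gp_mul y z)) (gp_mul (gp_mul x y) z);
  gp_mul1 : forall x, gp_rel (gp_mul gp_one x) x;
  gp_mulV : forall x, gp_rel (gp_mul (gp_inv x) x) gp_one }.

Section QuotientGroup.
Variable p : group_pres.

Let car : choiceType := {classic gp_car p}.
Let relb : rel car := fun x y => `[< gp_rel x y >].

Let relb_refl : reflexive relb.
Proof. by move=> x; apply/asboolP; apply: gp_refl. Qed.

Let relb_sym : symmetric relb.
Proof. by move=> x y; apply/asboolP/asboolP; apply: gp_sym. Qed.

Let relb_trans : transitive relb.
Proof.
by move=> y x z /asboolP xy /asboolP yz; apply/asboolP; apply: gp_trans xy yz.
Qed.

Let relb_equiv := EquivRel relb relb_refl relb_sym relb_trans.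

Local Open Scope quotient_scope.

Definition gquot : Type := {eq_quot relb_equiv}.
HB.instance Definition _ := Choice.on gquot.
HB.instance Definition _ := EqQuotient.on gquot.

Definition gcls (x : p) : gquot := \pi_gquot (x : car).
Definition grep (u : gquot) : p := repr u.

Lemma gclsP (x y : p) : gcls x = gcls y <-> gp_rel x y.
Proof. by split=> [/eqmodP/asboolP|xy]; last by apply/eqmodP/asboolP. Qed.

Lemma grepK u : gcls (grep u) = u.
Proof. exact: reprK. Qed.

Lemma grep_cls x : gp_rel (grep (gcls x)) x.
Proof. by apply/gclsP; rewrite grepK. Qed.

Let mul u v := gcls (gp_mul (grep u) (grep v)).
Let inv u := gcls (gp_inv (grep u)).

Let mulE x y : mul (gcls x) (gcls y) = gcls (gp_mul x y).
Proof. by apply/gclsP/gp_mulP; apply: grep_cls. Qed.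

Let mulA : associative mul.
Proof.
move=> u v w; rewrite -(grepK u) -(grepK v) -(grepK w) !mulE.
by apply/gclsP/gp_mulA.
Qed.

Let mul1x : left_id (gcls (gp_one p)) mul.
Proof. by move=> u; rewrite -(grepK u) mulE; apply/gclsP/gp_mul1. Qed.

Let mulVx : left_inverse (gcls (gp_one p)) inv mul.
Proof. by move=> u; rewrite -{2}(grepK u) mulE; apply/gclsP/gp_mulV. Qed.

Let mulxV : right_inverse (gcls (gp_one p)) inv mul.
Proof.
move=> u; rewrite -[LHS]mul1x -(mulVx (inv u)) -mulA (mulA (inv u)).
by rewrite mulVx mul1x.
Qed.

Let mulx1 : right_id (gcls (gp_one p)) mul.
Proof. by move=> u; rewrite -(mulVx u) mulA mulxV mul1x. Qed.

HB.instance Definition _ := isGroup.Build gquot mulA mul1x mulx1 mulVx mulxV.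

Lemma gcls_mul (x y : p) : gcls (gp_mul x y) = gcls x * gcls y.
Proof. by rewrite -mulE. Qed.

Lemma gcls_inv (x : p) : gcls (gp_inv x) = (gcls x)^-1.
Proof.
by apply: (mulIg (gcls x)); rewrite mulVg -gcls_mul; apply/gclsP/gp_mulV.
Qed.

End QuotientGroup.

Definition morph_mul (G H : groupType) (f : G -> H) : Prop :=
  forall x y, f (x * y) = f x * f y.

Lemma morph_mul1 (G H : groupType) (f : G -> H) : morph_mul f -> f 1 = 1.
Proof. by move=> fM; apply: (mulgI (f 1)); rewrite -fM !mulg1. Qed.

Lemma morph_mulV (G H : groupType) (f : G -> H) x :
  morph_mul f -> f x^-1 = (f x)^-1.
Proof.
by move=> fM; apply: (mulgI (f x)); rewrite -fM !mulgV morph_mul1.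
Qed.

(** * Free abelian groups *)

Section FreeAbelian.
Variable B : Type.

Inductive gterm :=
| gt_gen of B
| gt_one
| gt_mul of gterm & gterm
| gt_inv of gterm.

Fixpoint gt_eval (H : groupType) (g : B -> H) (t : gterm) : H :=
  match t with
  | gt_gen b => g b
  | gt_one => 1
  | gt_mul s t => gt_eval g s * gt_eval g t
  | gt_inv t => (gt_eval g t)^-1
  end.

Definition commuting (H : groupType) (g : B -> H) : Prop :=
  forall b c, commute (g b) (g c).

(* Two words are identified when they agree in every group, for every assignment of
   pairwise commuting values to the generators: this makes the universal property
   immediate. *)
Program Definition free_ab_pres : group_pres :=
  {| gp_car := gterm;
     gp_rel := fun s t => forall (H : groupType) (g : B -> H), commuting g ->
       gt_eval g s = gt_eval g t;
     gp_one := gt_one;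
     gp_inv := gt_inv;
     gp_mul := gt_mul |}.
Next Obligation. by []. Qed.
Next Obligation. by move=> s t st H g gC; rewrite st. Qed.
Next Obligation. by move=> s t u st tu H g gC; rewrite st // tu. Qed.
Next Obligation. by move=> s s' t t' ss tt H g gC /=; rewrite ss // tt. Qed.
Next Obligation. by move=> s t u H g gC /=; rewrite mulgA. Qed.
Next Obligation. by move=> s H g gC /=; rewrite mul1g. Qed.
Next Obligation. by move=> s H g gC /=; rewrite mulVg. Qed.

Definition free_ab : groupType := gquot free_ab_pres.
Definition fa_gen (b : B) : free_ab := gcls (gt_gen b : free_ab_pres).

Lemma gt_eval_commute (H : groupType) (g : B -> H) x t :
  (forall b, commute x (g b)) -> commute x (gt_eval g t).
Proof.
move=> xg; elim: t => [b|||] //=.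
- exact: commute1.
- by move=> s xs t xt; apply: commuteM.
- by move=> t xt; apply: commuteV.
Qed.

Lemma free_abC (x y : free_ab) : x * y = y * x.
Proof.
rewrite -(grepK x) -(grepK y) -!gcls_mul; apply/gclsP => H g gC /=.
apply: gt_eval_commute => b; apply: commute_sym.
by apply: gt_eval_commute => c.
Qed.

Definition fa_lift (H : groupType) (g : B -> H) (x : free_ab) : H :=
  gt_eval g (grep x).

Lemma fa_lift_cls (H : groupType) (g : B -> H) t : commuting g ->
  fa_lift g (gcls (t : free_ab_pres)) = gt_eval g t.
Proof. by move=> gC; apply: (grep_cls (t : free_ab_pres)). Qed.

Lemma fa_lift_mul (H : groupType) (g : B -> H) : commuting g ->
  morph_mul (fa_lift g).
Proof.
move=> gC x y; rewrite -(grepK x) -(grepK y) -gcls_mul.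
by rewrite !fa_lift_cls.
Qed.

Lemma fa_lift_gen (H : groupType) (g : B -> H) b : commuting g ->
  fa_lift g (fa_gen b) = g b.
Proof. by move=> gC; rewrite fa_lift_cls. Qed.

Lemma fa_ind (P : free_ab -> Prop) : (forall b, P (fa_gen b)) -> P 1 ->
  (forall x y, P x -> P y -> P (x * y)) -> (forall x, P x -> P x^-1) ->
  forall x, P x.
Proof.
move=> Pg P1 PM PV x; rewrite -(grepK x).
elim: (grep x) => [b|||] //; [exact: Pg | | ].
  by move=> s Ps t Pt; rewrite (gcls_mul (s : free_ab_pres)); apply: PM.
by move=> t Pt; rewrite (gcls_inv (t : free_ab_pres)); apply: PV.
Qed.

Lemma fa_morph_eq (H : groupType) (f g : free_ab -> H) :
  morph_mul f -> morph_mul g ->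
  (forall b, f (fa_gen b) = g (fa_gen b)) -> forall x, f x = g x.
Proof.
move=> fM gM fg; apply: fa_ind => [//|||].
- by rewrite !morph_mul1.
- by move=> x y fx fy; rewrite fM gM fx fy.
- by move=> x fx; rewrite !morph_mulV // fx.
Qed.

End FreeAbelian.

(** * Abelian 3-cocycles on free abelian groups *)

Section Cocycle.
Variables (B : Type) (A : zmodType).
Notation L := (free_ab B).
Variables (h : L -> L -> L -> A) (c : L -> L -> A).
Hypothesis pent : forall w x y z,
  h (w * x) y z + h w x (y * z) = h w x y + h w (x * y) z + h x y z.
Hypothesis hexa : forall x y z,
  h x y z - h y x z + h y z x = c x (y * z) - c x y - c x z.

(* The pairs [(l, f)], with [f] up to an additive constant, form an extension of [L] on
   which [h] becomes a coboundary. *)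
Let ext_mul (x y : L * (L -> A)) : L * (L -> A) :=
  (x.1 * y.1, fun s => x.2 (y.1 * s) + y.2 s - h x.1 y.1 s).

Program Definition ext_pres : group_pres :=
  {| gp_car := (L * (L -> A))%type;
     gp_rel := fun x y => x.1 = y.1 /\ exists a, forall s, x.2 s = y.2 s + a;
     gp_one := (1, h 1 1);
     gp_inv := fun x => (x.1^-1,
       fun s => h 1 1 (x.1^-1 * s) - x.2 (x.1^-1 * s) + h x.1^-1 x.1 (x.1^-1 * s));
     gp_mul := ext_mul |}.
Next Obligation. by move=> x; split=> //; exists 0 => s; rewrite addr0. Qed.
Next Obligation.
by move=> x y [-> [a E]]; split=> //; exists (- a) => s; rewrite E addrK.
Qed.
Next Obligation.
move=> x y z [-> [a E]] [-> [b E']]; split=> //; exists (b + a) => s.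
by rewrite E E' addrA.
Qed.
Next Obligation.
move=> [k f] [k' f'] [l g] [l' g'] [/= <- [a E]] [/= <- [b E']].
by split=> //=; exists (a + b) => s; rewrite E E'; zmod.
Qed.
Next Obligation.
move=> [k f] [l g] [m e]; split; first exact: mulgA.
exists (h k l m) => s /=; rewrite -!mulgA.
by zlin (pent k l m s).
Qed.
Next Obligation.
move=> [l g]; split; first exact: mul1g.
exists (h 1 1 l) => s /=; have := pent 1 1 l s; rewrite !mul1g => E.
by zlin E.
Qed.
Next Obligation.
move=> [l g]; split; first exact: mulVg.
by exists 0 => s /=; rewrite mulKg; zmod.
Qed.

Let N : groupType := gquot ext_pres.
Let cls (l : L) (f : L -> A) : N := gcls ((l, f) : ext_pres).

Let clsM k f l g :
  cls k f * cls l g = cls (k * l) (fun s => f (l * s) + g s - h k l s).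
Proof. by rewrite -gcls_mul. Qed.

Let clsP k f l g :
  cls k f = cls l g <-> k = l /\ exists a, forall s, f s = g s + a.
Proof. exact: (gclsP ((k, f) : ext_pres) (l, g)). Qed.

Let prj (n : N) : L := (grep n).1.
Let fn (n : N) : L -> A := (grep n).2.

Let nE n : n = cls (prj n) (fn n).
Proof. by rewrite /cls /prj /fn -surjective_pairing grepK. Qed.

Let prj_cls l f : prj (cls l f) = l.
Proof. by have /clsP[] := nE (cls l f). Qed.

Let prjM : morph_mul prj.
Proof. by move=> m n; rewrite [m]nE [n]nE clsM !prj_cls. Qed.

(* The commutator of [n] with a pair over [b]; by the hexagon identity it is a 1-cocycle. *)
Let kap (b : L) (n : N) (s : L) : A :=
  fn n (b * s) - fn n s + h b (prj n) s - h (prj n) b s + c b (prj n).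

Let kap_cls b l g s :
  kap b (cls l g) s = g (b * s) - g s + h b l s - h l b s + c b l.
Proof.
have /clsP[El [a Ef]] := nE (cls l g).
by rewrite /kap -El !Ef; zmod.
Qed.

(** Pentagon identities with [b] in first, second and third place; the symmetry terms cancel by the
    hexagon identity. *)
Let kapM b m n s : kap b (m * n) s = kap b m (prj n * s) + kap b n s.
Proof.
rewrite [m in LHS]nE [n in LHS]nE clsM kap_cls /kap.
move: (prj m) (prj n) (fn m) (fn n) => k l f g.
have E1 := pent b k l s; have E2 := pent k b l s; have E3 := pent k l b s.
have E4 := hexa b k l; rewrite (free_abC k b) (free_abC b l) in E1 E2.
rewrite -(_ : l * (b * s) = b * (l * s)); last by rewrite !mulgA (free_abC l).
zlin (congr2 +%R (congr2 +%R (congr2 +%R (esym E1) E2) (esym E3)) (esym E4)).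
Qed.

(** A partial lift of the generators to pairwise commuting elements of [N], given by its graph so
    that Zorn's lemma applies to inclusion. *)
Let compatible (Y : set (B * N)) : Prop :=
  [/\ forall x y, Y x -> Y y -> commute x.2 y.2,
      forall x, Y x -> prj x.2 = fa_gen x.1 &
      forall b m n, Y (b, m) -> Y (b, n) -> m = n].

(** A lift of [b] commutes with the elements chosen so far if its function satisfies
    [f (x * s) = kap b n s + f s] for [(x, n)] in [Y]. This asks that a 1-cocycle of the subgroup
    spanned by the generators already lifted be a coboundary. It is one, because the functions on
    [L] form a coinduced module over that subgroup. *)
Let extend (Y : set (B * N)) (b : B) : compatible Y ->
  exists n, prj n = fa_gen b /\ forall x, Y x -> commute n x.2.
Proof.
move=> [YC Yp YF].
(* With default value 1 outside the domain of [Y], the map [p] below projects [L] onto the subgroup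
   spanned by the generators in that domain. *)
pose g0 x := if pselect (exists n, Y (x, n)) is left H then sval (cid H) else 1.
have g0P x : Y (x, g0 x) \/ g0 x = 1.
  rewrite /g0; case: pselect => [H|]; last by right.
  by left; apply: (proj2_sig (cid H)).
have g0C : commuting g0.
  move=> x y; case: (g0P x) => [Yx|->]; last exact/commute_sym/commute1.
  by case: (g0P y) => [Yy|->]; [apply: YC Yx Yy | apply: commute1].
pose rho := fa_lift g0; have rhoM : morph_mul rho := fa_lift_mul g0C.
pose p x := prj (rho x).
have pM : morph_mul p by move=> x y; rewrite /p rhoM prjM.
have pg x : p (fa_gen x) = prj (g0 x) by rewrite /p /rho fa_lift_gen.
have pp x : p (p x) = p x.
  apply: (fa_morph_eq (f := p \o p) _ pM) => [{}x y|{}x]; first by rewrite /= !pM.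
  rewrite /= !pg; case: (g0P x) => [Yx|->]; first by rewrite (Yp _ Yx) pg (Yp _ Yx).
  by rewrite (morph_mul1 prjM) (morph_mul1 pM).
(* Here [(p s)^-1 * s] is the representative, killed by [p], of the coset of [s]; the cocycle
   condition propagates the values of [f] from it. *)
pose f s := kap (fa_gen b) (rho (p s)) ((p s)^-1 * s).
exists (cls (fa_gen b) f); split; first exact: prj_cls.
move=> [x n] Yx /=; have nx : g0 x = n.
  rewrite /g0; case: pselect => [H|[]]; last by exists n.
  by apply: YF Yx; apply: (proj2_sig (cid H)).
have pn := Yp _ Yx; rewrite /= in pn.
have fM s : f (fa_gen x * s) = kap (fa_gen b) n s + f s.
  rewrite /f pM pg nx pn rhoM {1}/rho fa_lift_gen // nx kapM.
  rewrite -/(p (p s)) pp (_ : (_ * p s)^-1 * _ = (p s)^-1 * s) ?mulVKg //.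
  by rewrite invgM -mulgA mulKg.
rewrite /commute [n]nE !clsM pn; apply/clsP; split; first exact: free_abC.
exists (c (fa_gen b) (fa_gen x)) => s.
by rewrite fM /kap pn; zmod.
Qed.

Let total_family : exists n : B -> N,
  commuting n /\ forall b, prj (n b) = fa_gen b.
Proof.
(* A maximal compatible family is total, since otherwise [extend] enlarges it. *)
have [|Y [[YC Yp YF] Ymax]] := @Zorn_bigcup _ compatible.
  move=> F FP Ftot.
  have two x y : (\bigcup_(X in F) X)%classic x ->
      (\bigcup_(X in F) X)%classic y -> exists2 Z, F Z & Z x /\ Z y.
    move=> [X FX Xx] [X' FX' X'y]; case: (Ftot _ _ FX FX') => H.
      by exists X' => //; split=> //; apply: H.
    by exists X => //; split=> //; apply: H.
  split=> [x y Ux Uy|x [X FX Xx]|b m n Um Un].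
  - have [Z FZ [Zx Zy]] := two _ _ Ux Uy.
    by have [ZC _ _] := FP _ FZ; apply: ZC.
  - by have [_ Xp _] := FP _ FX; apply: Xp.
  - have [Z FZ [Zm Zn]] := two _ _ Um Un.
    by have [_ _ ZF] := FP _ FZ; apply: ZF Zm Zn.
have YT b : exists n, Y (b, n).
  apply: contrapT => nY.
  have [n [pn nC]] := extend b (And3 YC Yp YF).
  apply: (Ymax (Y `|` [set (b, n)])%classic).
    split; first by move=> x Yx; left.
    by move=> /(_ (b, n)) H; apply: nY; exists n; apply: H; right.
  split.
  - move=> x y [Yx|->] [Yy|->] //=; first exact: YC.
      exact/commute_sym/nC.
    exact: nC.
  - by move=> x [Yx|-> //]; apply: Yp.
  - move=> b' m m' [Ym|[-> ->]] [Ym'|E]; first exact: YF Ym Ym'.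
    + by case: E Ym => -> _ Ym; case: nY; exists m.
    + by case: nY; exists m'.
    + by case: E.
exists (fun b => sval (cid (YT b))); split=> [b b'|b].
  exact: YC (proj2_sig (cid (YT b))) (proj2_sig (cid (YT b'))).
exact: Yp (proj2_sig (cid (YT b))).
Qed.

(** Commuting lifts of the generators extend to a homomorphic section of [prj]; up to constants, its
    functions have coboundary [h]. *)
Theorem cocycle_trivial : exists U : L -> L -> A,
  forall k l s, U k (l * s) + U l s = U (k * l) s + U k l + h k l s.
Proof.
have [n [nC pn]] := total_family.
pose rho := fa_lift n; have rhoM : morph_mul rho := fa_lift_mul nC.
have prho x : prj (rho x) = x.
  apply: (fa_morph_eq (f := prj \o rho) (g := id)) => // [{}x y|b].
    by rewrite /= rhoM prjM.
  by rewrite /= /rho fa_lift_gen.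
have uP k l : exists a, forall s,
    fn (rho k) (l * s) + fn (rho l) s - h k l s = fn (rho (k * l)) s + a.
  have := rhoM k l; rewrite {1}[rho (k * l)]nE {1}[rho k]nE {1}[rho l]nE.
  rewrite !prho clsM => /esym/clsP[_ //].
(* Subtracting the value at 1 removes the unknown constant [a] but leaves [h k l 1], which the terms
   [h k 1 1] compensate by the pentagon identity. *)
exists (fun k s => fn (rho k) s - fn (rho k) 1 - h k 1 1) => k l s.
have [a E] := uP k l.
have := pent k l 1 1; rewrite !mulg1 => E1.
have E0 := E 1; rewrite mulg1 in E0.
zlin (congr2 +%R (congr2 +%R (E s) (esym E0)) E1).
Qed.

End Cocycle.

(** * Categories and Picard groupoids *)

Definition fully_faithful (C D : category) (F : functor C D) : Prop :=
  forall (x y : C) (g : hom (F x) (F y)), exists! f : hom x y, fmap F f = g.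

Lemma functor_eq (C D : category) (F G : functor C D) (e : forall x, F x = G x) :
  (forall x y (f : hom x y), eqm (e y) ∘ fmap F f = fmap G f ∘ eqm (e x)) ->
  F = G.
Proof.
case: F G e => [F Fm F1 FM] [G Gm G1 GM] /= e E.
have FG : F = G by apply: functional_extensionality_dep.
case: G / FG e Gm G1 GM E => e Gm G1 GM E.
have FG : Fm = Gm.
  do 2![apply: functional_extensionality_dep => ?].
  apply: functional_extensionality_dep => f.
  by have := E _ _ f; rewrite !eqm1 cmp1m cmpm1.
case: Gm / FG G1 GM {E} => G1 GM.
by rewrite (Prop_irrelevance F1 G1) (Prop_irrelevance FM GM).
Qed.

Section FullyFaithful.
Variables (C D : category) (F : functor C D).
Hypothesis Fff : fully_faithful F.

Let pre (x y : C) (g : hom (F x) (F y)) : hom x y := sval (cid (Fff g)).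

Let preK (x y : C) (g : hom (F x) (F y)) : fmap F (pre g) = g.
Proof. exact: (proj2_sig (cid (Fff g))).1. Qed.

Lemma ff_inj (x y : C) (f g : hom x y) : fmap F f = fmap F g -> f = g.
Proof. by move=> fg; have [h [_ U]] := Fff (fmap F g); rewrite -(U f fg) (U g). Qed.

Lemma ff_equivalence :
  (forall d : D, exists (c : C) (f : hom (F c) d), is_iso f) ->
  is_equivalence F.
Proof.
move=> Fes; pose g d := sval (cid (Fes d)).
pose e d : hom (F (g d)) d := sval (cid (proj2_sig (cid (Fes d)))).
have eI d : is_iso (e d) := proj2_sig (cid (proj2_sig (cid (Fes d)))).
pose i d : hom d (F (g d)) := sval (cid (eI d)).
have ie d : i d ∘ e d = idm _ := (proj2_sig (cid (eI d))).1.
have ei d : e d ∘ i d = idm _ := (proj2_sig (cid (eI d))).2.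
pose gm d d' (u : hom d d') := pre (i d' ∘ u ∘ e d).
have g1 d : gm d d (idm d) = idm (g d).
  by apply: ff_inj; rewrite preK fmap1 cmpm1 ie.
have gM d d' d'' (u : hom d' d'') (v : hom d d') :
    gm _ _ (u ∘ v) = gm _ _ u ∘ gm _ _ v.
  apply: ff_inj; rewrite fmapM !preK !cmpA.
  by rewrite -(cmpA _ (e d') (i d')) ei cmpm1.
exists (Functor g1 gM); split.
  exists (fun x => pre (e (F x))); split=> [x y u|x].
    by rewrite /=; apply: ff_inj; rewrite !fmapM !preK !cmpA ei cmp1m.
  exists (pre (i (F x))).
  by rewrite /=; split; apply: ff_inj; rewrite fmapM fmap1 !preK.
exists e; split=> // x y u.
by rewrite /= preK !cmpA ei cmp1m.
Qed.

Lemma ff_isomorphism :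
  (forall x y : C, F x = F y -> x = y) -> (forall d : D, exists c, F c = d) ->
  is_isomorphism F.
Proof.
move=> Finj Fsurj; pose g d := sval (cid (Fsurj d)).
have e d : F (g d) = d := proj2_sig (cid (Fsurj d)).
pose gm d d' (u : hom d d') := pre (eqm (esym (e d')) ∘ u ∘ eqm (e d)).
have g1 d : gm d d (idm d) = idm (g d).
  by apply: ff_inj; rewrite preK fmap1 cmpm1 eqm_trans eqm1.
have gM d d' d'' (u : hom d' d'') (v : hom d d') :
    gm _ _ (u ∘ v) = gm _ _ u ∘ gm _ _ v.
  apply: ff_inj; rewrite fmapM !preK !cmpA.
  by rewrite -(cmpA _ (eqm (e d'))) eqm_trans eqm1 cmpm1.
exists (Functor g1 gM); split.
  apply: (@functor_eq _ _ (compF (Functor g1 gM) F) (idF C)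
    (fun x => Finj _ _ (e (F x)))) => x y u /=.
  apply: ff_inj; rewrite !fmapM !fmap_eqm preK !cmpA eqm_trans eqm1 cmp1m.
  by congr (_ ∘ _); apply: eqm_irr.
apply: (@functor_eq _ _ (compF F (Functor g1 gM)) (idF D) e) => x y u /=.
by rewrite preK !cmpA eqm_trans eqm1 cmp1m.
Qed.

End FullyFaithful.

Lemma iso_cancel_l (C : category) (x y z : C) (u : hom y z) (f g : hom x y) :
  is_iso u -> u ∘ f = u ∘ g -> f = g.
Proof. by move=> [v [vu _]] /(congr1 (cmp v)); rewrite !cmpA vu !cmp1m. Qed.

Lemma iso_cancel_r (C : category) (x y z : C) (u : hom x y) (f g : hom y z) :
  is_iso u -> f ∘ u = g ∘ u -> f = g.
Proof.
by move=> [v [_ uv]] /(congr1 (cmp^~ v)); rewrite -!cmpA uv !cmpm1.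
Qed.

Lemma nat_iso_faithful (C D : category) (F : functor C D) (G : functor D C) :
  nat_iso (compF G F) (idF C) ->
  forall (x y : C) (f g : hom x y), fmap F f = fmap F g -> f = g.
Proof.
move=> [t [tN tI]] x y f g fg; apply: (iso_cancel_r (tI x)).
by have := tN _ _ f; have := tN _ _ g; rewrite /= fg => -> ->.
Qed.

Lemma equivalence_fully_faithful (C D : category) (F : functor C D) :
  is_equivalence F -> fully_faithful F.
Proof.
move=> [G [GF FG]] x y g; have [t [tN tI]] := GF; have [u [ut tu]] := tI x.
exists (t y ∘ fmap G g ∘ u); split; last first.
  move=> f fg; apply: (iso_cancel_r (tI x)).
  by have := tN _ _ f; rewrite /= fg => <-; rewrite -!cmpA ut cmpm1.
apply: (nat_iso_faithful FG); apply: (iso_cancel_l (tI y)).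
have /= -> := tN _ _ (t y ∘ fmap G g ∘ u).
by rewrite -!cmpA ut cmpm1.
Qed.

(** * Inverses and isomorphism classes in a Picard groupoid *)

Section Inverse.
Variable P : picard.

Definition ginv (x y : P) (f : hom x y) : hom y x :=
  sval (cid (picard_groupoid f)).

Lemma ginvl (x y : P) (f : hom x y) : ginv f ∘ f = idm x.
Proof. exact: (proj2_sig (cid (picard_groupoid f))).1. Qed.

Lemma ginvr (x y : P) (f : hom x y) : f ∘ ginv f = idm y.
Proof. exact: (proj2_sig (cid (picard_groupoid f))).2. Qed.

Lemma gcancel_l (x y z : P) (u : hom y z) (f g : hom x y) :
  u ∘ f = u ∘ g -> f = g.
Proof. exact/iso_cancel_l/picard_groupoid. Qed.

Lemma gcancel_r (x y z : P) (u : hom x y) (f g : hom y z) :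
  f ∘ u = g ∘ u -> f = g.
Proof. exact/iso_cancel_r/picard_groupoid. Qed.

Lemma tensor_left_ff (x : P) : fully_faithful (tensor_left x).
Proof. exact/equivalence_fully_faithful/picard_tensor. Qed.

(** In a groupoid, this is the relation of being isomorphic. *)
Definition linked (x y : P) : Prop := inhabited (hom x y).

Lemma linked_refl x : linked x x.
Proof. exact: inhabits (idm x). Qed.

Lemma linked_sym x y : linked x y -> linked y x.
Proof. by move=> [f]; exists; apply: ginv f. Qed.

Lemma linked_trans x y z : linked x y -> linked y z -> linked x z.
Proof. by move=> [f] [g]; exists; apply: (g ∘ f). Qed.

Lemma linked_tns x x' y y' :
  linked x x' -> linked y y' -> linked (x ⊗ y) (x' ⊗ y').
Proof. by move=> [f] [g]; exists; apply: (f ⊠ g). Qed.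

Lemma linked_cancel x y y' : linked (x ⊗ y) (x ⊗ y') -> linked y y'.
Proof.
move=> [f]; have [g _] := (tensor_left_ff (x := x) (f : hom (tensor_left x y) (tensor_left x y'))).
exact: inhabits g.
Qed.

Lemma linked_inverse (x : P) : exists y : P, linked (y ⊗ x) unt.
Proof.
have [G [_ [t [_ _]]]] := picard_tensor x.
exists (G unt); apply: (linked_trans (inhabits (com _ _))).
exact: inhabits (t unt).
Qed.

End Inverse.

(** * Phases *)

(* All automorphism groups of a Picard groupoid are copies of the automorphism group of
   the unit; a phase measures every morphism by an element of that group, so that
   coherence conditions turn into additive identities. *)
Record phase (P : picard) := Phase {
  ph_ab : zmodType;
  ph : forall x y : P, hom x y -> ph_ab;
  ph_cor : P -> P -> ph_ab;
  phM : forall (x y z : P) (g : hom y z) (f : hom x y), ph (g ∘ f) = ph g + ph f;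
  ph_inj : forall (x y : P) (f g : hom x y), ph f = ph g -> f = g;
  ph_surj : forall (x y : P) a, linked x y -> exists f : hom x y, ph f = a;
  ph_tns : forall (x x' y y' : P) (f : hom x x') (g : hom y y'),
    ph (f ⊠ g) = ph f + ph g + ph_cor x' y' - ph_cor x y }.

Section PhaseConstruction.
Variable P : picard.

Definition unit_aut : Type := {classic @hom P unt unt}.
HB.instance Definition _ := Choice.on unit_aut.

(** The action of the automorphisms of the unit on each object, which identifies them with the
    automorphisms of [x], see [sc_bij]. *)
Let sc (x : P) (a : unit_aut) : hom x x := run x ∘ (idm x ⊠ a) ∘ ginv (run x).

Let sc_nat (x y : P) (f : hom x y) a : sc y a ∘ f = f ∘ sc x a.
Proof.
apply: (gcancel_r (u := run x)); rewrite /sc -!cmpA ginvl cmpm1.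
rewrite -run_nat (cmpA (ginv _)) ginvl cmp1m -tnsmM cmp1m cmpm1.
by rewrite [in RHS]cmpA -run_nat -cmpA -tnsmM cmp1m cmpm1.
Qed.

Let scM (x : P) (a b : unit_aut) : sc x (a ∘ b : hom unt unt) = sc x a ∘ sc x b.
Proof.
rewrite /sc -!cmpA (cmpA (ginv _)) ginvl cmp1m (cmpA (idm x ⊠ a)) -tnsmM.
by rewrite cmp1m.
Qed.

Let sc_bij (x : P) (f : hom x x) : exists! a, sc x a = f.
Proof.
have [a [aE aU]] := tensor_left_ff (x := x)
  (ginv (run x) ∘ f ∘ run x : hom (tensor_left x unt) (tensor_left x unt)).
exists a; split.
  rewrite /sc; move: aE => /= ->.
  by rewrite !cmpA ginvr cmp1m -cmpA ginvr cmpm1.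
move=> b bE; apply: aU; rewrite -bE /= /sc.
by rewrite !cmpA ginvl cmp1m -cmpA ginvl cmpm1.
Qed.

Let sc_inj (x : P) a b : sc x a = sc x b -> a = b.
Proof.
by move=> ab; have [c [_ U]] := sc_bij (sc x b); rewrite -(U a ab) (U b).
Qed.

Let add (a b : unit_aut) : unit_aut := a ∘ b.

Let addA : associative add.
Proof. by move=> a b c; apply: cmpA. Qed.

(** By naturality [sc unt b] commutes with every endomorphism of the unit, in particular with
    [sc unt a]; and [sc unt] is multiplicative and injective. *)
Let addC : commutative add.
Proof.
move=> a b; apply: (@sc_inj unt); rewrite !scM.
by have [f [<- _]] := sc_bij (sc unt a); apply: esym; apply: sc_nat.
Qed.

Let add0 : left_id (idm unt : unit_aut) add.
Proof. by move=> a; apply: cmp1m. Qed.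

Let addN : left_inverse (idm unt : unit_aut) (fun a => ginv a) add.
Proof. by move=> a; apply: ginvl. Qed.

HB.instance Definition _ :=
  GRing.isZmodule.Build unit_aut addA addC add0 addN.

Let rep (x : P) : P :=
  choose (fun y : {classic P} => `[< linked x y >]) (x : {classic P}).

Let rep_linked x : linked x (rep x).
Proof.
have := @chooseP {classic P} (fun y => `[< linked x y >]) x.
by move=> /(_ (asboolT (linked_refl x)))/asboolP.
Qed.

Let rep_eq (x y : P) : linked x y -> rep x = rep y.
Proof.
move=> xy; rewrite /rep; set p := fun _ => _; set q := fun _ => _.
have -> : choose p (x : {classic P}) = choose p (y : {classic P}).
  by apply: choose_id; apply/asboolP => //; apply: linked_refl.
apply: (@eq_choose {classic P}) => z; apply/asboolP/asboolP => xz; last exact: linked_trans xy xz.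
exact: linked_trans (linked_sym xy) xz.
Qed.

Let K (x : P) : hom x (rep x).
Proof. exact: (sval (cid (let: inhabits f := rep_linked x in ex_intro (fun=> True) f I))). Qed.

(** The morphisms [K] to chosen representatives give a reference isomorphism between any two
    isomorphic objects; the phase of [f] is its deviation from this reference. *)
Let phase_ex (x y : P) (f : hom x y) : exists a,
  exists e : rep x = rep y, K y ∘ f = eqm e ∘ K x ∘ sc x a.
Proof.
have e := rep_eq (inhabits f).
have [a [aE _]] := sc_bij (ginv (eqm e ∘ K x) ∘ K y ∘ f).
by exists a, e; rewrite aE !cmpA ginvr cmp1m.
Qed.

Let nu (x y : P) (f : hom x y) : unit_aut := sval (cid (phase_ex f)).

Let nuP (x y : P) (f : hom x y) (e : rep x = rep y) :
  K y ∘ f = eqm e ∘ K x ∘ sc x (nu f).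
Proof.
rewrite /nu; case: (cid _) => a [e' /= ->].
by rewrite (Prop_irrelevance e e').
Qed.

Let nu_uniq (x y : P) (f : hom x y) (e : rep x = rep y) a :
  K y ∘ f = eqm e ∘ K x ∘ sc x a -> nu f = a.
Proof. by rewrite (nuP f e) => /gcancel_l/sc_inj. Qed.

Let nuM (x y z : P) (g : hom y z) (f : hom x y) : nu (g ∘ f) = nu g + nu f.
Proof.
have e := rep_eq (inhabits f); have e' := rep_eq (inhabits g).
apply: (nu_uniq (e := etrans e e')); rewrite cmpA (nuP g e') -cmpA sc_nat cmpA.
have assoc (s t : hom x x) :
    eqm e' ∘ (eqm e ∘ K x ∘ s) ∘ t = eqm (etrans e e') ∘ K x ∘ (s ∘ t).
  by rewrite !cmpA eqm_trans.
rewrite -(cmpA (eqm e')) (nuP f e) assoc -scM.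
by congr (_ ∘ sc _ _); apply: (addC (nu f)).
Qed.

Let nu_inj (x y : P) (f g : hom x y) : nu f = nu g -> f = g.
Proof.
have e := rep_eq (inhabits f); move=> fg.
by apply: (gcancel_l (u := K y)); rewrite !(nuP _ e) fg.
Qed.

Let nu_sc (x : P) a : nu (sc x a) = a.
Proof. by apply: (nu_uniq (e := erefl)); rewrite cmp1m. Qed.

Let nu_surj (x y : P) a : linked x y -> exists f : hom x y, nu f = a.
Proof.
by move=> [f]; exists (f ∘ sc x (a - nu f)); rewrite nuM nu_sc addrC subrK.
Qed.

Let nu_id (x : P) : nu (idm x) = 0.
Proof. by apply: (addrI (nu (idm x))); rewrite -nuM cmp1m addr0. Qed.

Let nu_eqm (x y : P) (e : x = y) : nu (eqm e) = 0.
Proof. by case: y / e; apply: nu_id. Qed.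

Let nu_conj (x y : P) (u : hom x y) (f : hom x x) (g : hom y y) :
  u ∘ f = g ∘ u -> nu f = nu g.
Proof. by move=> /(congr1 (@nu _ _)); rewrite !nuM addrC => /addIr. Qed.

(** Conjugation preserves the phase of an automorphism; conjugating by unit and associativity
    constraints moves the scalar from the second factor to the whole product. *)
Let nu_sc_r (x y : P) a : nu (idm x ⊠ sc y a) = a.
Proof.
have -> : nu (idm x ⊠ sc y a) = nu (idm x ⊠ (idm y ⊠ a)).
  apply/esym/(nu_conj (u := idm x ⊠ run y)).
  by rewrite -!tnsmM /sc -!cmpA ginvl !cmpm1.
have -> : nu (idm x ⊠ (idm y ⊠ a)) = nu (idm (x ⊗ y) ⊠ a).
  by apply: (nu_conj (u := ass x y unt)); rewrite ass_nat tnsm1.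
rewrite -[RHS](nu_sc (x ⊗ y)); apply: (nu_conj (u := run _)).
by rewrite /sc -!cmpA ginvl cmpm1.
Qed.

Let nu_sc_l (x y : P) a : nu (sc x a ⊠ idm y) = a.
Proof.
by rewrite -[RHS](nu_sc_r y x); apply: (nu_conj (u := com x y)); rewrite com_nat.
Qed.

(** Scalars add up under the tensor product, so the defect comes from [K x ⊠ K y] alone. The double
    sign matches [ph_tns], with [- nu (K x ⊠ K y)] as correction term. *)
Let nu_tns (x x' y y' : P) (f : hom x x') (g : hom y y') :
  nu (f ⊠ g) = nu f + nu g - nu (K x' ⊠ K y') - - nu (K x ⊠ K y).
Proof.
have e := rep_eq (inhabits f); have e' := rep_eq (inhabits g).
have : nu (K x' ⊠ K y' ∘ (f ⊠ g)) = nu (K x ⊠ K y) + (nu f + nu g).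
  have sc_tns a b : nu (sc x a ⊠ sc y b) = a + b.
    rewrite -[RHS](congr2 +%R (nu_sc_l x y a) (nu_sc_r x y b)) -nuM -tnsmM.
    by rewrite cmp1m cmpm1.
  rewrite -tnsmM (nuP f e) (nuP g e') tnsmM nuM sc_tns tnsmM nuM tnsm_eqm nu_eqm.
  by rewrite add0r.
by rewrite nuM => E; zlin E.
Qed.

Definition picard_phase : phase P.
Proof. exact: Phase nuM nu_inj nu_surj nu_tns. Qed.

End PhaseConstruction.

(** * Coherence conditions in terms of phases *)

Section PhaseTheory.
Variables (P : picard) (V : phase P).
Notation "'ν' f" := (ph V f) (at level 10, f at level 9).
Notation m := (ph_cor V).

Lemma ph1 (x : P) : ν (idm x) = 0.
Proof. by apply: (addrI (ν (idm x))); rewrite -phM cmp1m addr0. Qed.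

Lemma ph_eqm (x y : P) (e : x = y) : ν (eqm e) = 0.
Proof. by case: y / e; apply: ph1. Qed.

(** The correction terms make this depend on isomorphism classes only, see [ph_ass_linked]; the same
    holds for [ph_com]. *)
Definition ph_ass (x y z : P) : ph_ab V :=
  ν (ass x y z) + m y z + m x (y ⊗ z) - m x y - m (x ⊗ y) z.

Definition ph_com (x y : P) : ph_ab V := ν (com x y) + m x y - m y x.

Lemma ph_ass_linked (x x' y y' z z' : P) :
  linked x x' -> linked y y' -> linked z z' -> ph_ass x y z = ph_ass x' y' z'.
Proof.
move=> [f] [g] [k]; have := congr1 (@ph _ V _ _) (ass_nat f g k).
by rewrite !phM !ph_tns /ph_ass => E; zlin (esym E).
Qed.

Lemma ph_com_linked (x x' y y' : P) :
  linked x x' -> linked y y' -> ph_com x y = ph_com x' y'.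
Proof.
move=> [f] [g]; have := congr1 (@ph _ V _ _) (com_nat f g).
by rewrite !phM !ph_tns /ph_com => E; zlin (esym E).
Qed.

Lemma ph_pentagon (w x y z : P) :
  ph_ass (w ⊗ x) y z + ph_ass w x (y ⊗ z) =
  ph_ass w x y + ph_ass w (x ⊗ y) z + ph_ass x y z.
Proof.
have := congr1 (@ph _ V _ _) (pentagon w x y z).
by rewrite !phM !ph_tns !ph1 /ph_ass => E; zlin E.
Qed.

Lemma ph_hexagon (x y z : P) :
  ph_ass z x y + ph_com (x ⊗ y) z + ph_ass x y z =
  ph_com x z + ph_ass x z y + ph_com y z.
Proof.
have := congr1 (@ph _ V _ _) (hexagon x y z).
by rewrite !phM !ph_tns !ph1 /ph_ass /ph_com => E; zlin E.
Qed.

Lemma ph_comC (x y : P) : ph_com x y + ph_com y x = 0.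
Proof.
have := congr1 (@ph _ V _ _) (com_sym x y).
by rewrite !phM !ph1 /ph_com => E; zlin E.
Qed.

Definition ph_lun (x : P) : ph_ab V := ν (lun x) + m unt x.
Definition ph_run (x : P) : ph_ab V := ν (run x) + m x unt.

Lemma ph_lun_linked (x y : P) : linked x y -> ph_lun x = ph_lun y.
Proof.
move=> [f]; have := congr1 (@ph _ V _ _) (lun_nat f).
by rewrite !phM !ph_tns !ph1 /ph_lun => E; zlin (esym E).
Qed.

Lemma ph_triangle (x y : P) : ph_ass x unt y = ph_lun y - ph_run x.
Proof.
have := congr1 (@ph _ V _ _) (triangle x y).
by rewrite !phM !ph_tns !ph1 /ph_ass /ph_lun /ph_run => E; zlin E.
Qed.

(** At the unit the pentagon equates twice the value with three times the value; the hexagon yields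
    [ph_com_unt] in the same way. *)
Lemma ph_ass_unt (x y z : P) :
  linked x unt -> linked y unt -> linked z unt -> ph_ass x y z = 0.
Proof.
move=> x1 y1 z1; rewrite (ph_ass_linked x1 y1 z1).
have u1 : linked (unt ⊗ unt) (unt : P) := inhabits (run unt).
have u0 := linked_refl (unt : P).
have := ph_pentagon unt unt unt unt; rewrite !(ph_ass_linked u1 u0 u0).
rewrite (ph_ass_linked u0 u1 u0) (ph_ass_linked u0 u0 u1) => E.
by zlin (esym E).
Qed.

Lemma ph_com_unt (x y : P) : linked x unt -> linked y unt -> ph_com x y = 0.
Proof.
move=> x1 y1; rewrite (ph_com_linked x1 y1).
have u0 := linked_refl (unt : P).
have := ph_hexagon unt unt unt.
rewrite (ph_com_linked (inhabits (run unt)) u0) !ph_ass_unt // => E.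
by zlin (esym E).
Qed.

Lemma ph_lun_run : ph_lun unt = ph_run unt.
Proof.
have u0 := linked_refl (unt : P).
by have := ph_triangle unt unt; rewrite ph_ass_unt // => E; zlin (esym E).
Qed.

End PhaseTheory.

(** * The universal property of the presentation *)

Lemma d3s0 (C : S_category) n (X : C n.+2) : d3 (s0 X) = s0 (d2 X).
Proof.
have H : (@ord0 n.+1 < ord2 n)%N by [].
have := congr1 (fun F : functor _ _ => F X) (face_degen_gt C H).
by rewrite /= (_ : widen_ord _ _ = ord0) //; apply: val_inj.
Qed.

Lemma d3s1 (C : S_category) n (X : C n.+2) : d3 (s1 X) = s1 (d2 X).
Proof.
have H : (ord1 n < ord2 n)%N by [].
have := congr1 (fun F : functor _ _ => F X) (face_degen_gt C H).
by rewrite /= (_ : widen_ord _ _ = ord1 _) //; apply: val_inj.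
Qed.

Lemma sqm_hom_eq (E E' : sqm) (f g : sqm_hom E E') :
  (forall x, sf0 f x = sf0 g x) -> (forall a, sf1 f a = sf1 g a) -> f = g.
Proof.
case: f g => [f0 f1 a b c d] [g0 g1 a' b' c' d'] /= E0 E1.
have {}E0 : f0 = g0 by apply: functional_extensionality_dep.
have {}E1 : f1 = g1 by apply: functional_extensionality_dep.
case: g0 / E0 a' c' d'; case: g1 / E1 b' => b' a' c' d'.
by rewrite (Prop_irrelevance a a') (Prop_irrelevance b b')
  (Prop_irrelevance c c') (Prop_irrelevance d d').
Qed.

Program Definition comp_sqm (E E' E'' : sqm) (g : sqm_hom E' E'')
  (f : sqm_hom E E') : sqm_hom E E'' :=
  {| sf0 := fun x => sf0 g (sf0 f x); sf1 := fun a => sf1 g (sf1 f a) |}.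
Next Obligation. by move=> * /=; rewrite !sf0_mul. Qed.
Next Obligation. by move=> * /=; rewrite !sf1_mul. Qed.
Next Obligation. by move=> * /=; rewrite !sf_bd. Qed.
Next Obligation. by move=> * /=; rewrite !sf_br. Qed.

Definition id_sqm (E : sqm) : sqm_hom E E :=
  @SqmHom E E id id (fun _ _ => erefl) (fun _ _ => erefl) (fun _ => erefl)
    (fun _ _ => erefl).

Section GammaMorphisms.
Variable E : sqm.

Definition gval (x y : gamma E) (f : hom x y) : sq1 E := sval f.
Definition ghm (x y : gamma E) (a : sq1 E) (e : (y : sq0 E) * sbd a = x) :
  hom x y := exist _ a e.

Lemma gvalP (x y : gamma E) (f : hom x y) : (y : sq0 E) * sbd (gval f) = x.
Proof. exact: (proj2_sig f). Qed.

Lemma gval_inj (x y : gamma E) (f g : hom x y) : gval f = gval g -> f = g.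
Proof. exact: ghom_eq. Qed.

Lemma gval_ghm (x y : gamma E) a e : gval (@ghm x y a e) = a.
Proof. by []. Qed.

Lemma gval_idm (x : gamma E) : gval (idm x) = 1.
Proof. by []. Qed.

Lemma gval_cmp (x y z : gamma E) (g : hom y z) (f : hom x y) :
  gval (g ∘ f) = gval g * gval f.
Proof. by []. Qed.

Lemma gval_tns (x x' y y' : gamma E) (f : hom x x') (g : hom y y') :
  gval (f ⊠ g) = sact (gval f) y' * gval g.
Proof. by []. Qed.

Lemma gval_eqm (x y : gamma E) (e : x = y) : gval (eqm e) = 1.
Proof. exact: sval_eqm. Qed.

Lemma gval_ass (x y z : gamma E) : gval (ass x y z) = 1.
Proof. by []. Qed.

Lemma gval_com (x y : gamma E) : gval (com x y) = sbr (y : sq0 E) x.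
Proof. by []. Qed.

Definition gvalE := (gval_ghm, gval_idm, gval_cmp, gval_tns, gval_eqm, gval_ass, gval_com).

End GammaMorphisms.

Section Presentation.
Variable C : S_category.
Notation D := (Dsqm C).

(* The relations on degenerate simplices other than [s0 (s0 pt)] are consequences of
   [m_ass], see [m_s0] and [m_s1]. *)
Record model (E : sqm) := Model {
  mX : C 1%N -> sq0 E;
  mW : forall X X' : wcat C 1%N, hom X X' -> sq1 E;
  mT : C 2%N -> sq1 E;
  m_bdW : forall (X X' : wcat C 1%N) (f : hom X X'), mX X' * sbd (mW f) = mX X;
  m_bdT : forall T : C 2%N, mX (d1 T) * sbd (mT T) = mX (d0 T) * mX (d2 T);
  m_pt : mX (s0 (pt C)) = 1;
  m_ss : mT (s0 (s0 (pt C))) = 1;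
  m_cmp : forall (X Y Z : wcat C 1%N) (g : hom Y Z) (f : hom X Y),
    mW (g ∘ f) = mW g * mW f;
  m_nat : forall (T T' : wcat C 2%N) (f : hom T T'),
    mW (wface (ord1 _) f) * mT T =
    mT T' * (sact (mW (wface ord0 f)) (mX (d2 (T' : C 2%N))) *
             mW (wface (ord2 _) f));
  m_ass : forall T : C 3%N,
    mT (d1 T) * mT (d3 T) = mT (d2 T) * sact (mT (d0 T)) (mX (d2 (d3 T)));
  m_com : forall (X Y : C 1%N) (Z : coproduct X Y)
    (S : sum_simplex Z) (S' : sum_simplex (cp_swap Z)),
    let sum X Y (Z : coproduct X Y) (S : sum_simplex Z) :=
      mW (ss_d1 S) * mT S *
      (sact (mW (ss_d0 S)) (mX (d2 (S : C 2%N))) * mW (ss_d2 S)) in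
    sum X Y Z S = sum Y X (cp_swap Z) S' * sbr (mX X) (mX Y) }.

Section ModelHom.
Variables (E : sqm) (M : model E).

Lemma m_idm (X : wcat C 1%N) : mW M (idm X) = 1.
Proof. by apply: (mulgI (mW M (idm X))); rewrite -m_cmp cmp1m mulg1. Qed.

(** Three faces of [s0 (s0 X)] are [s0 X], and the fourth, [d3], is [s0 (s0 (pt C))], of value 1; so
    associativity equates the value at [s0 X] with its square. In [m_s1] the exceptional face is
    [d0]. *)
Lemma m_s0 (X : C 1%N) : mT M (s0 X) = 1.
Proof.
have := m_ass M (s0 (s0 X)); rewrite d1s0 d2s0 d1s0 d0s0 d3s0 d2s0 (ptP (d1 X)).
rewrite m_ss mulg1 d2s0 (ptP (d1 _)) m_pt sact_one.
by rewrite -{1}[mT M _]mulg1 => /mulgI.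
Qed.

Lemma m_s1 (X : C 1%N) : mT M (s1 X) = 1.
Proof.
have := m_ass M (s1 (s1 X)); rewrite d1s1 d2s1 d3s1 d2s1 d0s1 d0s1 (ptP (d0 X)).
by rewrite m_ss sact1 => /mulgI.
Qed.

Definition deg_car (s : degree) : groupType :=
  match s with Deg0 => sq0 E | Deg1 => sq1 E end.

Fixpoint meval s (t : dterm C s) : deg_car s :=
  match t in dterm _ s return deg_car s with
  | tX X => mX M X
  | tW _ _ f => mW M f
  | tT T => mT M T
  | tone _ => 1
  | tmul _ x y => meval x * meval y
  | tinv _ x => (meval x)^-1
  | tbd a => sbd (meval a : sq1 E)
  | tbr x y => sbr (meval x : sq0 E) (meval y : sq0 E)
  end.

Lemma meval_deq s (x y : dterm C s) : deq x y -> meval x = meval y.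
Proof.
elim=> {s x y} /=.
- by [].
- by [].
- by move=> s x y z _ -> _ ->.
- by move=> s x x' y y' _ -> _ ->.
- by move=> s x x' _ ->.
- by move=> a a' _ ->.
- by move=> x x' y y' _ -> _ ->.
- by move=> *; rewrite mulgA.
- by move=> *; rewrite mul1g.
- by move=> *; rewrite mulg1.
- by move=> *; rewrite mulVg.
- by move=> *; rewrite mulgV.
- by move=> *; rewrite sbd_mul.
- by move=> *; rewrite sbr_mull.
- by move=> *; rewrite sbr_mulr.
- by move=> *; rewrite sbr_anti.
- by move=> *; rewrite sbd_br.
- by move=> *; rewrite sbr_bd.
- by move=> X X' f; rewrite -(m_bdW M f) mulKg.
- by move=> T; rewrite -(m_bdT M T) mulKg.
- exact: m_pt.
- exact: m_idm.
- exact: m_s0.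
- exact: m_s1.
- by move=> *; rewrite m_cmp.
(* [deq_nat] acts by the source [d2 T] and [m_nat] by the target [d2 T']; the two actions differ by
   conjugation by the value on [wface (ord2 _) f]. *)
- move=> T T' f; rewrite m_nat mulKg -[mX M (d2 T)](m_bdW M (wface (ord2 _) f)).
  by rewrite -/(sact _ _) sact_mul sact_bd !mulgA mulgV mul1g.
- by move=> T; rewrite m_ass.
- move=> X Y Z S S'; apply: (canRL (mulKg _)).
  by have /= := m_com M S S'; rewrite /sact !mulgA => ->.
Qed.

Let ev s (u : dquot C s) : deg_car s := meval (drepr u).

Let ev_cls s (t : dterm C s) : ev (dclass t) = meval t.
Proof. exact/meval_deq/drepr_class. Qed.

Let ev_mul s : morph_mul (@ev s).
Proof.
by elim/dquotW=> x; elim/dquotW=> y; rewrite -dclass_mul !ev_cls.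
Qed.

Program Definition model_hom : sqm_hom D E :=
  {| sf0 := @ev Deg0; sf1 := @ev Deg1 |}.
Next Obligation. exact: ev_mul. Qed.
Next Obligation. exact: ev_mul. Qed.
Next Obligation. by elim/dquotW=> a; rewrite /= dbdE !ev_cls. Qed.
Next Obligation.
by elim/dquotW=> x; elim/dquotW=> y; rewrite /= dbrE !ev_cls.
Qed.

Lemma model_homX X : sf0 model_hom (dX X) = mX M X.
Proof. exact: (ev_cls (tX X)). Qed.

Lemma model_homW (X X' : wcat C 1%N) (f : hom X X') :
  sf1 model_hom (dW f) = mW M f.
Proof. exact: (ev_cls (tW f)). Qed.

Lemma model_homT T : sf1 model_hom (dT T) = mT M T.
Proof. exact: (ev_cls (tT T)). Qed.

End ModelHom.

(** Both degrees are treated at once because [sbd] and [sbr] lead from one to the other. *)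
Lemma D_ind (P0 : sq0 D -> Prop) (P1 : sq1 D -> Prop) :
  (forall X, P0 (dX X)) ->
  (forall (X X' : wcat C 1%N) (f : hom X X'), P1 (dW f)) ->
  (forall T, P1 (dT T)) ->
  P0 1 -> P1 1 ->
  (forall x y, P0 x -> P0 y -> P0 (x * y)) ->
  (forall a b, P1 a -> P1 b -> P1 (a * b)) ->
  (forall x, P0 x -> P0 x^-1) -> (forall a, P1 a -> P1 a^-1) ->
  (forall a, P1 a -> P0 (sbd a)) ->
  (forall x y, P0 x -> P0 y -> P1 (sbr x y)) ->
  (forall x, P0 x) /\ (forall a, P1 a).
Proof.
move=> PX PW PT P01 P11 PM0 PM1 PV0 PV1 Pd Pb.
pose P s : dquot C s -> Prop :=
  match s with Deg0 => P0 | Deg1 => P1 end.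
suff PP s (t : dterm C s) : P s (dclass t).
  by split; apply: dquotW => t; [apply: (PP Deg0) | apply: (PP Deg1)].
elim: t => {s} /=.
- exact: PX.
- exact: PW.
- exact: PT.
- by case.
- case=> x Px y Py; rewrite dclass_mul; [exact: PM0 | exact: PM1].
- case=> x Px; rewrite dclass_inv; [exact: PV0 | exact: PV1].
- by move=> a Pa; rewrite -dbdE; apply: Pd.
- by move=> x Px y Py; rewrite -dbrE; apply: Pb.
Qed.

Lemma D_hom_eq (E : sqm) (f g : sqm_hom D E) :
  (forall X, sf0 f (dX X) = sf0 g (dX X)) ->
  (forall (X X' : wcat C 1%N) (u : hom X X'), sf1 f (dW u) = sf1 g (dW u)) ->
  (forall T, sf1 f (dT T) = sf1 g (dT T)) -> f = g.
Proof.
move=> EX EW ET.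
have [E0 E1] : (forall x, sf0 f x = sf0 g x) /\ (forall a, sf1 f a = sf1 g a).
  apply: D_ind => //.
  - by rewrite !sf0_1.
  - by rewrite !sf1_1.
  - by move=> x y; rewrite !sf0_mul => -> ->.
  - by move=> x y; rewrite !sf1_mul => -> ->.
  - by move=> x; rewrite !(morph_mulV _ (sf0_mul _)) => ->.
  - by move=> x; rewrite !(morph_mulV _ (sf1_mul _)) => ->.
  - by move=> a; rewrite -!sf_bd => ->.
  - by move=> x y; rewrite -!sf_br => -> ->.
exact: sqm_hom_eq.
Qed.

Lemma dX_pt : dX (s0 (pt C)) = 1.
Proof. exact/dclassP/deq_pt. Qed.

Lemma dT_s0 (X : C 1%N) : dT (s0 X) = 1.
Proof. exact/dclassP/deq_s0. Qed.

Lemma dW_cmp (X Y Z : wcat C 1%N) (g : hom Y Z) (f : hom X Y) :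
  dW (g ∘ f) = dW g * dW f.
Proof. by rewrite /dW -dclass_mul; apply/dclassP/deq_cmp. Qed.

Lemma dW_bd (X X' : wcat C 1%N) (f : hom X X') : dX X' * sbd (dW f) = dX X.
Proof.
have /dclassP := deq_bd_W f; rewrite dclass_mul dclass_inv /= dbdE => ->.
by rewrite mulVKg.
Qed.

Lemma dT_bd (T : C 2%N) : dX (d1 T) * sbd (dT T) = dX (d0 T) * dX (d2 T).
Proof.
have /dclassP := deq_bd_T T; rewrite !dclass_mul dclass_inv /= dbdE => ->.
by rewrite mulVKg.
Qed.

Lemma dclass_act (a : dterm C Deg1) (x : dterm C Deg0) :
  dclass (tact a x) = sact (dclass a : sq1 D) (dclass x : sq0 D).
Proof. by rewrite dclass_mul -dbrE -dbdE. Qed.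

Lemma d_nat (T T' : wcat C 2%N) (f : hom T T') :
  dW (wface (ord1 _) f) * dT T =
  dT T' * (sact (dW (wface ord0 f)) (dX (d2 (T' : C 2%N))) *
           dW (wface (ord2 _) f)).
Proof.
have /dclassP := deq_nat f.
rewrite (dclass_mul (tW _)) dclass_act !dclass_mul dclass_inv.
move=> E; have {}E : dW (wface (ord2 _) f) *
    sact (dW (wface ord0 f)) (dX (d2 (T : C 2%N))) =
    (dT T')^-1 * (dW (wface (ord1 _) f) * dT T) := E.
rewrite -[LHS](mulVKg (dT T')) -E.
rewrite -[dX (d2 (T : C 2%N))](dW_bd (wface (ord2 _) f)) sact_mul sact_bd.
by rewrite !mulgA mulgK.
Qed.

Lemma d_ass (T : C 3%N) :
  dT (d1 T) * dT (d3 T) = dT (d2 T) * sact (dT (d0 T)) (dX (d2 (d3 T))).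
Proof.
by have /dclassP := deq_ass T; rewrite 2!dclass_mul dclass_act.
Qed.

Lemma d_com (X Y : C 1%N) (Z : coproduct X Y)
    (S : sum_simplex Z) (S' : sum_simplex (cp_swap Z)) :
  let sum X Y (Z : coproduct X Y) (S : sum_simplex Z) :=
    dW (ss_d1 S) * dT S *
    (sact (dW (ss_d0 S)) (dX (d2 (S : C 2%N))) * dW (ss_d2 S)) in
  sum X Y Z S = sum Y X (cp_swap Z) S' * sbr (dX X) (dX Y).
Proof.
have sumE X' Y' (Z' : coproduct X' Y') (S0 : sum_simplex Z') :
    dclass (tsum S0) = dW (ss_d1 S0) * dT S0 *
      (sact (dW (ss_d0 S0)) (dX (d2 (S0 : C 2%N))) * dW (ss_d2 S0)).
  by rewrite 3!dclass_mul dclass_act mulgA.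
rewrite /= -!sumE; have /dclassP := deq_com S S'.
by rewrite dclass_mul dclass_inv /= dbrE => ->; rewrite mulVKg.
Qed.

(** ** The universal determinant functor *)

Program Definition det_univ1 : functor (wcat C 1%N) (gamma D) :=
  {| fob := fun X : wcat C 1%N => dX X : gamma D;
     fmap := fun X Y f => ghm (E := D) (x := dX X) (y := dX Y) (dW_bd f) |}.
Next Obligation.
by move=> X; apply: ghom_eq; apply: dW_identity; exists erefl.
Qed.
Next Obligation. by move=> X Y Z g f; apply: ghom_eq; apply: dW_cmp. Qed.

Program Definition det_univ : det_functor C (gamma D) :=
  {| det1 := det_univ1;
     det2 := fun T => ghm (E := D) (x := dX (d0 T) * dX (d2 T)) (y := dX (d1 T))
       (dT_bd T) |}.
Next Obligation. by move=> T T' f; apply: ghom_eq; apply: d_nat. Qed.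
Next Obligation.
move=> T; apply: gval_inj; rewrite !gvalE !mulg1 !mul1g !sact1 !mul1g.
by rewrite mulg1 d_ass d2d3.
Qed.
Next Obligation.
move=> X Y Z S S'; apply: gval_inj; exact: (d_com S S').
Qed.

Lemma det_univ_strict : is_strict det_univ.
Proof.
split; first exact: dX_pt.
have e : dX (d0 (s0 (s0 (pt C)))) * dX (d2 (s0 (s0 (pt C)))) =
    dX (d1 (s0 (s0 (pt C)))).
  by rewrite -dT_bd dT_s0 sbd1 mulg1.
by exists e; apply: ghom_eq; rewrite sval_eqm; apply: dT_s0.
Qed.

End Presentation.

(** * Extensions of groups by cocycles *)

(** Data for a central extension of the subgroup [cd_dom] by [cd_ab]. The cocycle need not be
    normalized, so the unit of the extension has second component [- cd_coc 1 1]. *)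
Record cocycle_data := CocycleData {
  cd_grp : groupType;
  cd_ab : zmodType;
  cd_dom : cd_grp -> Prop;
  cd_coc : cd_grp -> cd_grp -> cd_ab;
  cd_dom1 : cd_dom 1;
  cd_domM : forall x y, cd_dom x -> cd_dom y -> cd_dom (x * y);
  cd_domV : forall x, cd_dom x -> cd_dom x^-1;
  cd_cocP : forall x y z, cd_dom x -> cd_dom y -> cd_dom z ->
    cd_coc x y + cd_coc (x * y) z = cd_coc y z + cd_coc x (y * z) }.

Section CocycleExtension.
Variable d : cocycle_data.
Notation G := (cd_grp d).
Notation A := (cd_ab d).
Notation k := (@cd_coc d).

Definition cext : Type := {classic {p : G * A | cd_dom p.1}}.
HB.instance Definition _ := Choice.on cext.

Definition cx_mk (x : G) (a : A) (xS : cd_dom x) : cext :=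
  exist (fun p : G * A => cd_dom p.1) (x, a) xS.
Definition cx1 (u : cext) : G := (sval u).1.
Definition cx2 (u : cext) : A := (sval u).2.

Lemma cx1_mk x a (xS : cd_dom x) : cx1 (cx_mk a xS) = x.
Proof. by []. Qed.

Lemma cx2_mk x a (xS : cd_dom x) : cx2 (cx_mk a xS) = a.
Proof. by []. Qed.

Lemma cx_dom (u : cext) : cd_dom (cx1 u).
Proof. exact: (proj2_sig u). Qed.

Lemma cx_eq (u v : cext) : cx1 u = cx1 v -> cx2 u = cx2 v -> u = v.
Proof.
case: u v => [[x a] xS] [[y b] yS]; rewrite /cx1 /cx2 /= => E E'.
by case: y / E yS => yS; case: b / E' yS => yS; rewrite (Prop_irrelevance xS yS).
Qed.

Let mul (u v : cext) : cext :=
  cx_mk (cx2 u + cx2 v + k (cx1 u) (cx1 v)) (cd_domM (cx_dom u) (cx_dom v)).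
Let one : cext := cx_mk (- k 1 1) (cd_dom1 d).
Let inv (u : cext) : cext :=
  cx_mk (- cx2 u - k (cx1 u)^-1 (cx1 u) - k 1 1) (cd_domV (cx_dom u)).

Let lawE : [/\ forall u v, cx1 (mul u v) = cx1 u * cx1 v,
  forall u v, cx2 (mul u v) = cx2 u + cx2 v + k (cx1 u) (cx1 v),
  cx1 one = 1, cx2 one = - k 1 1 &
  (forall u, cx1 (inv u) = (cx1 u)^-1) /\
  (forall u, cx2 (inv u) = - cx2 u - k (cx1 u)^-1 (cx1 u) - k 1 1)].
Proof. by []. Qed.

Lemma coc1x x : cd_dom x -> k 1 x = k 1 1.
Proof.
move=> xS; have := cd_cocP (cd_dom1 d) (cd_dom1 d) xS.
by rewrite !mul1g => E; zlin (esym E).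
Qed.

Lemma cocx1 x : cd_dom x -> k x 1 = k 1 1.
Proof.
move=> xS; have := cd_cocP xS (cd_dom1 d) (cd_dom1 d).
by rewrite !mulg1 => E; zlin E.
Qed.

Let mulA : associative mul.
Proof.
move=> u v w; apply: cx_eq; first exact: mulgA.
have [m1 m2 _ _ _] := lawE; rewrite !(m1, m2).
by have := cd_cocP (cx_dom u) (cx_dom v) (cx_dom w) => E; zlin (esym E).
Qed.

Let mul1x : left_id one mul.
Proof.
move=> u; apply: cx_eq; first exact: mul1g.
have [_ m2 o1 o2 _] := lawE; rewrite m2 o1 o2 coc1x; last exact: cx_dom.
by zmod.
Qed.

Let mulx1 : right_id one mul.
Proof.
move=> u; apply: cx_eq; first exact: mulg1.
have [_ m2 o1 o2 _] := lawE; rewrite m2 o1 o2 cocx1; last exact: cx_dom.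
by zmod.
Qed.

Let mulVx : left_inverse one inv mul.
Proof.
move=> u; apply: cx_eq; first exact: mulVg.
by have [_ m2 _ o2 [i1 i2]] := lawE; rewrite m2 o2 i1 i2; zmod.
Qed.

Let mulxV : right_inverse one inv mul.
Proof.
move=> u; apply: cx_eq; first exact: mulgV.
have uS := cx_dom u; have := cd_cocP uS (cd_domV uS) uS.
rewrite mulgV mulVg coc1x // cocx1 //.
by have [_ m2 _ o2 [i1 i2]] := lawE; rewrite m2 o2 i1 i2 => E; zlin E.
Qed.

HB.instance Definition _ := isGroup.Build cext mulA mul1x mulx1 mulVx mulxV.

Lemma cx1M (u v : cext) : cx1 (u * v) = cx1 u * cx1 v.
Proof. by []. Qed.

Lemma cx2M (u v : cext) : cx2 (u * v) = cx2 u + cx2 v + k (cx1 u) (cx1 v).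
Proof. by []. Qed.

Lemma cx11 : cx1 (1 : cext) = 1.
Proof. by []. Qed.

Lemma cx21 : cx2 (1 : cext) = - k 1 1.
Proof. by []. Qed.

End CocycleExtension.

(** * Tensor functors on the groupoid of a stable quadratic module *)

Section TensorCocycle.
Variables (E : sqm) (P : picard) (V : phase P) (f : tensor_functor (gamma E) P).
Notation "'ν' f" := (ph V f) (at level 10, f at level 9).
Notation m := (ph_cor V).

Definition tf_coc (x y : sq0 E) : ph_ab V :=
  ν (tmult f x y) + m (f x) (f y).

Lemma tf_gid (x y : sq0 E) (e : x = y) : ν (fmap f (gid e : @hom (gamma E) x y)) = 0.
Proof.
have [e' ->] := gid_identity (C := E) e.
by rewrite (fmap_eqm (tff f) (e' : (x : gamma E) = y)) ph_eqm.
Qed.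

(** Compares phases of morphisms whose endpoints are equal but not convertible. *)
Lemma tf_gval (x y x' y' : gamma E) (u : hom x y) (v : hom x' y') :
  x = x' -> y = y' -> gval u = gval v -> ν (fmap f u) = ν (fmap f v).
Proof.
move=> ex ey; case: x' / ex v => v; case: y' / ey v => v uv.
by rewrite (gval_inj uv).
Qed.

(** Thus [tf_coc] trivializes the pullback of [ph_ass] along [f]. *)
Lemma tf_ass (x y z : sq0 E) :
  tf_coc x (y * z) + tf_coc y z =
  tf_coc (x * y) z + tf_coc x y + ph_ass V (f x) (f y) (f z).
Proof.
have := congr1 (@ph _ V _ _) (tmult_ass f x y z).
rewrite !phM !ph_tns !ph1 tf_gid /tf_coc /ph_ass => H.
by zlin H.
Qed.

Lemma tf_lun (x : sq0 E) : tf_coc 1 x + ν (tunit f) = ph_lun V (f x).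
Proof.
have := congr1 (@ph _ V _ _) (tmult_lun f x).
rewrite !phM !ph_tns !ph1 tf_gid /tf_coc /ph_lun => H.
by zlin H.
Qed.

Lemma tf_com (x y : gamma E) :
  ν (fmap f (com x y)) + tf_coc x y = tf_coc y x + ph_com V (f x) (f y).
Proof.
have := congr1 (@ph _ V _ _) (tmult_com f x y).
by rewrite !phM /tf_coc /ph_com => H; zlin H.
Qed.

Lemma tf_tns (x x' y y' : gamma E) (u : hom x x') (v : hom y y') :
  ν (fmap f (u ⊠ v)) =
  tf_coc x' y' - tf_coc x y + ν (fmap f u) + ν (fmap f v).
Proof.
have := congr1 (@ph _ V _ _) (tmult_nat f u v).
by rewrite !phM !ph_tns /tf_coc => H; zlin (esym H).
Qed.

Lemma tf_linked (x y : gamma E) : linked x y -> linked (f x) (f y).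
Proof. by move=> [u]; exact: (inhabits (fmap f u)). Qed.

Lemma tf_linked_mul (x y : sq0 E) : linked (f x ⊗ f y) (f (x * y)).
Proof. exact: inhabits (tmult f x y). Qed.

Lemma tf_linked_1 : linked unt (f 1).
Proof. exact: inhabits (tunit f). Qed.

End TensorCocycle.

(** * The universal determinant functor induces fully faithful functors *)

Section FullFaith.
Variables (C : S_category) (P : picard).
Notation D := (Dsqm C).
Variables f g : tensor_functor (gamma D) P.

Let V : phase P := picard_phase P.
Notation "'ν' f" := (ph V f) (at level 10, f at level 9).
Notation m := (ph_cor V).
Let k (x y : sq0 D) : ph_ab V := tf_coc V g x y - tf_coc V f x y.

Let dom (x : sq0 D) : Prop := linked (f x) (g x).

Let dom1 : dom 1.
Proof. exact: linked_trans (linked_sym (tf_linked_1 f)) (tf_linked_1 g). Qed.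

Let domM x y : dom x -> dom y -> dom (x * y).
Proof.
move=> fx fy; apply: linked_trans (linked_sym (tf_linked_mul f x y)) _.
exact: linked_trans (linked_tns fx fy) (tf_linked_mul g x y).
Qed.

Let domV x : dom x -> dom x^-1.
Proof.
move=> fx; apply: (linked_cancel (x := f x)).
apply: linked_trans (tf_linked_mul f x x^-1) _; rewrite mulgV.
apply: linked_trans dom1 _; rewrite -(mulgV x).
apply: linked_trans (linked_sym (tf_linked_mul g x x^-1)) _.
exact: linked_tns (linked_sym fx) (linked_refl _).
Qed.

(** On [dom] the functors [f] and [g] pull [ph_ass] back to the same 3-cocycle; the difference of
    two trivializations of it is a 2-cocycle. *)
Let kP x y z : dom x -> dom y -> dom z ->
  k x y + k (x * y) z = k y z + k x (y * z).
Proof.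
move=> fx fy fz; have E := tf_ass V f x y z; have E' := tf_ass V g x y z.
rewrite -(ph_ass_linked V fx fy fz) in E'.
by rewrite /k; zlin (congr2 +%R E (esym E')).
Qed.

(* Objects of [D] together with a morphism from their image under [f] to their image under
   [g], recorded by its phase: a tensor natural transformation is a section. *)
Definition nat_data : cocycle_data := CocycleData dom1 domM domV kP.
Let N : groupType := cext nat_data.

Let del (x y : gamma D) (u : hom x y) : ph_ab V := ν (fmap g u) - ν (fmap f u).

Let del_tns (x x' y y' : gamma D) (u : hom x x') (v : hom y y') :
  del (u ⊠ v) = del u + del v + k x' y' - k x y.
Proof. by rewrite /del !tf_tns /k; zmod. Qed.

Let del_gval (x y x' y' : gamma D) (u : hom x y) (v : hom x' y') :
  x = x' -> y = y' -> gval u = gval v -> del u = del v.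
Proof.
by move=> ex ey uv; rewrite /del (tf_gval V g ex ey uv) (tf_gval V f ex ey uv).
Qed.

Let to1 (a : sq1 D) : @hom (gamma D) (sbd a) 1 := ghm (mul1g (sbd a)).

Let bd_dom (a : sq1 D) : dom (sbd a).
Proof.
have a1 : @linked (gamma D) (sbd a) 1 := inhabits (to1 a).
apply: linked_trans (tf_linked f a1) _.
exact: linked_trans dom1 (linked_sym (tf_linked g a1)).
Qed.

(** The second component is forced by naturality along [to1 a], starting from the component
    [- k 1 1] of the unit of [N]. *)
Let nbd (a : sq1 D) : N :=
  @cx_mk nat_data (sbd a) (- k 1 1 - del (to1 a)) (bd_dom a).

(** The equation of phases says that the morphisms recorded by [n] and [n'] form a naturality square
    at [u]; naturality thereby becomes a boundary relation in [N]. *)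
Let nbdP (n n' : N) (x y : gamma D) (u : hom x y) :
  cx1 n = x -> cx1 n' = y -> (n' * nbd (gval u) = n <-> cx2 n' = cx2 n + del u).
Proof.
move=> nx ny.
have E : cx2 (n' * nbd (gval u)) = cx2 n' - del u.
  rewrite cx2M ny /nbd cx1_mk cx2_mk /=.
  have := del_tns (idm y) (to1 (gval u)).
  rewrite (del_gval (u := idm y ⊠ to1 (gval u)) (v := u)); last first.
  - by rewrite gval_tns gval_idm gval_ghm sact1 mul1g.
  - exact: mulg1.
  - exact: gvalP.
  have k1 : k y 1 = k 1 1.
    by rewrite -ny; apply: (cocx1 (d := nat_data)); apply: cx_dom.
  rewrite {2}/del !fmap1 !ph1 => H.
  by zlin (congr2 +%R k1 H).
split=> [<-|H]; first by rewrite E subrK.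
apply: cx_eq; last by rewrite E H addrK.
by rewrite cx1M ny nx; apply: gvalP.
Qed.

Let nsqm_bd_mul a b : nbd (a * b) = nbd a * nbd b.
Proof.
apply: cx_eq; first exact: sbd_mul.
rewrite cx2M /nbd !cx1_mk !cx2_mk /=.
have := del_tns (to1 a) (to1 b).
rewrite (del_gval (v := to1 (a * b))); first by move=> ->; zmod.
- exact: (esym (sbd_mul (s := D) _ _)).
- exact: mulg1.
- by rewrite gval_tns sact_one.
Qed.

Let nbr (n n' : N) : sq1 D := sbr (cx1 n : sq0 D) (cx1 n').

Let nbd_br n n' : nbd (nbr n n') = [~ n', n].
Proof.
apply: (mulgI (n * n')); rewrite -commg_mulgC.
pose u : @hom (gamma D) (cx1 n' * cx1 n : sq0 D) (cx1 n * cx1 n' : sq0 D) :=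
  com (cx1 n' : gamma D) (cx1 n).
apply/(nbdP u) => //; rewrite !cx2M /= /del.
have E := tf_com V f (cx1 n') (cx1 n); have := tf_com V g (cx1 n') (cx1 n).
rewrite -(ph_com_linked V (cx_dom n') (cx_dom n)) => E'.
by rewrite /u /k; zlin (congr2 +%R E (esym E')).
Qed.

Let nsqm : sqm.
Proof.
refine (@Sqm N (sq1 D) nbr nbd nsqm_bd_mul _ _ _ nbd_br _).
- by move=> x y z; apply: sbr_mull.
- by move=> x y z; apply: sbr_mulr.
- by move=> x y; apply: sbr_anti.
- by move=> a b; apply: (sbr_bd (s := D)).
Defined.

Let nproj : sqm_hom nsqm D.
Proof.
by refine (@SqmHom nsqm D (@cx1 nat_data) id _ _ _ _).
Defined.

Section Extension.
Variable a : @hom (Det C P) (comp_det f (det_univ C)) (comp_det g (det_univ C)).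

Let nX (X : C 1%N) : N := @cx_mk nat_data (dX X) (ν (a X)) (inhabits (a X)).

Let nW_bd (X X' : wcat C 1%N) (u : hom X X') : nX X' * nbd (dW u) = nX X.
Proof.
apply/(nbdP (fmap (det_univ C) u)) => //.
have := congr1 (@ph _ V _ _) (dmt_nat a u).
by rewrite !phM /del => H; rewrite !cx2_mk; zlin H.
Qed.

Let nT_bd (T : C 2%N) : nX (d1 T) * nbd (dT T) = nX (d0 T) * nX (d2 T).
Proof.
apply/(nbdP (det2 (det_univ C) T)) => //.
have := congr1 (@ph _ V _ _) (dmt_add a T).
rewrite /= /comp_det2 !phM !ph_tns => H.
by rewrite cx2M !cx2_mk /del /= /k /tf_coc; zlin H.
Qed.

(** The boundary relation at [s0 (s0 (pt C))] equates this element with its square. *)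
Let nX_pt : nX (s0 (pt C)) = 1.
Proof.
have := nT_bd (s0 (s0 (pt C))); rewrite dT_s0 d0s0 d1s0 d2s0 (ptP (d1 _)).
have -> : nbd 1 = 1 by apply: (sbd1 nsqm).
by rewrite mulg1 -{1}[nX _]mulg1 => /mulgI/esym.
Qed.

Let nmodel : model C nsqm :=
  @Model C nsqm nX (@dW C) (@dT C) nW_bd nT_bd nX_pt (dT_s0 _) (@dW_cmp C)
    (@d_nat C) (@d_ass C) (@d_com C).

Let phi := model_hom nmodel.

(** Checked on generators. So [phi] is a section of [nproj], and its second components are the
    phases of the desired transformation. *)
Let phiK : comp_sqm nproj phi = id_sqm D.
Proof.
apply: D_hom_eq => [X|X X' u|T].
- exact: (congr1 (@cx1 nat_data) (model_homX nmodel X)).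
- exact: (model_homW nmodel u).
- exact: (model_homT nmodel T).
Qed.

Let phi0K x : cx1 (sf0 phi x) = x.
Proof. by have := congr1 (fun h => sf0 h x) phiK. Qed.

Let phi1K b : sf1 phi b = b.
Proof. by have := congr1 (fun h => sf1 h b) phiK. Qed.

Let ext_ex x : exists t : hom (f x) (g x), ν t = cx2 (sf0 phi x).
Proof.
apply: ph_surj; have := cx_dom (sf0 phi x); rewrite /dom /=.
by rewrite phi0K.
Qed.

Let ext x : hom (f x) (g x) := sval (cid (ext_ex x)).

Let extE x : ν (ext x) = cx2 (sf0 phi x).
Proof. exact: (proj2_sig (cid (ext_ex x))). Qed.

Program Definition tensor_extension : tensor_nat f g := {| tnt := ext |}.
Next Obligation.
move=> x y u; apply: (@ph_inj _ V); rewrite !phM !extE.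
have : sf0 phi y * nbd (gval u) = sf0 phi x.
  have B : nbd (sf1 phi (gval u)) = sf0 phi (sbd (gval u)) := sf_bd phi _.
  rewrite phi1K in B; rewrite B -[RHS](congr1 (sf0 phi) (gvalP u)).
  exact: esym (sf0_mul phi _ _).
move=> /(nbdP u)-> //; rewrite /del; first by zmod.
Qed.
Next Obligation.
move=> x y; apply: (@ph_inj _ V); rewrite !phM ph_tns !extE.
rewrite (sf0_mul phi x y : sf0 phi (x ⊗ y) = _).
have := cx2M (sf0 phi x) (sf0 phi y); rewrite /= !phi0K => ->.
by rewrite /k /tf_coc; zmod.
Qed.
Next Obligation.
apply: (@ph_inj _ V); rewrite phM extE sf0_1 cx21 /= /k.
have E := tf_lun V f 1; have := tf_lun V g 1.
rewrite -(ph_lun_linked V dom1) => E'.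
by zlin (congr2 +%R E (esym E')).
Qed.

Lemma tensor_extensionE X : tensor_extension (dX X) = a X.
Proof.
apply: (@ph_inj _ V); rewrite extE model_homX.
by [].
Qed.

End Extension.

Lemma tensor_nat_det_eq (t t' : tensor_nat f g) :
  (forall X : C 1%N, t (dX X) = t' (dX X)) -> t = t'.
Proof.
move=> tX; apply: tensor_nat_eq => x; apply: (@ph_inj _ V); move: x.
have t1 : ν (t 1) = ν (t' 1).
  have := congr1 (@ph _ V _ _) (tnt_unit t').
  by rewrite -(tnt_unit t) !phM => /addIr.
have tM (s : tensor_nat f g) (x y : sq0 D) :
    ν (s (x * y)) = ν (s x) + ν (s y) + k x y.
  have := congr1 (@ph _ V _ _) (tnt_mult s x y).
  by rewrite !phM ph_tns /k /tf_coc => H; zlin H.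
have tV (s : tensor_nat f g) (x : sq0 D) :
    ν (s x^-1) = ν (s 1) - ν (s x) - k x x^-1.
  by have := tM s x x^-1; rewrite mulgV => ->; zmod.
(* A trivial predicate in degree 1 suffices, since the value at a boundary [sbd b] is determined by
   naturality along [to1 b]. *)
suff [] : (forall x : sq0 D, ν (t x) = ν (t' x)) /\ (forall b : sq1 D, True) by [].
apply: D_ind => // [X|x y Ex Ey|x Ex|b _].
- by rewrite tX.
- by rewrite !tM Ex Ey.
- by rewrite !tV Ex t1.
- have := congr1 (@ph _ V _ _) (tnt_nat t (to1 b)).
  have := congr1 (@ph _ V _ _) (tnt_nat t' (to1 b)).
  by rewrite !phM t1 => -> /addrI.
Qed.

End FullFaith.

Lemma precomp_det_ff (C : S_category) (P : picard) :
  fully_faithful (precomp_det (det_univ C) P).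
Proof.
move=> f g a; exists (tensor_extension a); split.
  by apply: det_mor_eq => X; apply: tensor_extensionE.
move=> t ta; apply: tensor_nat_det_eq => X.
by rewrite tensor_extensionE -ta.
Qed.

(** * Strict determinant functors *)

Lemma comp_ff (C D E : category) (G : functor D E) (F : functor C D) :
  fully_faithful G -> fully_faithful F -> fully_faithful (compF G F).
Proof.
move=> Gff Fff x y u; have [v [vu vU]] := Gff _ _ u.
have [w [wv wU]] := Fff _ _ v.
exists w; split; first by rewrite /= wv.
by move=> w' w'u; apply/wU/esym/vU.
Qed.

(** A tensor natural transformation is the same as a homotopy: compatibility with products is
    [hty_mul], and naturality along the morphism from [sbd a] to 1 gives [hty_sbd]. *)
Lemma gamma_fun_ff (E E' : sqm) : fully_faithful (gamma_fun E E').
Proof.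
move=> f g t; have val x := gvalP (t x : @hom (gamma E') _ _).
have tM (x y : sq0 E) : gval (t (x * y)) = sact (gval (t x)) (sf0 g y) * gval (t y).
  have := congr1 (@gval _ _ _) (tnt_mult t x y).
  by rewrite !gvalE mulg1 mul1g.
have t1 : gval (t 1) = 1.
  have := congr1 (@gval _ _ _) (tnt_unit t).
  by rewrite gval_cmp mulg1.
have tbd' (x : sq0 E) : sbd (gval (t x)) = (sf0 g x)^-1 * sf0 f x.
  by apply: (mulgI (sf0 g x)); rewrite mulVKg; apply: val.
have tsbd (a : sq1 E) : gval (t (sbd a)) = (sf1 g a)^-1 * sf1 f a.
  have := congr1 (@gval _ _ _) (tnt_nat t (ghm (mul1g (sbd a)))).
  rewrite gval_cmp t1 mul1g => E1; apply: (mulgI (sf1 g a)).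
  by rewrite mulVKg; apply: (esym E1).
exists (Homotopy tM tbd' tsbd); split.
  by apply: tensor_nat_eq => x; apply: gval_inj.
by move=> a at_; apply: homotopy_eq => x /=; rewrite -at_.
Qed.

Lemma det_functor_gamma_eq (C : S_category) (E : sqm)
  (d d' : det_functor C (gamma E)) :
  (forall X : C 1%N, d X = d' X) ->
  (forall (X X' : wcat C 1%N) (u : hom X X'), gval (fmap d u) = gval (fmap d' u)) ->
  (forall T, gval (det2 d T) = gval (det2 d' T)) -> d = d'.
Proof.
case: d d' => [F F2 FN FA FC] [G G2 GN GA GC] /= EX EW ET.
have FG : F = G.
  apply: (@functor_eq _ _ F G EX) => X X' u; apply: gval_inj.
  by rewrite !gval_cmp !gval_eqm mul1g mulg1.
case: G / FG G2 GN GA GC {EX EW} ET => G2 GN GA GC ET.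
have FG : F2 = G2.
  apply: functional_extensionality_dep => T; apply: gval_inj; exact: ET.
case: G2 / FG GN GA GC {ET} => GN GA GC.
by rewrite (Prop_irrelevance FN GN) (Prop_irrelevance FA GA) (Prop_irrelevance FC GC).
Qed.

(** * Models from strict determinant functors *)

Section StrictModel.
Variables (C : S_category) (E : sqm) (d : det_functor C (gamma E)).
Hypothesis dS : is_strict d.

Let nT_ss : gval (det2 d (s0 (s0 (pt C)))) = 1.
Proof. by have [_ [e ->]] := dS; rewrite gval_eqm. Qed.

Let nW_cmp (X Y Z : wcat C 1%N) (g : hom Y Z) (f : hom X Y) :
  gval (fmap d (g ∘ f)) = gval (fmap d g) * gval (fmap d f).
Proof. by rewrite fmapM. Qed.

Let nT_nat (T T' : wcat C 2%N) (f : hom T T') :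
  gval (fmap d (wface (ord1 _) f)) * gval (det2 d T) =
  gval (det2 d T') * (sact (gval (fmap d (wface ord0 f))) (d (d2 (T' : C 2%N))) *
                      gval (fmap d (wface (ord2 _) f))).
Proof. exact: (congr1 (@gval _ _ _) (det2_nat d f)). Qed.

Let nT_ass (T : C 3%N) :
  gval (det2 d (d1 T)) * gval (det2 d (d3 T)) =
  gval (det2 d (d2 T)) * sact (gval (det2 d (d0 T))) (d (d2 (d3 T))).
Proof.
have := congr1 (@gval _ _ _) (det_ass d T).
rewrite !gvalE !mulg1 !mul1g !sact1 !mul1g mulg1 => ->.
by congr (_ * sact _ _); rewrite d2d3.
Qed.

Let nT_com (X Y : C 1%N) (Z : coproduct X Y)
    (S : sum_simplex Z) (S' : sum_simplex (cp_swap Z)) :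
  let sum X Y (Z : coproduct X Y) (S : sum_simplex Z) :=
    gval (fmap d (ss_d1 S)) * gval (det2 d S) *
    (sact (gval (fmap d (ss_d0 S))) (d (d2 (S : C 2%N))) *
     gval (fmap d (ss_d2 S))) in
  sum X Y Z S = sum Y X (cp_swap Z) S' * sbr (d X : sq0 E) (d Y).
Proof. exact: (congr1 (@gval _ _ _) (det_com d S S')). Qed.

Definition strict_model : model C E :=
  @Model C E (fun X => d X) (fun X X' u => gval (fmap d u))
    (fun T => gval (det2 d T)) (fun X X' u => gvalP (fmap d u))
    (fun T => gvalP (det2 d T)) (proj1 dS) nT_ss nW_cmp nT_nat nT_ass nT_com.

End StrictModel.

Lemma gamma_det_isomorphism (C : S_category) (E : sqm) :
  is_isomorphism (gamma_det E (@det_univ_strict C)).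
Proof.
apply: ff_isomorphism.
- move=> f g.
  exact: (comp_ff (precomp_det_ff (P := gamma E)) (gamma_fun_ff (E' := E)) (x := f) (y := g)).
- move=> f g /(congr1 sval) /= fg; apply: D_hom_eq => [X|X X' u|T].
  + exact: (congr1 (fun d : det_functor C (gamma E) => d X) fg).
  + exact: (congr1 (fun d : det_functor C (gamma E) => (gpair (fmap d u)).2) fg).
  + have := congr1 (fun d : det_functor C (gamma E) => (gpair (det2 d T)).2) fg.
    by rewrite /= !mulg1.
- move=> [d dS]; exists (model_hom (strict_model dS)).
  apply: eq_exist; apply: det_functor_gamma_eq => [X|X X' u|T].
  + exact: (model_homX (strict_model dS)).
  + exact: (model_homW (strict_model dS)).
  + rewrite -[RHS](model_homT (strict_model dS)).
    exact: mulg1.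
Qed.

(** * Essential surjectivity *)

Section CompTensor.
Variables (P Q R : picard) (g : tensor_functor Q R) (f : tensor_functor P Q).

Program Definition comp_tensor : tensor_functor P R :=
  {| tff := compF g f;
     tmult := fun x y => fmap g (tmult f x y) ∘ tmult g (f x) (f y);
     tunit := fmap g (tunit f) ∘ tunit g |}.
Next Obligation.
move=> x x' y y' u v /=; rewrite -cmpA tmult_nat cmpA -fmapM tmult_nat.
by rewrite fmapM cmpA.
Qed.
Next Obligation.
move=> x y z /=.
have H := tensor_functor_ass g (a := fmap f (ass x y z) ∘ tmult f x (y ⊗ z))
  (b := tmult f y z) (g := tmult f (x ⊗ y) z) (h := tmult f x y)
  (k := idm (f z)) (tmult_ass f x y z).
rewrite fmapM fmap1 in H; rewrite cmpA H.
by rewrite -!cmpA.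
Qed.
Next Obligation.
move=> x /=; rewrite -[idm (g (f x))]cmpm1 tnsmM -(tmult_lun g (f x)).
rewrite -(tmult_lun f x) !fmapM !cmpA; congr (_ ∘ _).
by rewrite -(fmap1 g (f x)) -!cmpA tmult_nat.
Qed.
Next Obligation.
move=> x /=; rewrite -[idm (g (f x))]cmpm1 tnsmM -(tmult_run g (f x)).
rewrite -(tmult_run f x) !fmapM !cmpA; congr (_ ∘ _).
by rewrite -(fmap1 g (f x)) -!cmpA tmult_nat.
Qed.
Next Obligation.
move=> x y /=; rewrite cmpA -fmapM tmult_com fmapM -!cmpA; congr (_ ∘ _).
exact: tmult_com.
Qed.

End CompTensor.

Program Definition pi0_pres (P : picard) : group_pres :=
  {| gp_car := P;
     gp_rel := @linked P;
     gp_one := unt;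
     gp_inv := fun x => sval (cid (linked_inverse x));
     gp_mul := fun x y => x ⊗ y |}.
Next Obligation. by move=> P x; apply: linked_refl. Qed.
Next Obligation. by move=> P x y; apply: linked_sym. Qed.
Next Obligation. by move=> P x y z; apply: linked_trans. Qed.
Next Obligation. by move=> P x x' y y'; apply: linked_tns. Qed.
Next Obligation. by move=> P x y z; apply: inhabits (ass x y z). Qed.
Next Obligation. by move=> P x; apply: inhabits (lun x). Qed.
Next Obligation. by move=> P x; apply: (proj2_sig (cid (linked_inverse x))). Qed.

(* [U] is the phase of the constraints [r k ⊗ r l -> r (k * l)], up to correction terms; they
   make [r] a tensor functor, which in general is not symmetric. *)
Lemma free_ab_tensor (P : picard) (V : phase P) (B : Type) (x : B -> P) :
  exists (r : free_ab B -> P) (U : free_ab B -> free_ab B -> ph_ab V),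
    [/\ linked (r 1) unt,
        forall k l, linked (r (k * l)) (r k ⊗ r l),
        forall b, linked (r (fa_gen b)) (x b) &
        forall k l s, U k (l * s) + U l s =
          U (k * l) s + U k l + ph_ass V (r k) (r l) (r s)].
Proof.
pose c b : gquot (pi0_pres P) := gcls (x b : pi0_pres P).
have cC : commuting c.
  move=> b b'; rewrite /commute /c -!gcls_mul; apply/gclsP.
  exact: inhabits (com _ _).
(* A representative of the image of [l] under the homomorphism to isomorphism classes that extends
   [x]. *)
pose r l : P := grep (fa_lift c l).
have r1 : linked (r 1) unt.
  apply/(gclsP (r 1 : pi0_pres P)); rewrite grepK.
  exact: morph_mul1 (fa_lift_mul cC).
have rM k l : linked (r (k * l)) (r k ⊗ r l).
  apply/(gclsP (r (k * l) : pi0_pres P)); rewrite grepK (fa_lift_mul cC).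
  by rewrite (gcls_mul (r k : pi0_pres P)) !grepK.
have rg b : linked (r (fa_gen b)) (x b).
  by apply/(gclsP (r (fa_gen b) : pi0_pres P)); rewrite grepK fa_lift_gen.
have rr k := linked_refl (r k).
(* The order of the arguments of [ph_com] and the sign turn [ph_hexagon] into the hypothesis
   [hexa]. *)
have [||U UP] := @cocycle_trivial B (ph_ab V)
    (fun k l s => ph_ass V (r k) (r l) (r s)) (fun k l => - ph_com V (r l) (r k)).
- move=> w y z t /=; rewrite (ph_ass_linked V (rM w y) (rr _) (rr _)).
  rewrite (ph_ass_linked V (rr _) (rr _) (rM z t)).
  rewrite (ph_ass_linked V (rr _) (rM y z) (rr _)).
  exact: ph_pentagon.
- move=> k y z /=; rewrite (ph_com_linked V (rM y z) (rr k)).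
  by have H := ph_hexagon V (r y) (r z) (r k); zlin H.
by exists r, U; split.
Qed.

(** * A stable quadratic module over the free abelian group *)

Section EssSurj.
Variables (P : picard) (V : phase P) (B : Type).
Notation L := (free_ab B).
Notation A := (ph_ab V).
Notation "'ν' f" := (ph V f) (at level 10, f at level 9).
Notation m := (ph_cor V).
Variables (r : L -> P) (U : L -> L -> A).
Hypothesis r1 : linked (r 1) unt.
Hypothesis rM : forall k l, linked (r (k * l)) (r k ⊗ r l).
Hypothesis UP : forall k l s,
  U k (l * s) + U l s = U (k * l) s + U k l + ph_ass V (r k) (r l) (r s).

Let h k l s : A := ph_ass V (r k) (r l) (r s).
(** The kernel of the homomorphism that [r] induces to isomorphism classes; it consists of the
    boundaries of the module under construction. *)
Let dom (t : L) : Prop := linked (r t) unt.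
Let lam k : A := ph_lun V (r k).
Let rho k : A := ph_run V (r k).
Let kap : A := ph_run V unt.

Let rr k : linked (r k) (r k) := linked_refl (r k).

Let r_cancel k l : linked (r (k * l)) (r k) <-> dom l.
Proof.
split=> [kl|l1].
  apply: (linked_cancel (x := r k)).
  apply: linked_trans (linked_sym (rM k l)) _; apply: linked_trans kl _.
  exact: linked_sym (inhabits (run _)).
apply: linked_trans (rM k l) _; apply: linked_trans (linked_tns (rr k) l1) _.
exact: inhabits (run _).
Qed.

Let dom1 : dom 1. Proof. exact: r1. Qed.

Let domM k l : dom k -> dom l -> dom (k * l).
Proof. by move=> k1 l1; apply: linked_trans k1; apply/r_cancel. Qed.

Let domV k : dom k -> dom k^-1.
Proof.
move=> k1; apply/(r_cancel k); rewrite mulgV.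
exact: linked_trans dom1 (linked_sym k1).
Qed.

(** Here and in the next lemmas, arguments in [dom] are replaced by the unit, where the triangle and
    pentagon identities determine the associator. *)
Let hx11 k s t : dom s -> dom t -> h k s t = kap - rho k.
Proof.
move=> s1 t1; rewrite /h (ph_ass_linked V (rr k) s1 t1) ph_triangle.
by rewrite ph_lun_run.
Qed.

Let h1x1 k s t : dom s -> dom t -> h s k t = 0.
Proof.
move=> s1 t1; have u0 := linked_refl (unt : P).
rewrite /h (ph_ass_linked V s1 (rr k) t1).
have := ph_pentagon V unt (r k) unt unt.
rewrite (ph_ass_linked V (inhabits (lun (r k))) u0 u0).
rewrite (ph_ass_linked V u0 (rr k) (inhabits (run unt))).
rewrite (ph_ass_linked V u0 (inhabits (run (r k))) u0) => H.
by zlin (esym H).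
Qed.

Let hxy1 k l t : dom t -> h k l t = rho l - rho (k * l).
Proof.
move=> t1; have u0 := linked_refl (unt : P).
rewrite /h (ph_ass_linked V (rr k) (rr l) t1).
have := ph_pentagon V (r k) (r l) unt unt.
rewrite (ph_ass_linked V (rr k) (rr l) (inhabits (run unt))).
rewrite (ph_ass_linked V (rr k) (inhabits (run (r l))) u0).
rewrite -(ph_ass_linked V (rM k l) u0 u0) !ph_triangle -/(rho l) -/(rho (k * l)) => H.
by zlin (esym H).
Qed.

Let hx1y k s y : dom s -> h k s y = lam y - rho k.
Proof. by move=> s1; rewrite /h (ph_ass_linked V (rr k) s1 (rr y)) ph_triangle. Qed.

Let com1x y s : dom s -> ph_com V (r s) (r y) = lam y - rho y.
Proof.
move=> s1; have u0 := linked_refl (unt : P).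
rewrite (ph_com_linked V s1 (rr y)).
have := ph_hexagon V unt unt (r y).
rewrite (ph_com_linked V (inhabits (run unt)) (rr y)) !ph_triangle.
rewrite -(ph_ass_linked V r1 (rr y) r1) -/(h 1 y 1) h1x1 // ph_lun_run.
by rewrite -/(lam y) -/(rho y) => H; zlin (esym H).
Qed.

Let Ux1 k : U k 1 = U 1 1 - kap + rho k.
Proof.
have := UP k 1 1; rewrite !mulg1 -/(h k 1 1) hx11 // => H.
by zlin (esym H).
Qed.

Let U1x k : U 1 k = U 1 1 + lam k - kap.
Proof.
have := UP 1 1 k; rewrite !mul1g -/(h 1 1 k) hx1y // => H.
have rho1 : rho 1 = kap.
  have H' := hx11 1 dom1 dom1; rewrite h1x1 // in H'.
  by zlin H'.
by rewrite rho1 in H; zlin H.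
Qed.

Let rho_dom k s : dom s -> rho (k * s) = rho k.
Proof.
move=> s1; have H := hxy1 k s dom1; rewrite hx11 // in H.
have rhos : rho s = kap.
  have H' := hx11 s dom1 dom1; have H1 := h1x1 1 s1 dom1; rewrite H1 in H'.
  by zlin H'.
by rewrite rhos in H; zlin H.
Qed.

Let Udom1 s : dom s -> U s 1 = U 1 1.
Proof. by move=> /(rho_dom 1); rewrite mul1g => rs; rewrite Ux1 rs -Ux1. Qed.

(** The associator vanishes on [dom] by [h1x1], so that [U] is a 2-cocycle there; the shift by
    [U 1 1] normalizes it. *)
Let cocP x y z : dom x -> dom y -> dom z ->
  (U 1 1 - U x y) + (U 1 1 - U (x * y) z) = (U 1 1 - U y z) + (U 1 1 - U x (y * z)).
Proof.
move=> x1 y1 z1; have := UP x y z; rewrite -/(h x y z) h1x1 // => H.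
by zlin H.
Qed.

Definition free_data : cocycle_data := CocycleData dom1 domM domV cocP.
Notation E1 := (cext free_data).

Let b x y : A := U x y - U y x + ph_com V (r y) (r x).

(** Here [b] measures how far the constraints given by [U] are from respecting the symmetry of [P].
    Taking it as bracket, hence as symmetry of the new groupoid, repairs this. *)
Let fbr (x y : L) : E1 := @cx_mk free_data 1 (b x y) dom1.

Let bC x y : b x y = - b y x.
Proof.
by have H := ph_comC V (r x) (r y); rewrite /b; zlin H.
Qed.

(** The three instances of [UP] produce exactly the three associators of the hexagon for [x], [y],
    [z]. *)
Let b_mull x y z : b (x * y) z = b x z + b y z.
Proof.
have H1 := UP x y z; have H2 := UP z x y; have H3 := UP x z y.
rewrite (free_abC z x) in H2; rewrite (free_abC z y) in H3.
have H4 := ph_hexagon V (r x) (r y) (r z).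
have H5 := ph_comC V (r z) (r (x * y)); have H6 := ph_comC V (r z) (r x).
have H7 := ph_comC V (r z) (r y); rewrite -(ph_com_linked V (rM x y) (rr z)) in H4.
rewrite /b; zlin (congr2 +%R (congr2 +%R (congr2 +%R (esym H1) (esym H2))
  (congr2 +%R H3 (esym H4))) (congr2 +%R H5 (congr2 +%R (esym H6) (esym H7)))).
Qed.

Let b_mulr x y z : b x (y * z) = b x y + b x z.
Proof. by rewrite bC b_mull (bC y) (bC z); zmod. Qed.

Let coc11 : U 1 1 - U 1 1 = 0 :> A. Proof. exact: subrr. Qed.

Let fbr_add (x y : A) : @cx_mk free_data 1 x dom1 * @cx_mk free_data 1 y dom1 =
  @cx_mk free_data 1 (x + y) dom1.
Proof.
apply: cx_eq; first exact: mulg1.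
by rewrite cx2M !cx2_mk !cx1_mk /= coc11 addr0.
Qed.

Let fsqm_mull x y z : fbr (x * y) z = fbr x z * fbr y z.
Proof. by rewrite fbr_add -b_mull. Qed.

Let fsqm_mulr x y z : fbr x (y * z) = fbr x y * fbr x z.
Proof. by rewrite fbr_add -b_mulr. Qed.

Let fsqm_anti x y : fbr x y * fbr y x = 1.
Proof.
rewrite fbr_add bC addNr; apply: cx_eq; first by [].
by rewrite cx2_mk cx21 /= coc11 oppr0.
Qed.

Let fsqm_bd_br x y : cx1 (fbr x y) = [~ y, x].
Proof. by rewrite /fbr cx1_mk; apply: (mulgI (x * y)); rewrite -commg_mulgC mulg1 free_abC. Qed.

(** On [dom] the symmetry has phase 0 by [ph_com_unt], and the antisymmetrization of [U] gives the
    commutators of the extension. *)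
Let fsqm_br_bd (u v : E1) : fbr (cx1 u) (cx1 v) = [~ v, u].
Proof.
apply: (mulgI (u * v)); rewrite -commg_mulgC; apply: cx_eq.
  by rewrite !cx1M /fbr cx1_mk mulg1; apply: free_abC.
have u1 : dom (cx1 u) := cx_dom u; have v1 : dom (cx1 v) := cx_dom v.
rewrite !cx2M /fbr cx2_mk cx1_mk !cx1M /= /b ph_com_unt //.
by rewrite (Udom1 (domM u1 v1)); zmod.
Qed.

Definition free_sqm : sqm :=
  @Sqm L E1 fbr (@cx1 free_data) (@cx1M free_data) fsqm_mull fsqm_mulr fsqm_anti
    fsqm_bd_br fsqm_br_bd.

(* The phase of the morphism with target [l] and degree 1 component [a]. *)
Definition fval (l : sq0 free_sqm) (a : sq1 free_sqm) : A :=
  cx2 a + U l 1 - U l (cx1 a).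

Lemma fval1 l : fval l 1 = 0.
Proof. by rewrite /fval cx21 cx11 /= coc11; zmod. Qed.

Lemma fval_inj l a a' : l * sbd a = l * sbd a' -> fval l a = fval l a' -> a = a'.
Proof.
move=> /mulgI aa; rewrite /fval -[cx1 a]/(sbd a) aa => H.
by apply: cx_eq => //; zlin H.
Qed.

Lemma fvalM l a a' : fval l (a * a') = fval l a + fval (l * sbd a) a'.
Proof.
rewrite /fval cx2M cx1M /=; have a1 : dom (cx1 a) := cx_dom a.
have a1' : dom (cx1 a') := cx_dom a'.
have H := UP l (cx1 a) (cx1 a'); rewrite -/(h _ _ _) hx11 // in H.
rewrite (Ux1 (l * cx1 a)) rho_dom //.
by zlin (esym H).
Qed.

Lemma fval_br l x y : fval l (sbr x y) = b x y.
Proof. by rewrite /fval /= /fbr cx2_mk cx1_mk addrK. Qed.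

(** This is naturality of the constraints given by [U]. Four instances of [UP] leave associators
    with an argument in [dom], all computed above; the bracket in the action contributes the
    symmetry computed in [com1x]. *)
Lemma fval_tns l l' a a' :
  fval (l * l') (sact a l' * a') + U (l * sbd a) (l' * sbd a') =
  fval l a + fval l' a' + U l l'.
Proof.
have a1 : dom (cx1 a) := cx_dom a; have a1' : dom (cx1 a') := cx_dom a'.
rewrite /fval /sact !cx2M !cx1M /= /fbr cx1_mk cx2_mk mulg1.
move: (cx1 a) (cx1 a') (cx2 a) (cx2 a') a1 a1' => s t p q s1 t1.
have H1 := UP l s (l' * t); have H2 := UP l l' (s * t).
have H3 := UP s l' t; have H4 := UP l' s t.
rewrite (free_abC l' s) in H4.
have E0 : l' * (s * t) = s * (l' * t) by rewrite !mulgA (free_abC l').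
rewrite E0 in H2; rewrite -/(h _ _ _) hx1y // in H1.
rewrite -/(h _ _ _) hxy1 in H2; last exact: domM.
rewrite -/(h _ _ _) h1x1 // in H3; rewrite -/(h _ _ _) hx11 // in H4.
have lamE : lam (l' * t) = lam l'.
  by apply: ph_lun_linked; apply/r_cancel.
rewrite lamE in H1; rewrite /b com1x // (Udom1 s1) (Ux1 l) (Ux1 l') (Ux1 (l * l')).
zlin (congr2 +%R (congr2 +%R (esym H1) H2) (congr2 +%R H3 (esym H4))).
Qed.

Let psi_ex (k l : gamma free_sqm) (u : hom k l) :
  exists f : hom (r k) (r l), ν f = fval l (gval u).
Proof.
apply: ph_surj; have := gvalP u; rewrite /= => <-.
by apply/r_cancel; apply: (cx_dom (gval u)).
Qed.

Let psi_map (k l : gamma free_sqm) (u : hom k l) : hom (r k) (r l) :=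
  sval (cid (psi_ex u)).

Let psiE (k l : gamma free_sqm) (u : hom k l) : ν (psi_map u) = fval l (gval u).
Proof. exact: (proj2_sig (cid (psi_ex u))). Qed.

Program Definition free_functor : functor (gamma free_sqm) P :=
  {| fob := fun k : gamma free_sqm => r k; fmap := psi_map |}.
Next Obligation.
by move=> k; apply: (@ph_inj _ V); rewrite psiE ph1 fval1.
Qed.
Next Obligation.
move=> k l s g f; apply: (@ph_inj _ V); rewrite phM !psiE gval_cmp fvalM.
by rewrite gvalP.
Qed.

Lemma free_functorE (k l : gamma free_sqm) (u : hom k l) :
  ν (fmap free_functor u) = fval l (gval u).
Proof. exact: psiE. Qed.

Let mult_ex (x y : L) :
  exists f : hom (r x ⊗ r y) (r (x * y)), ν f = U x y - m (r x) (r y).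
Proof. exact/ph_surj/linked_sym/rM. Qed.

Let mult (x y : L) := sval (cid (mult_ex x y)).

Let multE x y : ν (mult x y) = U x y - m (r x) (r y).
Proof. exact: (proj2_sig (cid (mult_ex x y))). Qed.

(** The phase is forced by the unit axioms, in view of [U1x] and [Ux1]. *)
Let unit_ex : exists f : hom unt (r 1), ν f = kap - U 1 1.
Proof. exact/ph_surj/linked_sym. Qed.

Let unitE : ν (sval (cid unit_ex)) = kap - U 1 1.
Proof. exact: (proj2_sig (cid unit_ex)). Qed.

Program Definition free_tensor : tensor_functor (gamma free_sqm) P :=
  {| tff := free_functor;
     tmult := mult;
     tunit := sval (cid unit_ex) |}.
Next Obligation.
move=> x x' y y' f g; apply: (@ph_inj _ V).
rewrite !phM ph_tns !free_functorE !multE gval_tns.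
have := fval_tns x' y' (gval f) (gval g); rewrite !gvalP => H.
by zlin (esym H).
Qed.
Next Obligation.
move=> x y z; apply: (@ph_inj _ V).
rewrite !phM !ph_tns !free_functorE !multE gval_ass fval1 !ph1.
by have := UP x y z; rewrite /ph_ass => H; zlin H.
Qed.
Next Obligation.
move=> x; apply: (@ph_inj _ V).
rewrite !phM !ph_tns free_functorE fval1 multE unitE ph1.
by rewrite /= (U1x x) /lam /ph_lun; zmod.
Qed.
Next Obligation.
move=> x; apply: (@ph_inj _ V).
rewrite !phM !ph_tns free_functorE fval1 multE unitE ph1.
by rewrite /= (Ux1 x) /rho /ph_run; zmod.
Qed.
Next Obligation.
move=> x y; apply: (@ph_inj _ V).
rewrite !phM free_functorE gval_com fval_br !multE /b /ph_com.
by zmod.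
Qed.

Lemma free_tensor_mult x y : ν (tmult free_tensor x y) = U x y - m (r x) (r y).
Proof. exact: multE. Qed.

(** With [fval_inj], this is full faithfulness of [free_tensor]: phases parametrize the morphisms
    between objects with isomorphic images. *)
Lemma free_ex (k l : L) (a : A) : linked (r k) (r l) ->
  exists e : sq1 free_sqm, l * sbd e = k /\ fval l e = a.
Proof.
move=> kl; have kldom : dom (l^-1 * k) by apply/(r_cancel l); rewrite mulVKg.
exists (@cx_mk free_data (l^-1 * k) (a - U l 1 + U l (l^-1 * k)) kldom).
by split; [exact: mulVKg | rewrite /fval cx2_mk cx1_mk; zmod].
Qed.

Lemma fval_brE l x y :
  fval l (sbr x y) = U x y - U y x + ph_com V (r y) (r x).
Proof. exact: fval_br. Qed.

Lemma fval_mull l l' a :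
  fval (l * l') a + U l (l' * sbd a) = fval l' a + U l l'.
Proof.
have := fval_tns l l' 1 a; rewrite sact1 mul1g sbd1 mulg1 fval1 => H.
by zlin H.
Qed.

Lemma fval_mulr l l' a :
  fval (l * l') (sact a l') + U (l * sbd a) l' = fval l a + U l l'.
Proof.
have := fval_tns l l' a 1; rewrite mulg1 sbd1 mulg1 fval1 => H.
by zlin H.
Qed.

End EssSurj.

(** * Lifting a determinant functor along the free tensor functor *)

Section Lift.
Variables (C : S_category) (P : picard) (det : det_functor C P).
Let V : phase P := picard_phase P.
Notation "'ν' f" := (ph V f) (at level 10, f at level 9).
Notation m := (ph_cor V).
Notation L := (free_ab (C 1%N)).
Variables (r : L -> P) (U : L -> L -> ph_ab V).
Hypothesis r1 : linked (r 1) unt.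
Hypothesis rM : forall k l, linked (r (k * l)) (r k ⊗ r l).
Hypothesis rgen : forall X, linked (r (fa_gen X)) (det X).
Hypothesis UP : forall k l s,
  U k (l * s) + U l s = U (k * l) s + U k l + ph_ass V (r k) (r l) (r s).

Let E : sqm := free_sqm r1 rM UP.
Let fv : sq0 E -> sq1 E -> ph_ab V := fval (r1 := r1) (rM := rM) (UP := UP).
Let pt2 : C 2%N := s0 (s0 (pt C)).

Let q (T : C 2%N) : ph_ab V := ν (det2 det T) + m (det (d0 T)) (det (d2 T)).

(* The phase of the comparison morphisms [r (lX X) -> det X]; this value makes the
   transported determinant functor strict. *)
Let z : ph_ab V := U 1 1 - q pt2.

(** Strictness requires the value 1 at [s0 (pt C)], in place of the generator. *)
Let lX (X : C 1%N) : sq0 E :=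
  if pselect (X = s0 (pt C)) then 1 else fa_gen X.

Let lX_pt : lX (s0 (pt C)) = 1.
Proof. by rewrite /lX; case: pselect. Qed.

Let faces_pt2 : [/\ d0 pt2 = s0 (pt C), d1 pt2 = s0 (pt C) & d2 pt2 = s0 (pt C)].
Proof. by rewrite /pt2 d0s0 d1s0 d2s0 (ptP (d1 _)). Qed.

(** At [s0 (pt C)], the morphism [det2 det pt2] relates the determinant to its own square;
    cancelling one factor makes it isomorphic to the unit. *)
Let lXP X : linked (r (lX X)) (det X).
Proof.
rewrite /lX; case: pselect => [e|_] /=; [rewrite e {e} | exact: rgen].
apply: linked_trans r1 _.
apply: linked_sym; apply: (linked_cancel (x := det (s0 (pt C)))).
have [E0 E1 E2] := faces_pt2.
have := inhabits (det2 det pt2); rewrite E0 E1 E2 => H.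
exact: linked_trans H (linked_sym (inhabits (run _))).
Qed.

Let W_ex (X X' : wcat C 1%N) (u : hom X X') :
  exists e : sq1 E, lX X' * sbd e = lX X /\ fv (lX X') e = ν (fmap det u).
Proof.
apply: free_ex; apply: linked_trans (lXP X) _.
exact: linked_trans (inhabits (fmap det u)) (linked_sym (lXP X')).
Qed.

(** The phase of [det2 det T] transported along comparisons of phase [z]: two occur at the source
    and one at the target, so a single [z] remains. The term in [U] comes from the tensor
    constraint. *)
Let T_ex (T : C 2%N) : exists e : sq1 E,
  lX (d1 T) * sbd e = lX (d0 T) * lX (d2 T) /\
  fv (lX (d1 T)) e = q T + z - U (lX (d0 T)) (lX (d2 T)).
Proof.
apply: free_ex; apply: linked_trans (rM _ _) _.
apply: linked_trans (linked_tns (lXP (d0 T)) (lXP (d2 T))) _.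
exact: linked_trans (inhabits (det2 det T)) (linked_sym (lXP (d1 T))).
Qed.

Let lW (X X' : wcat C 1%N) (u : hom X X') : sq1 E := sval (cid (W_ex u)).
Let lT (T : C 2%N) : sq1 E := sval (cid (T_ex T)).

Let lW_bd (X X' : wcat C 1%N) (u : hom X X') : lX X' * sbd (lW u) = lX X.
Proof. exact: (proj2_sig (cid (W_ex u))).1. Qed.

Let lWE (X X' : wcat C 1%N) (u : hom X X') : fv (lX X') (lW u) = ν (fmap det u).
Proof. exact: (proj2_sig (cid (W_ex u))).2. Qed.

Let lT_bd (T : C 2%N) : lX (d1 T) * sbd (lT T) = lX (d0 T) * lX (d2 T).
Proof. exact: (proj2_sig (cid (T_ex T))).1. Qed.

Let lTE (T : C 2%N) :
  fv (lX (d1 T)) (lT T) = q T + z - U (lX (d0 T)) (lX (d2 T)).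
Proof. exact: (proj2_sig (cid (T_ex T))).2. Qed.

Let fvM l a a' : fv l (a * a') = fv l a + fv (l * sbd a) a'.
Proof. exact: fvalM. Qed.

Let fv_tns l l' a a' :
  fv (l * l') (sact a l' * a') + U (l * sbd a) (l' * sbd a') =
  fv l a + fv l' a' + U l l'.
Proof. exact: fval_tns. Qed.

(** Reduces relations between elements of degree 1 to an equality of boundaries and an additive
    identity of phases. *)
Let fv_inj l a a' : l * sbd a = l * sbd a' -> fv l a = fv l a' -> a = a'.
Proof. exact: fval_inj. Qed.

Let bdM l k s (a a' : sq1 E) : l * sbd a = k -> k * sbd a' = s -> l * sbd (a * a') = s.
Proof. by move=> <- <-; rewrite sbd_mul mulgA. Qed.

Let bd_tns l l' k k' (a a' : sq1 E) : l * sbd a = k -> l' * sbd a' = k' ->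
  l * l' * sbd (sact a l' * a') = k * k'.
Proof.
by move=> <- <-; rewrite sbd_mul sbd_act !mulgA mulgK.
Qed.

Let lT_pt : lT pt2 = 1.
Proof.
have := lTE pt2; have := lT_bd pt2.
have [-> -> ->] := faces_pt2; rewrite lX_pt !mul1g => H0 H.
apply: (fv_inj (l := 1)); first by rewrite H0 sbd1.
by rewrite H /fv fval1 /z; zmod.
Qed.

Let lW_cmp (X Y Z : wcat C 1%N) (g : hom Y Z) (f : hom X Y) :
  lW (g ∘ f) = lW g * lW f.
Proof.
apply: (fv_inj (l := lX Z)).
  by rewrite lW_bd (bdM (lW_bd g) (lW_bd f)).
by rewrite fvM lW_bd !lWE fmapM phM.
Qed.

Let lT_nat (T T' : wcat C 2%N) (f : hom T T') :
  lW (wface (ord1 _) f) * lT T =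
  lT T' * (sact (lW (wface ord0 f)) (lX (d2 (T' : C 2%N))) *
           lW (wface (ord2 _) f)).
Proof.
have bd0 := lW_bd (wface ord0 f); have bd1 := lW_bd (wface (ord1 _) f).
have bd2 := lW_bd (wface (ord2 _) f).
apply: (fv_inj (l := lX (d1 (T' : C 2%N)))).
  by rewrite (bdM bd1 (lT_bd T)) (bdM (lT_bd T') (bd_tns bd0 bd2)).
have := fv_tns (lX (d0 (T' : C 2%N))) (lX (d2 (T' : C 2%N)))
  (lW (wface ord0 f)) (lW (wface (ord2 _) f)).
rewrite !fvM bd0 bd1 bd2 lT_bd !lTE !lWE => H.
have := congr1 (@ph _ V _ _) (det2_nat det f); rewrite !phM ph_tns => H'.
by rewrite /q; zlin (congr2 +%R H' (esym H)).
Qed.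

Let q_ass (T : C 3%N) :
  q (d1 T) + q (d3 T) = q (d2 T) + q (d0 T) +
  ph_ass V (det (d0 (d1 T))) (det (d0 (d3 T))) (det (d2 (d3 T))).
Proof.
have := congr1 (@ph _ V _ _) (det_ass det T).
rewrite !phM !ph_tns !phM !ph_tns !ph_eqm !ph1 => H.
rewrite /q /ph_ass; zlin H.
Qed.

Let lT_ass (T : C 3%N) :
  lT (d1 T) * lT (d3 T) = lT (d2 T) * sact (lT (d0 T)) (lX (d2 (d3 T))).
Proof.
have b0 := lT_bd (d0 T); have b1 := lT_bd (d1 T).
have b2 := lT_bd (d2 T); have b3 := lT_bd (d3 T).
have v0 := lTE (d0 T); have v1 := lTE (d1 T); have v2 := lTE (d2 T).
have v3 := lTE (d3 T); have qT := q_ass T.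
rewrite -(ph_ass_linked V (lXP _) (lXP _) (lXP _)) in qT.
have := UP (lX (d0 (d1 T))) (lX (d0 (d3 T))) (lX (d2 (d3 T))) => H.
rewrite d1d3 in b3 v3; rewrite d1d2 d0d2 -d2d3 in b2 v2.
rewrite -d0d3 -d0d1 in b0 v0.
(* The phases of [lT (d3 T)] and [lT (d0 T)] are known at their own targets; the products require
   them at targets translated on the left and on the right. *)
have M3 := fval_mull (r1 := r1) (rM := rM) (UP := UP) (lX (d0 (d1 T))) (lX (d2 (d1 T))) (lT (d3 T)).
have M0 := fval_mulr (r1 := r1) (rM := rM) (UP := UP) (lX (d1 (d0 T))) (lX (d2 (d3 T))) (lT (d0 T)).
rewrite b3 in M3; rewrite b0 in M0.
apply: (fv_inj (l := lX (d1 (d1 T)))).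
  have b1' : lX (d0 (d1 T)) * lX (d2 (d1 T)) * sbd (lT (d3 T)) =
      lX (d0 (d1 T)) * (lX (d0 (d3 T)) * lX (d2 (d3 T))) by rewrite -mulgA b3.
  have b2' : lX (d1 (d0 T)) * lX (d2 (d3 T)) * sbd (sact (lT (d0 T)) (lX (d2 (d3 T)))) =
      lX (d0 (d1 T)) * (lX (d0 (d3 T)) * lX (d2 (d3 T))).
    by rewrite sbd_act !mulgA mulgK b0.
  by rewrite (bdM b1 b1') (bdM b2 b2').
rewrite (fvM _ (lT (d1 T))) (fvM _ (lT (d2 T))) b1 b2 v1 v2.
rewrite /fv in v3 v0 *; rewrite v3 in M3; rewrite v0 in M0.
by zlin (congr2 +%R (congr2 +%R qT (esym H)) (congr2 +%R M3 (esym M0))).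
Qed.

Let lT_com (X Y : C 1%N) (Z : coproduct X Y)
    (S : sum_simplex Z) (S' : sum_simplex (cp_swap Z)) :
  let sum X Y (Z : coproduct X Y) (S : sum_simplex Z) :=
    lW (ss_d1 S) * lT S *
    (sact (lW (ss_d0 S)) (lX (d2 (S : C 2%N))) * lW (ss_d2 S)) in
  sum X Y Z S = sum Y X (cp_swap Z) S' * sbr (lX X) (lX Y).
Proof.
move=> sum.
have sum_bd X0 Y0 (Z0 : coproduct X0 Y0) (S0 : sum_simplex Z0) :
    lX Z0 * sbd (sum X0 Y0 Z0 S0) = lX Y0 * lX X0.
  exact: bdM (bdM (lW_bd (ss_d1 S0)) (lT_bd S0))
    (bd_tns (lW_bd (ss_d0 S0)) (lW_bd (ss_d2 S0))).
have sumE X0 Y0 (Z0 : coproduct X0 Y0) (S0 : sum_simplex Z0) :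
    fv (lX Z0) (sum X0 Y0 Z0 S0) =
    ν (det_sum (det2 det) S0) + m (det Y0) (det X0) + z - U (lX Y0) (lX X0).
  rewrite /sum fvM (bdM (lW_bd (ss_d1 S0)) (lT_bd S0)) fvM lW_bd lWE lTE.
  have := fv_tns (lX (d0 (S0 : C 2%N))) (lX (d2 (S0 : C 2%N)))
    (lW (ss_d0 S0)) (lW (ss_d2 S0)).
  rewrite (lW_bd (ss_d0 S0)) (lW_bd (ss_d2 S0)) !lWE => H.
  by rewrite /det_sum !phM ph_tns /q; zlin H.
apply: (fv_inj (l := lX Z)).
  rewrite sum_bd (bdM (sum_bd _ _ _ S') (s := lX Y * lX X)) //.
  by rewrite sbd_br -commg_mulgC.
have E' : fv (lX Z) (sum Y X (cp_swap Z) S') = _ := sumE _ _ _ S'.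
rewrite fvM sumE E' /fv fval_brE.
have H : ν (det_sum (det2 det) S) =
    ν (det_sum (det2 det) S') + ν (com (det Y) (det X)).
  by rewrite (det_com det S S'); apply: phM.
have := ph_com_linked V (lXP Y) (lXP X); rewrite /ph_com => H'.
by rewrite /ph_com; zlin (congr2 +%R H (esym H')).
Qed.

Let lmodel : model C E :=
  @Model C E lX lW lT lW_bd lT_bd lX_pt lT_pt lW_cmp lT_nat lT_ass lT_com.

Let phi := model_hom lmodel.
Let psi : tensor_functor (gamma E) P := free_tensor r1 rM UP.
Let psi_phi : tensor_functor (gamma (Dsqm C)) P := comp_tensor psi (gamma_hom phi).

Let phiX X : sf0 phi (dX X) = lX X. Proof. exact: (model_homX lmodel). Qed.

Let iso_ex X : exists f : hom (psi_phi (dX X)) (det X), ν f = z.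
Proof. by apply: ph_surj; have := lXP X; rewrite -(phiX X). Qed.

Let iso X := sval (cid (iso_ex X)).

Let isoE X : ν (iso X) = z.
Proof. exact: (proj2_sig (cid (iso_ex X))). Qed.

(** All components have phase [z]. They cancel in the naturality condition; in the additivity, one
    component faces two, and the [z] in [lTE] makes up the difference. *)
Program Definition lift_iso : det_mor (comp_det psi_phi (det_univ C)) det :=
  {| dmt := iso |}.
Next Obligation.
move=> X Y f; apply: (@ph_inj _ V); rewrite !phM !isoE.
have -> : ν (fmap (comp_det psi_phi (det_univ C)) f) = fv (lX Y) (lW f).
  apply: etrans (congr2 fv (phiX Y) (model_homW lmodel f)).
  exact: free_functorE.
by rewrite lWE addrC.
Qed.
Next Obligation.
move=> T; apply: (@ph_inj _ V); rewrite !phM ph_tns !isoE.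
have E2 : ν (fmap psi_phi (det2 (det_univ C) T)) = fv (lX (d1 T)) (lT T).
  apply: etrans (congr2 fv (phiX (d1 T)) (model_homT lmodel T)).
  exact: free_functorE.
have E3 : ν (fmap psi (tmult (gamma_hom phi) (dX (d0 T)) (dX (d2 T)))) +
      ν (tmult psi (sf0 phi (dX (d0 T))) (sf0 phi (dX (d2 T)))) =
    U (lX (d0 T)) (lX (d2 T)) - m (psi_phi (dX (d0 T))) (psi_phi (dX (d2 T))).
  have -> : ν (fmap psi (tmult (gamma_hom phi) (dX (d0 T)) (dX (d2 T)))) = 0.
    by apply: etrans; [exact: free_functorE | exact: fval1].
  rewrite add0r; apply: etrans; first exact: free_tensor_mult.
  by congr (U _ _ - _); apply: phiX.
rewrite E2 E3 lTE /q; zmod.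
Qed.

End Lift.

Lemma det_univ_universal (C : S_category) : is_universal (det_univ C).
Proof.
move=> P; apply: (ff_equivalence (@precomp_det_ff C P)) => det.
have [r [U [r1 rM rg UP]]] := free_ab_tensor (picard_phase P) (fun X : C 1%N => det X).
by eexists; exists (lift_iso r1 rM rg UP); apply: Det_groupoid.
Qed.

Local Close Scope group_scope.
Local Close Scope ring_scope.

Theorem theorem4p3p4 (C : S_category) :
  exists (det : det_functor C (gamma (Dsqm C))) (detS : is_strict det),
    [/\ forall X : C 1, det X = dX X,
        forall (X X' : wcat C 1) (f : hom X X'),
          gpair (fmap det f) = (dX X', dW f),
        forall D : C 2, gpair (det2 det D) = (dX (d1 D), dT D),
        is_universal det &
        forall E : sqm, is_isomorphism (gamma_det E detS)].
Proof.
exists (det_univ C), (@det_univ_strict C); split=> //.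
- exact: det_univ_universal.
- exact: gamma_det_isomorphism.
Qed.
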